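(* Let $n$ be a positive integer. The set of wheel polynomials $\{D_\pi \mid \pi\in\mathrm{NC}_n\}$ is a $\mathbb{Q}(q)$-basis of $W_n[z]$. Further, for every $\pi\in\mathrm{NC}_n$, $\Psi_\pi$ is a $\mathbb{Q}(q)$-linear combination of the $D_\tau$ with $\tau\in\mathrm{NC}_n$, $\tau\le\pi$, and the coefficient of $D_\pi$ is $1$.
   Context: Noncrossing matchings: $\mathrm{NC}_n$ is the set of noncrossing matchings of size $n$, i.e. of systems of $n$ pairwise noncrossing arches above a line on $2n$ points labelled $1,\dots,2n$ from left to right, each point being an endpoint of exactly one arch. $()_n\in\mathrm{NC}_n$ is the matching consisting of $n$ nested arches. For $\pi\in\mathrm{NC}_n$, the Young diagram $\lambda(\pi)$ is the area between two lattice paths with the same endpoints: the first consists of $n$ north-steps followed by $n$ east-steps; the second is obtained by reading the labels $1,\dots,2n$ in order, drawing a north-step for a left endpoint of an arch and an east-step otherwise. The map $\pi\mapsto\lambda(\pi)$ is a bijection from $\mathrm{NC}_n$ to the Young diagrams (partitions $(\lambda_1,\dots,\lambda_l)$, $\lambda_r$ the number of boxes in the $r$-th row from the top) whose $r$-th row has at most $n-r$ boxes for $1\le r\le n$. Partial order: $\sigma\le\pi$ iff $\lambda(\sigma)\subseteq\lambda(\pi)$. The box in row $r$ and column $c$ lies on the diagonal labelled $n+c-r$. Write $\sigma\nearrow_j\pi$ if $\lambda(\pi)$ is obtained from $\lambda(\sigma)$ by adding one box on the $j$-th diagonal ($2\le j\le 2n-2$). Operators $e_j$ on matchings: for $1\le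 j\le 2n$, $e_j:\mathrm{NC}_n\to\mathrm{NC}_n$; $e_j(\pi)$ is obtained from $\pi$ by deleting the arches incident to $j$ and $j+1$ and adding an arch between $j$ and $j+1$ and an arch between the points formerly connected to $j$ and $j+1$ (if $j,j+1$ are connected in $\pi$, then $e_j(\pi)=\pi$); $2n+1$ is identified with $1$. $e_j^{-1}(\sigma)$ denotes the preimage of $\sigma$ in $\mathrm{NC}_n$. Wheel polynomials: $q$ is a variable. $W_n[z]$ is the $\mathbb{Q}(q)$-vector space of homogeneous polynomials $p\in\mathbb{Q}(q)[z_1,\dots,z_{2n}]$ of degree $n(n-1)$ satisfying $p(z_1,\dots,z_{2n})|_{q^4z_i=q^2z_j=z_k}=0$ for all $1\le i<j<k\le 2n$. Operators on polynomials: for $1\le k\le 2n$ (with $z_{2n+1}:=z_1$), $\mathbf{S}_k$ interchanges the variables $z_k$ and $z_{k+1}$ in a polynomial, and $\mathbf{D}_k(f)=\frac{qz_k-q^{-1}z_{k+1}}{z_{k+1}-z_k}(\mathbf{S}_k(f)-f)$. The polynomials $\Psi_\pi$: $\Psi_{()_n}:=(q-q^{-1})^{-n(n-1)}\prod_{1\le i<j\le n}(qz_i-q^{-1}z_j)(qz_{n+i}-q^{-1}z_{n+j})$, and whenever $\sigma\nearrow_j\pi$, $$\Psi_\pi:=\mathbf{D}_j(\Psi_\sigma)-\sum_{\tau\in e_j^{-1}(\sigma)\setminus\{\sigma,\pi\}}\Psi_\tau .$$ It is known that this recursion gives well-defined polynomials $\Psi_\pi$ for all $\pi\in\mathrm{NC}_n$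 and that $\{\Psi_\pi\mid\pi\in\mathrm{NC}_n\}$ is a $\mathbb{Q}(q)$-basis of $W_n[z]$. The polynomials $D_\pi$: for $\pi\in\mathrm{NC}_n$ with $\lambda(\pi)=(\lambda_1,\dots,\lambda_l)$, $$D_\pi:=\Big(\prod_{i=1}^{l}\prod_{j=1}^{\lambda_{l+1-i}}\mathbf{D}_{n+(i-l)+(\lambda_{l+1-i}-j)}\Big)(\Psi_{()_n}),$$ where $\prod_{i=1}^N\mathbf{D}_{a_i}$ means $\mathbf{D}_{a_1}\circ\cdots\circ\mathbf{D}_{a_N}$. Equivalently: starting from $\Psi_{()_n}$, read the boxes of $\lambda(\pi)$ row by row from top to bottom, each row from left to right, and successively apply $\mathbf{D}_d$, where $d$ is the label of the diagonal of the box being read. *)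

(* Defs.v *)
From HB Require Import structures.
From mathcomp Require Import all_boot all_order all_fingroup all_algebra.
From mathcomp Require Import fraction mpoly.

Set Implicit Arguments.
Unset Strict Implicit.
Unset Printing Implicit Defensive.

Import GRing.Theory.
Local Open Scope ring_scope.

(* The 2n points (and the variables z_1, ..., z_2n) are indexed by
   'I_(n + n): the point labelled k is the ordinal of value k - 1.  [ordS] is
   the cyclic successor, which realizes the identification of 2n+1 with 1. *)

(* A matching is encoded by the map sending each point to the other endpoint
   of its arch, i.e. by a fixed-point-free involution. *)
Definition is_ncm (n : nat) (m : {ffun 'I_(n + n) -> 'I_(n + n)}) : bool :=
  [&& [forall i, m i != i], [forall i, m (m i) == i] &
      [forall i : 'I_(n + n), forall j : 'I_(n + n),
         ~~ [&& (i < j)%N, (j < m i)%N & (m i < m j)%N]]].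

Record ncm (n : nat) := NCM {
  partner :> {ffun 'I_(n + n) -> 'I_(n + n)};
  _ : is_ncm partner }.

HB.instance Definition _ (n : nat) := [isSub for @partner n].
HB.instance Definition _ (n : nat) := [Finite of ncm n by <:].

Lemma nested_subproof (n : nat) : is_ncm [ffun i : 'I_(n + n) => rev_ord i].
Proof.
apply/and3P; split.
- apply/forallP=> i; rewrite ffunE -val_eqE /=; apply/eqP=> h.
  have := ltn_ord i; move: h; set k := nat_of_ord i => h lt_k.
  have e : ((n + n) = k.+1 + k)%N by rewrite -{2}h subnKC.
  by move: (congr1 odd e); rewrite addSn /= !oddD !addbb.
- by apply/forallP=> i; rewrite !ffunE rev_ordK.
- apply/forallP=> i; apply/forallP=> j; rewrite !ffunE /=.
  apply/negP=> /and3P[lt_ij _]; apply/negP; rewrite -leqNgt.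
  by apply: leq_sub2l; rewrite ltnS ltnW.
Qed.

(* The matching ()_n. *)
Definition nested (n : nat) : ncm n := NCM (nested_subproof n).

Definition is_left (n : nat) (m : ncm n) (i : 'I_(n + n)) : bool :=
  (i < m i)%N.

(* Numbers of north-steps and of east-steps preceding the step at the point i
   in the lattice path of m, i.e. the coordinates at which that step starts. *)
Definition norths (n : nat) (m : ncm n) (i : 'I_(n + n)) : nat :=
  #|[set h : 'I_(n + n) | (h < i)%N && is_left m h]|.
Definition easts (n : nat) (m : ncm n) (i : 'I_(n + n)) : nat :=
  #|[set h : 'I_(n + n) | (h < i)%N && ~~ is_left m h]|.

(* The set of boxes of lambda(m); the box of coordinates (r, c) stands in the
   row r + 1 from the top and in the column c + 1 from the left, i.e. it is the
   unit square [c, c + 1] x [n - r - 1, n - r].  In that column the path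
   N^n E^n runs at height n, hence the box belongs to the area between the two
   paths iff the east-step of the path of m crossing the column is at height at
   most n - r - 1. *)
Definition diagram (n : nat) (m : ncm n) : {set 'I_n * 'I_n} :=
  [set b : 'I_n * 'I_n |
    [exists i : 'I_(n + n),
      [&& ~~ is_left m i, easts m i == b.2 & (norths m i + b.1 < n)%N]]].

(* lambda(m) as the partition (lambda_1, ..., lambda_l) with positive parts. *)
Definition shape (n : nat) (m : ncm n) : seq nat :=
  [seq k <- [seq #|[set c : 'I_n | (r, c) \in diagram m]| | r <- enum 'I_n]
     | (0 < k)%N].

Definition ncle (n : nat) (s p : ncm n) : bool := diagram s \subset diagram p.

(* adds_box j s p: p is obtained from s by adding a box on the diagonal
   labelled j + 1; a box (r, c) as above is on the diagonal n + c - r. *)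
Definition adds_box (n : nat) (j : 'I_(n + n)) (s p : ncm n) : bool :=
  [exists b : 'I_n * 'I_n,
    [&& b \notin diagram s, diagram p == b |: diagram s &
        (j.+1 + b.1 == n + b.2)%N]].

(* The operator e_(j+1), on the underlying involutions. *)
Definition e_op (n : nat) (j : 'I_(n + n))
    (m : {ffun 'I_(n + n) -> 'I_(n + n)}) : {ffun 'I_(n + n) -> 'I_(n + n)} :=
  [ffun i => if i == j then ordS j
             else if i == ordS j then j
             else if i == m j then m (ordS j)
             else if i == m (ordS j) then m j
             else m i].

Definition e_preim (n : nat) (j : 'I_(n + n)) (s : ncm n) : {set ncm n} :=
  [set t : ncm n | e_op j t == s].

Definition Qq : fieldType := {fraction {poly rat}}.
Definition q : Qq := tofrac ('X : {poly rat}).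

Notation pol n := {mpoly Qq[n + n]}.

(* The polynomial p restricted to q^4 z_i = q^2 z_j = z_k, as a polynomial in
   the remaining variables: z_j and z_k are replaced by q^2 z_i and q^4 z_i. *)
Definition wheel_subst (n : nat) (i j k : 'I_(n + n)) (p : pol n) : pol n :=
  p \mPo [tuple if l == j then q ^+ 2 *: 'X_i
                else if l == k then q ^+ 4 *: 'X_i
                else 'X_l | l < n + n].

(* Membership in W_n[z]. *)
Definition wheel (n : nat) (p : pol n) : Prop :=
  p \is (n * n.-1)%N.-homog /\
  forall i j k : 'I_(n + n), (i < j)%N -> (j < k)%N -> wheel_subst i j k p = 0.

Definition S_op (n : nat) (k : 'I_(n + n)) (f : pol n) : pol n :=
  msym (tperm k (ordS k)) f.

Lemma divdiff_ex (n : nat) (k : 'I_(n + n)) (f : pol n) :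
  exists g : pol n, g * ('X_(ordS k) - 'X_k) == S_op k f - f.
Proof.
pose P (f : pol n) := exists g : pol n, g * ('X_(ordS k) - 'X_k) == S_op k f - f.
have P1 : P 1 by exists 0; rewrite /S_op msym1 subrr mul0r.
have PM u v : P u -> P v -> P (u * v).
  move=> [g /eqP gu] [h /eqP hv]; exists (S_op k u * h + g * v); apply/eqP.
  rewrite mulrDl -mulrA hv mulrAC gu /S_op msymM mulrBr mulrBl addrA.
  by rewrite subrK.
have PX i : P 'X_i.
  rewrite /P /S_op /msym mmapX mmap1U.
  case: tpermP => [->|->|_ _].
  - by exists 1; rewrite mul1r.
  - by exists (-1); rewrite mulN1r opprB.
  - by exists 0; rewrite subrr mul0r.
elim/mpolyind: f => [|c m p _ _ [g /eqP gp]].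
  by exists 0; rewrite /S_op msym0 subrr mul0r.
have [h /eqP hm] : P 'X_[m].
  rewrite (mpolyXE _ 1%g); elim/big_ind: _ => // i _.
  by rewrite perm1; elim: (m i) => [|e IHe]; rewrite ?expr0 // exprS; apply: PM.
exists (c *: h + g); apply/eqP.
by rewrite mulrDl -scalerAl hm gp /S_op msymD msymZ scalerBr opprD addrACA.
Qed.

(* (S_k f - f) / (z_(k+1) - z_k); the quotient is unique since polynomials
   form an integral domain. *)
Definition divdiff (n : nat) (k : 'I_(n + n)) (f : pol n) : pol n :=
  xchoose (divdiff_ex k f).

Definition D_op (n : nat) (k : 'I_(n + n)) (f : pol n) : pol n :=
  (q *: 'X_k - q^-1 *: 'X_(ordS k)) * divdiff k f.

(* D_d for a label 1 <= d <= 2n; other values of d never occur below. *)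
Definition D_lab (n : nat) (d : nat) (f : pol n) : pol n :=
  if insub d.-1 is Some k then D_op k f else f.

(* Psi_{()_n} *)
Definition Psi0 (n : nat) : pol n :=
  (q - q^-1) ^- (n * n.-1)%N *:
  \prod_(i < n) \prod_(j < n | (i < j)%N)
    ((q *: 'X_(lshift n i) - q^-1 *: 'X_(lshift n j)) *
     (q *: 'X_(rshift n i) - q^-1 *: 'X_(rshift n j))).

(* The equations defining the family of the polynomials Psi_p. *)
Definition is_Psi (n : nat) (Psi : ncm n -> pol n) : Prop :=
  Psi (nested n) = Psi0 n /\
  forall (s p : ncm n) (j : 'I_(n + n)), adds_box j s p ->
    Psi p = D_op j (Psi s) - \sum_(t in e_preim j s :\: [set s; p]) Psi t.

(* The diagonal n + (i - l) + (lambda_(l+1-i) - j) is computed in nat as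
   (n + i + lambda_(l+1-i)) - (l + j), which never truncates here. *)
Definition D_pol (n : nat) (p : ncm n) : pol n :=
  let lam r := nth 0%N (shape p) r.-1 in
  let l := size (shape p) in
  (\big[(fun f g : pol n -> pol n => f \o g)/idfun]_(1 <= i < l.+1)
    \big[(fun f g : pol n -> pol n => f \o g)/idfun]_(1 <= j < (lam (l.+1 - i)%N).+1)
      @D_lab n (n + i + lam (l.+1 - i) - (l + j))%N) (Psi0 n).

(* The family b is a basis of the subspace of V of predicate W. *)
Definition is_basis (F : fieldType) (V : lmodType F) (W : V -> Prop)
    (I : finType) (b : I -> V) : Prop :=
  [/\ forall i, W (b i),
      forall c : I -> F, \sum_i c i *: b i = 0 -> forall i, c i = 0 &
      forall v, W v -> exists c : I -> F, v = \sum_i c i *: b i].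

(* Main.v *)
Require Import Defs.
From HB Require Import structures.
From mathcomp Require Import all_boot all_order all_fingroup all_algebra.
From mathcomp Require Import fraction mpoly ring zify.

(* Restricting a polynomial f that satisfies the wheel condition in N variables
   to z_a = u, z_b = q^2 u leaves one linear factor in each of the other N - 2
   variables, times a polynomial of the same kind in N - 2 variables.  By
   induction, f = 0 if its degree is below floor((N-1)^2 / 4), which is n(n-1)
   for N = 2n, since otherwise all the binomials z_b - q^2 z_a would divide f.
   In the extremal degree, f is determined by its values at the points given by
   the Dyck words, with z_i = 1 or q^2.  So W_n embeds into the functions on
   NC_n, and the D_p form a basis as soon as they are independent.

   Independence is read off from the coefficients of the monomials whose
   exponents are a rearrangement of 0,...,n-1,0,...,n-1.  These are vertices of
   a polytope containing all the exponents that occur, so D_k acts on their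
   coefficients, and at q = 0 it acts as in the 0-Hecke algebra: reading the
   boxes of a diagram moves the exponents of Psi_0 without ever meeting a tie,
   and D_p has, at q = 0, a single such monomial, which determines p.

   For the expansion of Psi_p, the point is that Psi_t is an eigenvector of D_j
   when j and j+1 are not connected in t, i.e. that it vanishes at
   z_(j+1) = q^2 z_j.  This follows by induction on the diagram from the
   recursion; when the last box added lies on a diagonal next to j, it needs
   the Temperley-Lieb relation satisfied by (q + 1/q) - D_j on W_n.  Hence D_j
   maps the span of the Psi_t with t < s into the span of those with t < p, if
   p is obtained from s by adding a box on the diagonal j, and the transition
   from the D_p to the Psi_p is unitriangular. *)

Set Implicit Arguments.
Unset Strict Implicit.
Unset Printing Implicit Defensive.
Import GRing.Theory.
Local Open Scope ring_scope.

(** * Evaluation and division of polynomials *)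

(** The field being infinite, a polynomial is determined by its values and an affine set of points
    is irreducible. The wheel condition, the divisions and the relation g = D_k f are therefore
    stated on values, and a factor is cancelled by exhibiting one admissible point where it is
    nonzero; powers of q, which are pairwise distinct, provide such points. Each restriction removes
    two variables and fixes z_a = u, so the number of variables has to vary and homogeneity is lost.
    Only a bound on the degree is carried along; homogeneity comes back because f(cz) - c^d f(z) has
    too small a degree to be nonzero. Coefficients in Q(q) cannot be evaluated at q = 0 directly:
    each D_p is first multiplied by a scalar that clears the denominators of its relevant
    coefficients. Independence then follows from a determinant over Q[q] with nonzero value at 0.
    The order in which the boxes are read matters only through the last box, which is always a
    removable corner. *)

Section Evaluation.
Variable F : fieldType.
Implicit Types (N M : nat) (v w x y : nat -> F).

(** Points are indexed by all of [nat], so that one point serves polynomials in different numbers of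
    variables and index shifts need no ordinals. *)
Definition ev N (f : {mpoly F[N]}) v : F := f.@[fun i : 'I_N => v i].

Lemma evD N (f g : {mpoly F[N]}) v : ev (f + g) v = ev f v + ev g v.
Proof. exact: mevalD. Qed.
Lemma evB N (f g : {mpoly F[N]}) v : ev (f - g) v = ev f v - ev g v.
Proof. exact: mevalB. Qed.
Lemma evM N (f g : {mpoly F[N]}) v : ev (f * g) v = ev f v * ev g v.
Proof. exact: mevalM. Qed.
Lemma evZ N c (f : {mpoly F[N]}) v : ev (c *: f) v = c * ev f v.
Proof. exact: mevalZ. Qed.
Lemma evC N c v : ev (c%:MP : {mpoly F[N]}) v = c.
Proof. exact: mevalC. Qed.
Lemma evX N (i : 'I_N) v : ev ('X_i : {mpoly F[N]}) v = v i.
Proof. exact: mevalXU. Qed.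
Lemma ev0 N v : ev (0 : {mpoly F[N]}) v = 0.
Proof. exact: meval0. Qed.
Lemma ev1 N v : ev (1 : {mpoly F[N]}) v = 1.
Proof. exact: meval1. Qed.
Lemma ev_prod N I (r : seq I) (P : pred I) (G : I -> {mpoly F[N]}) v :
  ev (\prod_(i <- r | P i) G i) v = \prod_(i <- r | P i) ev (G i) v.
Proof. by rewrite /ev rmorph_prod. Qed.
Lemma ev_sum N I (r : seq I) (P : pred I) (G : I -> {mpoly F[N]}) v :
  ev (\sum_(i <- r | P i) G i) v = \sum_(i <- r | P i) ev (G i) v.
Proof. by rewrite /ev rmorph_sum. Qed.

Lemma ev_ext N (f : {mpoly F[N]}) v w :
  (forall i, (i < N)%N -> v i = w i) -> ev f v = ev f w.
Proof. by move=> h; apply: meval_eq => i; apply: h. Qed.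

Definition subst N M (g : 'I_N -> {mpoly F[M]}) (f : {mpoly F[N]}) :
  {mpoly F[M]} := f \mPo [tuple g i | i < N].

HB.instance Definition _ N M (g : 'I_N -> {mpoly F[M]}) :=
  GRing.RMorphism.copy (subst g) (comp_mpoly [tuple g i | i < N]).

Lemma substX N M (g : 'I_N -> {mpoly F[M]}) i : subst g 'X_i = g i.
Proof. by rewrite /subst comp_mpolyXU -tnth_nth tnth_mktuple. Qed.

Lemma substC N M (g : 'I_N -> {mpoly F[M]}) c : subst g c%:MP = c%:MP.
Proof. exact: comp_mpolyC. Qed.

Lemma ev_subst N M (g : 'I_N -> {mpoly F[M]}) f v w :
  (forall i, w (val i) = ev (g i) v) -> ev (subst g f) v = ev f w.
Proof.
move=> h; rewrite /ev comp_mpoly_meval; apply: meval_eq => i.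
by rewrite tnth_mktuple h.
Qed.

Lemma rmorph_mpoly_eq N (A : nzRingType) (f g : {rmorphism {mpoly F[N]} -> A}) :
  (forall c, f c%:MP = g c%:MP) -> (forall i, f 'X_i = g 'X_i) -> f =1 g.
Proof.
move=> hC hX p; rewrite (mpolyE p) !rmorph_sum; apply: eq_bigr => m _ /=.
rewrite -mul_mpolyC !rmorphM /= hC (mpolyXE _ 1%g) !rmorph_prod.
by congr (_ * _); apply: eq_bigr => i _; rewrite !rmorphXn /= hX.
Qed.

Lemma subst_id N (f : {mpoly F[N]}) : subst (fun i => 'X_i) f = f.
Proof.
by apply: (rmorph_mpoly_eq (f := subst _) (g := idfun)) => [c|i] /=;
  rewrite ?substC ?substX.
Qed.

Lemma subst_subst N M K (g : 'I_N -> {mpoly F[M]}) (h : 'I_M -> {mpoly F[K]}) f :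
  subst h (subst g f) = subst (fun i => subst h (g i)) f.
Proof.
by apply: (rmorph_mpoly_eq (f := subst h \o subst g) (g := subst _)) => [c|i] /=;
  rewrite ?substC ?substX.
Qed.

(* [msizeM] sees the coefficients as an integral domain, which keeps [lia] from
   identifying its sizes with those of the hypotheses. *)
Lemma msizeMF N (f g : {mpoly F[N]}) : f != 0 -> g != 0 ->
  msize (f * g) = (msize f + msize g).-1.
Proof. exact: msizeM. Qed.

Lemma msizeM_leq N (f g : {mpoly F[N]}) a b :
  (msize f <= a.+1)%N -> (msize g <= b.+1)%N -> (msize (f * g) <= (a + b).+1)%N.
Proof.
move=> fa gb; have [->|f0] := eqVneq f 0; first by rewrite mul0r msize0.
have [->|g0] := eqVneq g 0; first by rewrite mulr0 msize0.
by rewrite msizeMF //; lia.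
Qed.

Lemma msize_subst N M (g : 'I_N -> {mpoly F[M]}) f :
  (forall i, msize (g i) <= 2)%N -> (msize (subst g f) <= msize f)%N.
Proof.
move=> hg; rewrite [in leqLHS](mpolyE f) rmorph_sum /=.
apply: leq_trans (msize_sum _ _ _) _.
apply/bigmax_leqP_seq => m mf _.
rewrite /subst comp_mpolyZ; apply: leq_trans (msizeZ_le _ _) _.
apply: leq_trans (msize_mdeg_lt mf); rewrite comp_mpolyX mdegE.
elim/big_rec2: _ => [|i a p _ IH]; first by rewrite msize1.
apply: msizeM_leq IH.
rewrite tnth_mktuple; elim: (m i) => [|e IHe]; first by rewrite expr0 msize1.
by rewrite exprS -[e.+1]add1n; apply: msizeM_leq.
Qed.

Hypothesis Finf : forall s : seq F, exists t : F, t \notin s.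

Lemma poly_eq0 (p : {poly F}) : (forall t, p.[t] = 0) -> p = 0.
Proof.
move=> h; apply/eqP; apply: contraT => p0.
suff [s us ss] : exists2 s : seq F, uniq s & size s = size p.
  have := max_poly_roots p0 (_ : all (root p) s) us; rewrite ss ltnn; apply.
  by apply/allP => t _; rewrite /root h.
elim: (size p) => [|k [s us ss]]; first by exists [::].
by have [x xs] := Finf s; exists (x :: s); rewrite /= ?xs ?ss.
Qed.

Lemma ev_line N (f : {mpoly F[N]}) x y :
  exists p : {poly F}, forall t, p.[t] = ev f (fun i => x i + t * (y i - x i)).
Proof.
elim/mpolyind: f => [|c m p _ _ [g hg]].
  by exists 0 => t; rewrite horner0 ev0.
have [h hh] : exists h : {poly F}, forall t, h.[t] =
    ev ('X_[m] : {mpoly F[N]}) (fun i => x i + t * (y i - x i)).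
  rewrite (mpolyXE _ 1%g); elim/big_ind: _ => [|u w [g1 h1] [g2 h2]|i _].
  - by exists 1 => t; rewrite hornerE ev1.
  - by exists (g1 * g2) => t; rewrite hornerE h1 h2 evM.
  exists (((x i)%:P + (y i - x i) *: 'X) ^+ (m i)) => t.
  by rewrite perm1 !hornerE /ev rmorphXn /= mevalXU [in LHS]mulrC.
by exists (c *: h + g) => t; rewrite !hornerE hh hg evD evZ.
Qed.

Definition affine (V : (nat -> F) -> Prop) :=
  forall x y t, V x -> V y -> V (fun i => x i + t * (y i - x i)).

(* An affine set of points is irreducible. *)
Lemma density N (V : (nat -> F) -> Prop) (L Q : {mpoly F[N]}) x0 :
  affine V -> (forall v, V v -> ev L v * ev Q v = 0) ->
  V x0 -> ev L x0 != 0 -> forall v, V v -> ev Q v = 0.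
Proof.
move=> hV h Vx0 L0 v Vv.
(* On the line from v to x0 both values are univariate polynomials, with product 0. The one from [L]
   is nonzero at t = 1, so the one from [Q] is 0. *)
have [p hp] := ev_line L v x0; have [r hr] := ev_line Q v x0.
have pr0 : p * r = 0.
  by apply: poly_eq0 => t; rewrite hornerM hp hr h //; apply: hV.
have p0 : p != 0.
  apply: contra_neq L0 => p0; have := hp 1; rewrite p0 horner0 => e.
  by rewrite e; apply: ev_ext => i _; ring.
have r0 : r = 0 by apply/eqP; move/eqP: pr0; rewrite mulf_eq0 (negbTE p0).
have := hr 0; rewrite r0 horner0 => e; rewrite e.
by apply: ev_ext => i _; ring.
Qed.

Definition sub1 N (a : 'I_N) (l : {mpoly F[N]}) (i : 'I_N) : {mpoly F[N]} :=
  if i == a then l else 'X_i.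

(** Division by a linear form: the property passes to products and linear combinations, so it
    suffices to treat the variables. *)
Lemma factor_ex N (a : 'I_N) l (f : {mpoly F[N]}) :
  exists h : {mpoly F[N]}, f = subst (sub1 a l) f + ('X_a - l) * h.
Proof.
pose P (f : {mpoly F[N]}) := exists h : {mpoly F[N]}, f = subst (sub1 a l) f + ('X_a - l) * h.
have PM (f1 f2 : {mpoly F[N]}) : P f1 -> P f2 -> P (f1 * f2).
  move=> [g gu] [h hv]; exists (subst (sub1 a l) f1 * h + g * f2).
  rewrite rmorphM /=; move: (subst _ f1) (subst _ f2) gu hv => A B -> ->.
  by ring.
elim/mpolyind: f => [|c m p _ _ [g gp]].
  by exists 0; rewrite rmorph0 mulr0 addr0.
have [h hm] : P 'X_[m].
  rewrite (mpolyXE _ 1%g); elim/big_ind: _ => // [|i _].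
    by exists 0; rewrite rmorph1 mulr0 addr0.
  rewrite perm1; elim: (m i) => [|e IHe].
    by exists 0; rewrite expr0 rmorph1 mulr0 addr0.
  rewrite exprS; apply: PM => //; rewrite /P substX /sub1.
  by case: eqP => [->|_]; [exists 1; ring | exists 0; ring].
exists (c *: h + g); rewrite -!mul_mpolyC rmorphD rmorphM /= substC.
by move: (subst _ 'X_[m]) (subst _ p) hm gp => A B -> ->; ring.
Qed.

Lemma msize_lin N (a : 'I_N) (l : {mpoly F[N]}) :
  (msize l <= 2)%N -> l@_U_(a) = 0 -> msize ('X_a - l) = 2%N.
Proof.
move=> sl la; apply/eqP; rewrite eqn_leq; apply/andP; split.
  apply: leq_trans (msizeD_le _ _) _.
  by rewrite msizeN geq_max sl msizeX mdeg1.
rewrite -(mdeg1 a); apply: msize_mdeg_lt.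
by rewrite mcoeff_msupp mcoeffB mcoeffXU eqxx la subr0 oner_eq0.
Qed.

Lemma msize_mulr_lin N (a : 'I_N) (l h p : {mpoly F[N]}) :
  (msize l <= 2)%N -> l@_U_(a) = 0 -> p = ('X_a - l) * h ->
  msize h = (msize p).-1.
Proof.
move=> sl la ->; have s2 := msize_lin sl la.
have [->|h0] := eqVneq h 0; first by rewrite mulr0 msize0.
rewrite msizeMF ?s2 // -msize_poly_eq0 s2 //.
Qed.

(** The quotient of f by z_a is smaller and vanishes wherever z_a does not, hence everywhere by
    density; by induction it is 0. So f involves no variable and equals its value at the origin. *)
Lemma ev_eq0 N (f : {mpoly F[N]}) : (forall v, ev f v = 0) -> f = 0.
Proof.
have [k] := ubnP (msize f); elim: k f => // k IH f sf h.
have sub_id (a : 'I_N) : subst (sub1 a 0) f = f.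
  have [g gf] := factor_ex a 0 f.
  suff g0 : g = 0 by rewrite [RHS]gf g0 mulr0 addr0.
  have [//|g0] := eqVneq g 0; apply: IH; last first.
    move=> v; apply: (@density _ (fun=> True) 'X_a g (fun=> 1)) => //.
    - move=> w _; have := h w; rewrite gf evD evM evB evX ev0 subr0.
      rewrite (@ev_subst _ _ _ _ _ (fun i => if i == a :> nat then 0 else w i)).
        by rewrite h add0r.
      by move=> i; rewrite /sub1 -val_eqE; case: ifP => _; rewrite ?ev0 ?evX.
    - by rewrite evX oner_eq0.
  have le : (msize (f - subst (sub1 a 0) f) <= msize f)%N.
    apply: leq_trans (msizeD_le _ _) _; rewrite msizeN geq_max leqnn /=.
    apply: msize_subst => i; rewrite /sub1.
    by case: ifP => _; rewrite ?msize0 // msizeX mdeg1.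
  have e : f - subst (sub1 a 0) f = ('X_a - 0) * g by rewrite {1}gf; ring.
  have := msize_mulr_lin _ _ e; rewrite msize0 mcoeff0 => /(_ isT erefl) sg.
  by move: g0; rewrite -msize_poly_eq0; lia.
have sub_ids (r : seq 'I_N) :
    subst (fun i => if i \in r then 0 else 'X_i) f = f.
  elim: r => [|a r IHr]; first exact: subst_id.
  rewrite -{2}IHr -{2}(sub_id a) subst_subst; congr (_ \mPo _).
  apply: eq_mktuple => i; rewrite in_cons /sub1; case: eqP => _ /=.
    by rewrite rmorph0.
  by rewrite substX.
have e : subst (fun=> 0) f = f.
  rewrite -[RHS](sub_ids (enum 'I_N)); congr (_ \mPo _).
  by apply: eq_mktuple => i; rewrite mem_enum.
rewrite -e -[RHS](mpolyC0 N) -(h (fun=> 0)).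
apply: (rmorph_mpoly_eq (f := subst (fun=> 0))
  (g := @mpolyC N F \o @meval N F (fun=> 0))) => [c|i] /=.
  by rewrite substC mevalC.
by rewrite substX mevalXU mpolyC0.
Qed.
End Evaluation.

(** * The wheel condition *)

(* The minimal degree of a nonzero polynomial in N variables satisfying the
   wheel condition; it is n(n-1) for N = 2n. *)
Definition wheel_deg N := (N./2 * (uphalf N).-1)%N.

(** The increment is the number of linear factors split off when two variables are specialized: one
    for each remaining variable. *)
Lemma wheel_degSS N : wheel_deg N.+2 = (wheel_deg N + N)%N.
Proof.
rewrite /wheel_deg /=; have := odd_double_half N; have := uphalf_half N.
by case: (odd N) => /= ->; case: (N./2) => [|h] /=; rewrite -?muln2; nia.
Qed.

(** Meant for a < b: the coordinates x, y are inserted at positions a, b. The function [emb] below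
    enumerates the other positions increasingly. *)
Definition ins (T : Type) (a b : nat) (x y : T) (v : nat -> T) (i : nat) : T :=
  if i == a then x else if i == b then y else v (i - (a < i) - (b < i))%N.

Definition emb (a b k : nat) : nat :=
  if (k < a)%N then k else if (k.+1 < b)%N then k.+1 else k.+2.

Lemma ins_emb T a b (x y : T) v k : (a < b)%N -> ins a b x y v (emb a b k) = v k.
Proof.
move=> ab; rewrite /emb; case: ltnP => ?; [|case: ltnP => ?]; rewrite /ins.
all: do 2 (case: eqP => [?|_]; first by exfalso; lia).
all: by congr (v _); lia.
Qed.

Lemma emb_homo a b k l : (a < b)%N -> (k < l)%N -> (emb a b k < emb a b l)%N.
Proof. by rewrite /emb; repeat case: ifP => ?; lia. Qed.

Lemma emb_lt M a b k : (b < M.+2)%N -> (k < M)%N -> (emb a b k < M.+2)%N.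
Proof. by rewrite /emb; repeat case: ifP => ?; lia. Qed.

Lemma ins_id T a b (v : nat -> T) i : (a < b)%N ->
  ins a b (v a) (v b) (fun k => v (emb a b k)) i = v i.
Proof.
move=> ab; rewrite /ins; case: eqP => [->//|?]; case: eqP => [->//|?].
by congr (v _); rewrite /emb; repeat case: ifP => ?; lia.
Qed.

Section Wheel.
Variables (F : fieldType) (q : F).
Hypothesis q_neq0 : q != 0.
Hypothesis q_nroot : forall k, q ^+ k.+1 != 1.
Implicit Types (N M : nat) (v w x y : nat -> F).

Lemma expq_inj : injective (GRing.exp q).
Proof.
have wl i j : (i < j)%N -> q ^+ i = q ^+ j -> False.
  move=> ij e; have /eqP[] := q_nroot (j - i).-1.
  rewrite prednK ?subn_gt0 //; apply: (mulfI (expf_neq0 i q_neq0)).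
  by rewrite -exprD subnKC ?mulr1 // ltnW.
by move=> i j e; case: (ltngtP i j) => // /wl; [move/(_ e) | move/(_ (esym e))].
Qed.

Lemma q_inf (s : seq F) : exists t : F, t \notin s.
Proof.
have [/allP h|] := boolP (all (mem s) [seq q ^+ i | i <- iota 0 (size s).+1]).
  have := uniq_leq_size (s2 := s) _ h.
  by rewrite (map_inj_uniq expq_inj) iota_uniq => /(_ isT); rewrite size_map size_iota ltnn.
by rewrite -has_predC => /hasP[x _ xs]; exists x.
Qed.

Lemma q2_neq1 : q ^+ 2 != 1. Proof. exact: q_nroot. Qed.
Lemma q4_neq1 : q ^+ 4 != 1. Proof. exact: q_nroot. Qed.

Definition wheelp N (f : {mpoly F[N]}) := forall v i j k,
  (i < j)%N -> (j < k)%N -> (k < N)%N ->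
  v j = q ^+ 2 * v i -> v k = q ^+ 4 * v i -> ev f v = 0.

Definition wplane i j k v := v j = q ^+ 2 * v i /\ v k = q ^+ 4 * v i.

Lemma wplane_affine i j k : affine (wplane i j k).
Proof. by move=> x y t [x1 x2] [y1 y2]; split; rewrite ?x1 ?x2 ?y1 ?y2; ring. Qed.

Lemma hplane_affine k (c : F) : affine (fun v => v k = c).
Proof. by move=> x y t -> ->; ring. Qed.

Lemma pair_affine a b (c : F) : affine (fun v => v b = c * v a).
Proof. by move=> x y t -> ->; ring. Qed.

(** Supplies the generic point of a wheel plane at which products of factors z_l - c_l can be
    cancelled. *)
Lemma wplane_point i j k (s : seq F) : (i < j)%N -> (j < k)%N ->
  exists2 x, wplane i j k x & forall l, x l \notin s.
Proof.
move=> ij jk.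
have [t] := q_inf (s ++ [seq r / q ^+ 2 | r <- s] ++ [seq r / q ^+ 4 | r <- s]).
rewrite !mem_cat !negb_or => /and3P[t0 t2 t4].
have scal e : t \notin [seq r / q ^+ e | r <- s] -> q ^+ e * t \notin s.
  apply: contra => h; apply/mapP; exists (q ^+ e * t) => //.
  by rewrite mulrAC mulfV ?mul1r // expf_neq0.
exists (fun l => if l == j then q ^+ 2 * t else if l == k then q ^+ 4 * t else t).
  by split; rewrite !eqxx; repeat case: ifP => ? //; lia.
by move=> l; repeat case: ifP => _ //; apply: scal.
Qed.

Lemma factor_hplane N (f : {mpoly F[N]}) (k : 'I_N) c :
  (forall v, v k = c -> ev f v = 0) ->
  exists2 h : {mpoly F[N]}, f = ('X_k - c%:MP) * h & msize h = (msize f).-1.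
Proof.
move=> hf; have [h fh] := factor_ex k c%:MP f.
have e0 : subst (sub1 k c%:MP) f = 0.
  apply: (ev_eq0 q_inf) => v.
  rewrite (@ev_subst _ _ _ _ _ _ (fun i => if i == k :> nat then c else v i)).
    by apply: hf; rewrite eqxx.
  by move=> i; rewrite /sub1 -val_eqE; case: ifP => _; rewrite ?evC ?evX.
rewrite e0 add0r in fh; exists h => //; apply: msize_mulr_lin fh.
  by rewrite msizeC; case: eqP.
by rewrite mcoeffC mnm1_eq0 mulr0.
Qed.

Lemma factor_pair N (f : {mpoly F[N]}) (a b : 'I_N) c : a != b ->
  (forall v, v b = c * v a -> ev f v = 0) ->
  exists2 h : {mpoly F[N]}, f = ('X_b - c *: 'X_a) * h & msize h = (msize f).-1.
Proof.
move=> ab hf; have [h fh] := factor_ex b (c *: 'X_a) f.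
have e0 : subst (sub1 b (c *: 'X_a)) f = 0.
  apply: (ev_eq0 q_inf) => v.
  rewrite (@ev_subst _ _ _ _ _ _ (fun i => if i == b :> nat then c * v a else v i)).
    by apply: hf; rewrite eqxx; case: ifP => // /eqP/val_inj e; rewrite e eqxx in ab.
  by move=> i; rewrite /sub1 -val_eqE; case: ifP => _; rewrite ?evZ ?evX.
rewrite e0 add0r in fh; exists h => //; apply: msize_mulr_lin fh.
  by apply: leq_trans (msizeZ_le _ _) _; rewrite msizeX mdeg1.
by rewrite mcoeffZ mcoeffXU (negbTE ab) mulr0.
Qed.

Definition hprod M (c v : nat -> F) := \prod_(k < M) (v k - c k).

Lemma hprod_neq0 M (c v : nat -> F) :
  (forall k, (k < M)%N -> v k != c k) -> hprod M c v != 0.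
Proof. by move=> h; apply/prodf_neq0 => k _; rewrite subr_eq0 h. Qed.

Definition avoids M (c x : nat -> F) := forall k, (k < M)%N -> x k != c k.

Lemma avoids_seq M (c x : nat -> F) :
  (forall l, x l \notin [seq c i | i <- iota 0 M]) -> avoids M c x.
Proof.
move=> h k kM; apply: contraNneq (h k) => ->.
by apply/mapP; exists k; rewrite ?mem_iota.
Qed.

Lemma hprod_cancel M (c : nat -> F) (Q : {mpoly F[M]}) (V : (nat -> F) -> Prop) x :
  affine V -> V x -> avoids M c x ->
  (forall v, V v -> hprod M c v * ev Q v = 0) -> forall v, V v -> ev Q v = 0.
Proof.
move=> aV Vx cx h.
pose L : {mpoly F[M]} := \prod_(k < M) ('X_k - (c k)%:MP).
have hL v : ev L v = hprod M c v.
  by rewrite ev_prod; apply: eq_bigr => k _; rewrite evB evX evC.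
apply: (density q_inf aV (L := L) _ Vx) => [v Vv|]; first by rewrite hL; apply: h.
by rewrite hL hprod_neq0.
Qed.

Lemma factor_hplanes M (g : {mpoly F[M]}) (c : nat -> F) :
  (forall k v, (k < M)%N -> v k = c k -> ev g v = 0) ->
  exists2 Q : {mpoly F[M]}, forall v, ev g v = hprod M c v * ev Q v &
    (msize Q <= msize g - M)%N.
Proof.
move=> hg.
suff H r : (r <= M)%N -> exists2 Q : {mpoly F[M]}, forall v,
    ev g v = \prod_(k < M | (k < r)%N) (v k - c k) * ev Q v &
    (msize Q <= msize g - r)%N.
  have [Q hQ sQ] := H M (leqnn M); exists Q => // v.
  rewrite hQ /hprod; congr (_ * _).
  by apply: eq_bigl => k; rewrite ltn_ord.
elim: r => [|r IHr] rM.
  by exists g; rewrite ?subn0 // => v; rewrite big_pred0 ?mul1r.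
have [Q hQ sQ] := IHr (ltnW rM).
have [|h Qh sh] := @factor_hplane _ Q (Ordinal rM) (c r).
  have [t ts] := q_inf [seq c i | i <- iota 0 M].
  pose x k := if k == r then c r else t.
  pose L : {mpoly F[M]} := \prod_(k < M | (k < r)%N) ('X_k - (c k)%:MP).
  have hL v : ev L v = \prod_(k < M | (k < r)%N) (v k - c k).
    by rewrite ev_prod; apply: eq_bigr => k _; rewrite evB evX evC.
  apply: (density q_inf (@hplane_affine r (c r)) (L := L) (x0 := x)).
  - by move=> v vr; rewrite hL -hQ (hg r).
  - by rewrite /x eqxx.
  rewrite hL; apply/prodf_neq0 => k kr; rewrite /x ltn_eqF // subr_eq0.
  by apply: contraNneq ts => ->; apply/mapP; exists (k : nat); rewrite ?mem_iota /=.
exists h; last by rewrite sh; lia.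
move=> v; rewrite hQ Qh evM evB evX evC mulrA; congr (_ * _).
rewrite [RHS](bigD1 (Ordinal rM)) //= mulrC; congr (_ * _).
apply: eq_bigl => k; rewrite -val_eqE /=; lia.
Qed.

Definition polX M k : {mpoly F[M]} := if insub k is Some i then 'X_i else 0.

Lemma ev_polX M k v : (k < M)%N -> ev (polX M k) v = v k.
Proof. by move=> kM; rewrite /polX insubT evX. Qed.

(* The value of the k-th remaining variable at which a polynomial restricted to
   z_a = u, z_b = q^2 u vanishes: outside of [a, b] it completes a wheel triple. *)
Definition hval a b (u : F) k : F :=
  if (k < a)%N then q ^- 2 * u else if (k.+1 < b)%N then q ^+ 2 * u
  else q ^+ 4 * u.

(** For positions outside of [a, b] the vanishing at [hval] is the wheel condition; for those
    strictly between, where no wheel triple arises, it is the last hypothesis, which an induction on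
    b - a provides. *)
Lemma restr_factor M (f : {mpoly F[M.+2]}) a b u : wheelp f ->
  (a < b)%N -> (b < M.+2)%N ->
  (forall k v, (a < k)%N -> (k < b)%N -> v k = q ^+ 2 * v a -> ev f v = 0) ->
  exists Q : {mpoly F[M]}, [/\ wheelp Q, (msize Q <= msize f - M)%N &
    forall v, ev f (ins a b u (q ^+ 2 * u) v) =
              hprod M (hval a b u) v * ev Q v].
Proof.
move=> wf ab bM hf.
pose g : {mpoly F[M]} := subst (fun i : 'I_M.+2 =>
  ins a b u%:MP (q ^+ 2 * u)%:MP (polX M) i) f.
have hg v : ev g v = ev f (ins a b u (q ^+ 2 * u) v).
  apply: ev_subst => i; rewrite /ins.
  case: eqP => [_|ia]; first by rewrite evC.
  case: eqP => [_|ib]; first by rewrite evC.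
  rewrite ev_polX //; move: ia ib (ltn_ord i) => /=.
  by move: (nat_of_ord i) => k; lia.
have sg : (msize g <= msize f)%N.
  apply: msize_subst => i; rewrite /ins /polX.
  case: eqP => _; first by rewrite msizeC; case: eqP.
  case: eqP => _; first by rewrite msizeC; case: eqP.
  by case: insubP => [j _ _|_]; rewrite ?msize0 // msizeX mdeg1.
have inse k v : ins a b u (q ^+ 2 * u) v (emb a b k) = v k by exact: ins_emb.
have insa v : ins a b u (q ^+ 2 * u) v a = u by rewrite /ins eqxx.
have insb v : ins a b u (q ^+ 2 * u) v b = q ^+ 2 * u.
  by rewrite /ins eqxx gtn_eqF.
have [k v kM vk|Q hQ sQ] := @factor_hplanes _ g (hval a b u).
  rewrite hg; move: vk; rewrite /hval.
  case: ifP => [ka|ka] vk.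
    have ik : ins a b u (q ^+ 2 * u) v k = v k.
      by rewrite -[in LHS](_ : emb a b k = k) ?inse // /emb ka.
    by apply: (wf _ k a b) => //; rewrite ?insa ?insb ik vk; field.
  move: vk; case: ifP => [kb|kb] vk.
    apply: (hf k.+1); rewrite ?insa //; first lia.
    by rewrite -(_ : emb a b k = k.+1) ?inse // /emb ka kb.
  apply: (wf _ a b k.+2); rewrite ?insa ?insb //; try lia.
  by rewrite -(_ : emb a b k = k.+2) ?inse // /emb ka kb.
exists Q; split => //; last by move=> v; rewrite -hg hQ.
  (* [emb] keeps wheel triples in order, so the product vanishes on the plane; the linear factors
     are cancelled at a generic point. *)
  move=> v i j k ij jk kM vj vk.
  have [x xP xs] := @wplane_point i j k [seq hval a b u i | i <- iota 0 M] ij jk.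
  apply: (hprod_cancel (@wplane_affine i j k) xP (avoids_seq xs)) (conj vj vk).
  move=> w [wj wk]; rewrite -hQ hg.
  apply: (wf _ (emb a b i) (emb a b j) (emb a b k)); rewrite ?inse //.
  - exact: emb_homo.
  - exact: emb_homo.
  - exact: emb_lt.
exact: leq_trans sQ (leq_sub2r _ sg).
Qed.

Definition pair_vanish N (f : {mpoly F[N]}) a b :=
  forall v, v b = q ^+ 2 * v a -> ev f v = 0.

(** The binomials z_b - q^2 z_a are pairwise non-associated primes; they are divided out one after
    the other. *)
Lemma pairs_size N (f : {mpoly F[N]}) (s : seq ('I_N * 'I_N)) : uniq s ->
  (forall p, p \in s -> (p.1 < p.2)%N /\ pair_vanish f p.1 p.2) ->
  f != 0 -> (size s < msize f)%N.
Proof.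
elim: s f => [|[a b] s IH] f /=; first by rewrite lt0n msize_poly_eq0.
case/andP=> abs us h f0.
have [/= ab fab] := h (a, b) (mem_head _ _).
have [|h1 fh sh] := @factor_pair _ f a b (q ^+ 2) _ fab.
  by rewrite -val_eqE /= ltn_eqF.
have h10 : h1 != 0 by apply: contra_neq f0 => e; rewrite fh e mulr0.
suff : (size s < msize h1)%N by rewrite sh; lia.
apply: IH => // -[c d] cds; have [] := h (c, d).
  by rewrite in_cons cds orbT.
move=> /= cd fcd.
split=> //= v vd; move: v vd.
(* A point with z_d = q^2 z_c but z_b - q^2 z_a nonzero. If b = d then a and c differ, so z_a = 0 is
   allowed; otherwise the value is 1 - q^2 or 1 - q^4. *)
pose x i : F := if b == d then if i == a :> nat then 0 else
  if i == d :> nat then q ^+ 2 else 1 else if i == d :> nat then q ^+ 2 else 1.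
apply: (density q_inf (@pair_affine c d (q ^+ 2)) (L := 'X_b - q ^+ 2 *: 'X_a)
          (x0 := x)).
- by move=> v vd; rewrite -evM -fh; apply: fcd.
- rewrite /x; case: eqP => bd.
    have ad : (d == a :> nat) = false by rewrite -bd gtn_eqF.
    have ca : (c == a :> nat) = false.
      apply: contraNF abs => /eqP/val_inj ca.
      by rewrite -ca bd.
    by rewrite ad eqxx ca (ltn_eqF cd) mulr1.
  by rewrite eqxx (ltn_eqF cd) mulr1.
rewrite evB evZ !evX /x; case: (b =P d) => bd.
  have ba : (b == a :> nat) = false by rewrite gtn_eqF.
by rewrite eqxx mulr0 subr0 ba -bd eqxx expf_neq0.
have -> : (b == d :> nat) = false by apply/eqP => /val_inj.
case: ifP => _; rewrite subr_eq0.
  by rewrite -exprD eq_sym q4_neq1.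
by rewrite mulr1 eq_sym q2_neq1.
Qed.

(** A nonzero f would have degree at least N(N-1)/2, which exceeds [wheel_deg N]. *)
Lemma all_pairs_zero N (f : {mpoly F[N]}) : (1 < N)%N ->
  (msize f <= (wheel_deg N).+1)%N ->
  (forall a b, (a < b)%N -> (b < N)%N -> pair_vanish f a b) -> f = 0.
Proof.
move=> N1 sf h; apply/eqP; apply: contraT => f0.
pose s := [seq p : 'I_N * 'I_N <- enum {: 'I_N * 'I_N} | (p.1 < p.2)%N].
have us : uniq s by rewrite filter_uniq // enum_uniq.
have := pairs_size us _ f0.
have -> : size s = 'C(N, 2).
  rewrite -bin2_sum size_filter -sum1_count big_mkord -[RHS]/(\sum_(i < N) i)%N.
  rewrite big_enum_cond /= (eq_bigl (fun p : 'I_N * 'I_N => true && (p.1 < p.2)%N)) //.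
  rewrite -(pair_big_dep xpredT (fun i j : 'I_N => (i < j)%N) (fun _ _ => 1%N)) /=.
  rewrite (exchange_big_dep xpredT) //=; apply: eq_bigr => j _.
  rewrite sum1_card -[RHS](card_ord j).
  have w : (j <= N)%N by rewrite ltnW.
  have wi : injective (widen_ord w) by move=> i k /(congr1 val) /= e; apply: val_inj.
  rewrite -(card_imset _ wi).
  apply: eq_card => i; rewrite unfold_in -[eqn _ _]/(i < j)%N.
  apply/idP/imsetP => [ij|[k _ ->]]; last exact: (ltn_ord k).
  by exists (Ordinal ij) => //; apply: val_inj.
have H p : p \in s -> (p.1 < p.2)%N /\ pair_vanish f p.1 p.2.
  by rewrite mem_filter => /andP[p12 _]; split=> //; apply: h.
move=> /(_ H); move: (msize f) sf => z sf.
rewrite bin2 /wheel_deg in sf *.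
have := odd_double_half N; have := uphalf_half N.
have := odd_double_half (N * N.-1); rewrite oddM.
clear -N1 sf; move: sf; case: N N1 => [|[|n]] //= _; nia.
Qed.

(** As [msize] is the degree plus one, the bound means degree below [wheel_deg N]. Induction on N
    kills the quotient left by each restriction, and an inner induction on b - a feeds
    [restr_factor]. *)
Lemma wheelp_small N (f : {mpoly F[N]}) : wheelp f ->
  (msize f <= wheel_deg N)%N -> f = 0.
Proof.
have [m] := ubnP N; elim: m N f => // m IH [|[|M]] f Nm wf sf.
- by apply/eqP; rewrite -msize_poly_eq0 -leqn0.
- by apply/eqP; rewrite -msize_poly_eq0 -leqn0.
apply: all_pairs_zero => //; first exact: leqW.
move=> a b; have [d] := ubnP (b - a)%N; elim: d a b => // d IHd a b bad ab bM v vb.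
have [|Q [wQ sQ hQ]] := restr_factor (v a) wf ab bM.
  by move=> k w ak kb; apply: IHd; lia.
have Q0 : Q = 0.
  apply: IH => //; first lia.
  by apply: leq_trans sQ _; move: sf; rewrite wheel_degSS; lia.
have := hQ (fun k => v (emb a b k)); rewrite Q0 ev0 mulr0 => <-.
by apply: ev_ext => i _; rewrite -vb ins_id.
Qed.

(** The cofactor of z_k - c still satisfies the wheel condition, and its degree is too small. *)
Lemma hplane_zero M (Q : {mpoly F[M]}) k c : wheelp Q -> (k < M)%N ->
  (msize Q <= (wheel_deg M).+1)%N ->
  (forall v, v k = c -> ev Q v = 0) -> Q = 0.
Proof.
move=> wQ kM sQ h.
have [|h1 Qh sh] := @factor_hplane _ Q (Ordinal kM) c; first exact: h.
suff h10 : h1 = 0 by rewrite Qh h10 mulr0.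
apply: wheelp_small; last by rewrite sh; lia.
move=> v i j l ij jl lM vj vl.
have [x xP xs] := @wplane_point i j l [:: c] ij jl.
apply: (density q_inf (@wplane_affine i j l) (L := 'X_(Ordinal kM) - c%:MP) _ xP)
  (conj vj vl).
  by move=> w [wj wl]; rewrite -evM -Qh; apply: (wQ _ i j l).
by rewrite evB evX evC subr_eq0 /=; have := xs k; rewrite inE.
Qed.

(** In extremal degree the non-adjacent pairs follow from the adjacent ones. On z_b = q^2 z_a with b
    > a + 1, setting z_(a+1) = z_a gives z_b = q^2 z_(a+1), where f vanishes by induction; so the
    quotient vanishes on a hyperplane. *)
Lemma adjacent_zero M (f : {mpoly F[M.+2]}) : wheelp f ->
  (msize f <= (wheel_deg M.+2).+1)%N ->
  (forall a, (a.+1 < M.+2)%N -> pair_vanish f a a.+1) -> f = 0.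
Proof.
move=> wf sf h; apply: all_pairs_zero => //.
move=> a b; have [d] := ubnP (b - a)%N; elim: d a b => // d IHd a b bad ab bM.
have [e|ba1] := eqVneq b a.+1; first by rewrite e; apply: h; rewrite -e.
have hv k w : (a < k)%N -> (k < b)%N -> w k = q ^+ 2 * w a -> ev f w = 0.
  by move=> ak kb; apply: IHd; lia.
have aM2 : (a < M.+2)%N by lia.
(* Restricts to z_a nonzero, where u and q^2 u differ, so that the linear factor in z_(a+1) can be
   cancelled on z_(a+1) = u. *)
apply: (density q_inf (@pair_affine a b (q ^+ 2)) (L := 'X_(Ordinal aM2))
  (x0 := fun i => if i == b then q ^+ 2 else 1)).
- move=> v vb; rewrite evX /=.
  have [->|u0] := eqVneq (v a) 0; first by rewrite mul0r.
  rewrite [X in _ * X](_ : _ = 0) ?mulr0 //.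
have [Q [wQ sQ hQ]] := restr_factor (v a) wf ab bM hv.
have Q0 : Q = 0.
  have aM : (a < M)%N by lia.
  apply: (hplane_zero (c := v a) wQ aM).
    by apply: leq_trans sQ _; move: sf; rewrite wheel_degSS; lia.
  pose c := hval a b (v a).
  have [x xs] := q_inf [seq c i | i <- iota 0 M].
  apply: (hprod_cancel (c := c) (x := fun i => if i == a then v a else x)).
  - exact: hplane_affine.
  - by rewrite eqxx.
  - move=> k kM; case: (k =P a) => [->|_].
      rewrite /c /hval ltnn; case: ifP; last lia.
      move=> _; rewrite -subr_eq0 -{1}[v a]mul1r -mulrBl mulf_neq0 //.
      by rewrite subr_eq0 eq_sym q2_neq1.
    by apply: contraNneq xs => ->; apply/mapP; exists k; rewrite ?mem_iota.
  move=> w wa; rewrite -hQ; apply: (IHd a.+1 b); try lia.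
  rewrite [in LHS]/ins gtn_eqF ?eqxx //; congr (_ * _).
  have ea : emb a b a = a.+1 by rewrite /emb ltnn; case: ifP; lia.
  by rewrite -ea ins_emb.
have := hQ (fun k => v (emb a b k)); rewrite Q0 ev0 mulr0 => <-.
  by apply: ev_ext => i _; rewrite -vb ins_id.
- by rewrite eqxx (ltn_eqF ab) mulr1.
by rewrite evX /= (ltn_eqF ab) oner_eq0.
Qed.

End Wheel.

Ltac split_ifs := repeat match goal with
  |- context [if ?b then _ else _] =>
     lazymatch b with context [if _ then _ else _] => fail | _ => destruct b eqn:? end
  end.

Definition swi (k i : nat) : nat :=
  if i == k then k.+1 else if i == k.+1 then k else i.

Definition sw (T : Type) k (v : nat -> T) i : T := v (swi k i).

Lemma swiK k : involutive (swi k).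
Proof. by move=> i; rewrite /swi; split_ifs; lia. Qed.

Lemma swi_lt N k i : (k.+1 < N)%N -> (i < N)%N -> (swi k i < N)%N.
Proof. by rewrite /swi; split_ifs; lia. Qed.

(** * Wheel polynomials of minimal degree and their values at Dyck words *)

Section MinimalWheel.
Variables (F : fieldType) (q : F).
Hypothesis q_neq0 : q != 0.
Hypothesis q_nroot : forall k, q ^+ k.+1 != 1.
Implicit Types (N M : nat) (v x y : nat -> F).
Local Notation wheelp := (wheelp q).
Local Notation q_inf := (q_inf q_neq0 q_nroot).

Definition min_wheel N (f : {mpoly F[N]}) :=
  wheelp f /\ (msize f <= (wheel_deg N).+1)%N.

Lemma min_wheelD N (f g : {mpoly F[N]}) :
  min_wheel f -> min_wheel g -> min_wheel (f + g).
Proof.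
move=> [wf sf] [wg sg]; split.
  by move=> v i j k ij jk kN vj vk; rewrite evD (wf _ i j k) ?(wg _ i j k) ?addr0.
by apply: leq_trans (msizeD_le _ _) _; rewrite geq_max sf sg.
Qed.

Lemma min_wheelZ N c (f : {mpoly F[N]}) : min_wheel f -> min_wheel (c *: f).
Proof.
move=> [wf sf]; split.
  by move=> v i j k ij jk kN vj vk; rewrite evZ (wf _ i j k) ?mulr0.
exact: leq_trans (msizeZ_le _ _) sf.
Qed.

Lemma min_wheelB N (f g : {mpoly F[N]}) :
  min_wheel f -> min_wheel g -> min_wheel (f - g).
Proof. by move=> hf hg; rewrite -scaleN1r; apply/min_wheelD/min_wheelZ. Qed.

Lemma min_wheel0 N : min_wheel (0 : {mpoly F[N]}).
Proof. by split; [move=> *; rewrite ev0 | rewrite msize0]. Qed.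

Lemma min_wheel_sum N I (r : seq I) (P : pred I) (G : I -> {mpoly F[N]}) :
  (forall i, P i -> min_wheel (G i)) -> min_wheel (\sum_(i <- r | P i) G i).
Proof. by move=> h; elim/big_rec: _ => [|i f Pi hf]; [exact: min_wheel0 | exact: min_wheelD (h i Pi) hf]. Qed.

Lemma mcoeff_scale N c (f : {mpoly F[N]}) m :
  (subst (fun i => c *: 'X_i) f)@_m = c ^+ mdeg m * f@_m.
Proof.
have linX k : subst (fun i => c *: 'X_i) 'X_[k] = c ^+ mdeg k *: 'X_[F, k] :> {mpoly F[N]}.
  rewrite [in RHS]mpolyXE_id /subst comp_mpolyX mdegE.
  rewrite -prodrXr -scaler_prod; apply: eq_bigr => i _.
  by rewrite tnth_mktuple exprZn.
rewrite {1}(mpolyE f) rmorph_sum raddf_sum [in RHS](mpolyE f) raddf_sum mulr_sumr /=.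
apply: eq_bigr => k _; rewrite /subst comp_mpolyZ -/(subst _ _) linX !mcoeffZ mcoeffX.
by case: eqP => [->|_]; rewrite ?mulr0 // !mulr1 mulrC.
Qed.

(** The terms of top degree cancel in f(cz) - c^d f(z), which also satisfies the wheel condition, so
    it is 0 by [wheelp_small]. *)
Lemma ev_scale N c (f : {mpoly F[N]}) v : min_wheel f ->
  ev f (fun i => c * v i) = c ^+ wheel_deg N * ev f v.
Proof.
move=> [wf sf]; pose g := subst (fun i => c *: 'X_i) f - c ^+ wheel_deg N *: f.
have hg w : ev g w = ev f (fun i => c * w i) - c ^+ wheel_deg N * ev f w.
  rewrite evB evZ; congr (_ - _).
  by apply: ev_subst => i; rewrite evZ evX.
suff g0 : g = 0 by apply/eqP; rewrite -subr_eq0 -hg g0 ev0.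
apply: (wheelp_small q_neq0 q_nroot).
  move=> w i j k ij jk kN wj wk; rewrite hg.
  by rewrite (wf w i j k) // (wf (fun i => c * w i) i j k) ?wj ?wk; try ring.
rewrite msizeE; apply/bigmax_leqP_seq => m mg _.
have := mg; rewrite mcoeff_msupp mcoeffB mcoeffZ mcoeff_scale -mulrBl mulf_eq0.
rewrite negb_or => /andP[cm]; rewrite -mcoeff_msupp => /msize_mdeg_lt mf.
rewrite ltn_neqAle -ltnS (leq_trans mf sf) andbT.
by apply: contraNneq cm => ->; rewrite subrr.
Qed.

Lemma min_wheel_homog N (f : {mpoly F[N]}) : min_wheel f ->
  f \is (wheel_deg N).-homog.
Proof.
move=> hf; apply/dhomogP => m mf; apply: (expq_inj q_neq0 q_nroot).
have e : subst (fun i => q *: 'X_i) f = q ^+ wheel_deg N *: f.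
  apply/eqP; rewrite -subr_eq0; apply/eqP/(ev_eq0 q_inf) => v.
  rewrite evB evZ -ev_scale // (@ev_subst _ _ _ _ _ _ (fun i => q * v i)) ?subrr //.
  by move=> i; rewrite evZ evX.
have := congr1 (mcoeff m) e; rewrite mcoeff_scale mcoeffZ.
by apply: mulIf; rewrite -mcoeff_msupp.
Qed.

Lemma pair_vanish_adj M (f : {mpoly F[M.+2]}) a : min_wheel f ->
  (a.+1 < M.+2)%N ->
  (forall (u : F) (Q : {mpoly F[M]}), u != 0 -> min_wheel Q ->
   (forall v, ev f (ins a a.+1 u (q ^+ 2 * u) v) =
      hprod M (hval q a a.+1 u) v * ev Q v) -> Q = 0) ->
  pair_vanish q f a a.+1.
Proof.
move=> [wf sf] aM h; have aM' := ltnW aM.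
apply: (density q_inf (@pair_affine _ a a.+1 (q ^+ 2)) (L := 'X_(Ordinal aM'))
  (x0 := fun i => if i == a.+1 then q ^+ 2 else 1)).
- move=> v vb; rewrite evX /=.
  have [->|u0] := eqVneq (v a) 0; first by rewrite mul0r.
  have [|Q [wQ sQ hQ]] := restr_factor q_neq0 q_nroot (v a) wf (ltnSn a) aM.
    by move=> k w; lia.
  have Q0 : Q = 0.
    apply: (h (v a)) => //; split=> //.
    by apply: leq_trans sQ _; move: sf; rewrite wheel_degSS; lia.
  have := hQ (fun k => v (emb a a.+1 k)); rewrite Q0 ev0 mulr0 => e.
  rewrite -[X in _ * X](_ : 0 = _) ?mulr0 // -e.
  by apply: ev_ext => i _; rewrite -vb ins_id.
- by rewrite eqxx (ltn_eqF (ltnSn a)) mulr1.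
by rewrite evX /= (ltn_eqF (ltnSn a)) oner_eq0.
Qed.

Definition cnt (w : nat -> bool) k := count w (iota 0 k).

Lemma cntS w k : cnt w k.+1 = (cnt w k + w k)%N.
Proof. by rewrite /cnt -addn1 iotaD count_cat /= addn0 add0n. Qed.

Lemma eq_cnt (w w' : nat -> bool) k :
  (forall i, (i < k)%N -> w i = w' i) -> cnt w k = cnt w' k.
Proof.
elim: k => // k IH h; rewrite !cntS h // IH // => i ik.
by apply: h; apply: leqW.
Qed.

Definition dyck N (w : nat -> bool) :=
  (forall k, (k <= N)%N -> (k <= 2 * cnt w k)%N) /\ (2 * cnt w N = N)%N.

Lemma cnt_ins (w : nat -> bool) a k : cnt (ins a a.+1 true false w) k =
  if (k <= a)%N then cnt w k else if k == a.+1 then (cnt w a).+1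
  else (cnt w k.-2).+1.
Proof.
elim: k => // k IH; rewrite cntS IH /ins.
have [ka|ka] := ltnP k a.
  by rewrite (ltnW ka) cntS; split_ifs; try lia; congr (_ + nat_of_bool (w _))%N; lia.
have [->|ka1] := eqVneq k a; first by rewrite leqnn !eqxx; lia.
rewrite leqNgt ltn_neqAle eq_sym ka1 ka /= eqSS (negbTE ka1).
have [->|ka2] := eqVneq k a.+1; first by rewrite addn0.
rewrite (_ : k.-1 = (k.-2).+1) ?cntS; last lia.
by congr (_ + nat_of_bool (w _)).+1; lia.
Qed.

Lemma dyck_ins M (w : nat -> bool) a : (a <= M)%N -> dyck M w ->
  dyck M.+2 (ins a a.+1 true false w).
Proof.
move=> aM [h1 h2]; split=> [k kM|]; rewrite cnt_ins.
  case: ifP => ka; first by apply: h1; lia.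
  case: eqP => ka1; first by have := h1 a; lia.
  by have := h1 k.-2; lia.
by rewrite ifF ?ifF /=; lia.
Qed.

Definition dyck_pt (u : F) (w : nat -> bool) i : F := if w i then u else q ^+ 2 * u.

(** Inserting a peak into a Dyck word gives a Dyck word, so the quotient at an adjacent pair is
    tested on shorter Dyck words. The linear factors do not vanish there: their roots are q^-2 u and
    q^4 u, while the coordinates are u and q^2 u. Homogeneity normalizes u to 1. *)
Lemma dyck_zero N (f : {mpoly F[N]}) : ~~ odd N -> min_wheel f ->
  (forall w, dyck N w -> ev f (dyck_pt 1 w) = 0) -> f = 0.
Proof.
have [m] := ubnP N; elim: m N f => // m IH [|[|M]] f Nm // oN [wf sf] hf.
  have := hf (fun=> true); rewrite (msize1_polyC sf) evC => -> //.
  by split=> // k; rewrite leqn0 => /eqP->.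
apply: (adjacent_zero q_neq0 q_nroot) => // a aM.
apply: pair_vanish_adj => // u Q u0 mQ hQ.
apply: IH => //; [lia | by move: oN; rewrite /= negbK | move=> w dw].
have := hQ (dyck_pt u w).
have -> : ev f (ins a a.+1 u (q ^+ 2 * u) (dyck_pt u w)) = 0.
  have dw' : dyck M.+2 (ins a a.+1 true false w) by apply: dyck_ins.
  have := ev_scale u (dyck_pt 1 (ins a a.+1 true false w)) (conj wf sf).
  rewrite hf // mulr0 => e; rewrite -[RHS]e; apply: ev_ext => i _.
  rewrite /dyck_pt /ins; repeat case: (i =P _) => _; rewrite ?mulr1 //; try ring.
  by case: ifP => _; rewrite ?mulr1 //; ring.
move/esym/eqP; rewrite mulf_eq0 => /orP[|/eqP e].
  apply: contraTeq => _; apply: hprod_neq0 => k kM.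
  have nz e e' : (e < e')%N -> q ^+ e * u != q ^+ e' * u.
    move=> ee; apply: contraTneq ee => /(mulIf u0)/(expq_inj q_neq0 q_nroot) ->.
    by rewrite ltnn.
  have sc c c' : q ^+ 2 * c != q ^+ 2 * c' -> c != c'.
    by apply: contra_neq => ->.
  rewrite /dyck_pt /hval ltnS; case: ltnP => ka.
    apply: sc; rewrite mulrA mulfV ?expf_neq0 // mul1r.
    case: ifP => _; first by rewrite eq_sym -[X in X != _]mul1r -(expr0 q) nz.
    by rewrite mulrA -exprD eq_sym -[X in X != _]mul1r -(expr0 q) nz.
  case: ifP => _; first by rewrite -[X in X != _]mul1r -(expr0 q) nz.
  exact: nz.
have := ev_scale u (dyck_pt 1 w) mQ.
rewrite (@ev_ext _ _ _ _ (dyck_pt u w)) ?e; last first.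
  by move=> i _; rewrite /dyck_pt; case: ifP => _; rewrite ?mulr1 //; ring.
by move/esym/eqP; rewrite mulf_eq0 expf_eq0 (negbTE u0) andbF => /eqP.
Qed.

End MinimalWheel.

(** * The operators D and wheel polynomials *)

Lemma swi_l k : swi k k = k.+1.
Proof. by rewrite /swi eqxx. Qed.
Lemma swi_r k : swi k k.+1 = k.
Proof. by rewrite /swi gtn_eqF // eqxx. Qed.
Lemma swi_id k i : i != k -> i != k.+1 -> swi k i = i.
Proof. by rewrite /swi => /negbTE-> /negbTE->. Qed.

Lemma sw_ins T a j (x y : T) (v : nat -> T) i : (j.+1 < a)%N ->
  sw j (ins a a.+1 x y v) i = ins a a.+1 x y (sw j v) i.
Proof.
move=> ja; rewrite /sw /ins.
by rewrite /swi; split_ifs => //; (try by exfalso; lia); congr (v _); lia.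
Qed.

Lemma sw_ins_r T a j (x y : T) (v : nat -> T) i : (a <= j)%N ->
  sw j.+2 (ins a a.+1 x y v) i = ins a a.+1 x y (sw j v) i.
Proof.
move=> ja; rewrite /sw /ins.
by rewrite /swi; split_ifs => //; (try by exfalso; lia); congr (v _); lia.
Qed.

Section DemazureLusztig.
Variables (F : fieldType) (q : F).
Hypothesis q_neq0 : q != 0.
Hypothesis q_nroot : forall k, q ^+ k.+1 != 1.
Implicit Types (N M : nat) (v x y : nat -> F).
Local Notation wheelp := (wheelp q).
Local Notation min_wheel := (min_wheel q).
Local Notation pair_vanish := (pair_vanish q).
Local Notation q_inf := (q_inf q_neq0 q_nroot).
Local Notation tau := (q + q^-1).

Lemma tau_neq0 : tau != 0.
Proof.
suff : q * tau != 0 by apply: contra_neq => ->; rewrite mulr0.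
rewrite mulrDr mulfV // -expr2; apply: contra_neq (q_nroot 3) => e.
by rewrite -[4%N]/(2 * 2)%N exprM -[q ^+ 2](addrK 1) e; ring.
Qed.

Definition swp N k (f : {mpoly F[N]}) : {mpoly F[N]} :=
  subst (fun i : 'I_N => polX F N (swi k i)) f.

Lemma ev_swp N k (f : {mpoly F[N]}) v : (k.+1 < N)%N ->
  ev (swp k f) v = ev f (sw k v).
Proof. by move=> kN; apply: ev_subst => i; rewrite ev_polX ?swi_lt. Qed.

Lemma msize_swp N k (f : {mpoly F[N]}) : (msize (swp k f) <= msize f)%N.
Proof.
apply: msize_subst => i; rewrite /polX.
by case: insubP => [j _ _|_]; rewrite ?msize0 // msizeX mdeg1.
Qed.

(* g = D_k f, stated without division. *)
Definition isD N k (f g : {mpoly F[N]}) := forall v,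
  ev g v * (v k.+1 - v k) = (q * v k - q^-1 * v k.+1) * (ev f (sw k v) - ev f v).

Definition diff_point k (i : nat) : F := if i == k then 0 else 1.

Lemma ev_cancel N k (f : {mpoly F[N]}) : (k.+1 < N)%N ->
  (forall v, ev f v * (v k.+1 - v k) = 0) -> f = 0.
Proof.
move=> kN h; apply: (ev_eq0 q_inf) => v; have kN' := ltnW kN.
apply: (density q_inf (V := fun=> True) (x0 := diff_point k)
  (L := 'X_(Ordinal kN) - 'X_(Ordinal kN'))) => //.
  by move=> w _; rewrite mulrC evB !evX /= h.
by rewrite evB !evX /= /diff_point eqxx gtn_eqF // subr0 oner_eq0.
Qed.

Lemma ev_inj N (f g : {mpoly F[N]}) : (forall v, ev f v = ev g v) -> f = g.
Proof.
by move=> h; apply/eqP; rewrite -subr_eq0; apply/eqP/(ev_eq0 q_inf) => v; rewrite evB h subrr.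
Qed.

Lemma isD_uniq N k (f g h : {mpoly F[N]}) : (k.+1 < N)%N ->
  isD k f g -> isD k f h -> g = h.
Proof.
move=> kN hg hh; apply/eqP; rewrite -subr_eq0; apply/eqP/(ev_cancel kN) => v.
by rewrite evB mulrBl hg hh subrr.
Qed.

Lemma isDB N k (f g f' g' : {mpoly F[N]}) :
  isD k f g -> isD k f' g' -> isD k (f - f') (g - g').
Proof. by move=> h h' v; rewrite !evB mulrBl h h'; ring. Qed.

Lemma isDZ N k c (f g : {mpoly F[N]}) : isD k f g -> isD k (c *: f) (c *: g).
Proof. by move=> h v; rewrite !evZ -mulrA h; ring. Qed.

Lemma swK (T : Type) k (v : nat -> T) i : sw k (sw k v) i = v i.
Proof. by rewrite /sw swiK. Qed.

(** The divided difference is symmetric, and exchanging the variables in its prefactor q z_k - q^-1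
    z_(k+1) adds tau (z_(k+1) - z_k). So S_k D_k f - D_k f = tau (S_k f - f). *)
Lemma isD_sym N k (f g : {mpoly F[N]}) : (k.+1 < N)%N -> isD k f g ->
  forall v, ev (tau *: f - g) (sw k v) = ev (tau *: f - g) v.
Proof.
move=> kN h; suff e : swp k (tau *: f - g) = tau *: f - g.
  by move=> v; rewrite -[in RHS]e ev_swp.
apply/eqP; rewrite -subr_eq0; apply/eqP/(ev_cancel kN) => v.
rewrite evB ev_swp // !evB !evZ.
have e2 := h v; have := h (sw k v).
rewrite (@ev_ext _ _ f (sw k (sw k v)) v); last by move=> i _; rewrite swK.
have -> : sw k v k = v k.+1 by rewrite /sw swi_l.
have -> : sw k v k.+1 = v k by rewrite /sw swi_r.
move=> e1; move: (ev g (sw k v)) (ev g v) (ev f (sw k v)) (ev f v) e1 e2 => B A D C e1 e2.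
rewrite (_ : _ * _ = tau * (D - C) * (v k.+1 - v k) + B * (v k - v k.+1)
  + A * (v k.+1 - v k)); last by ring.
by rewrite e1 e2; field.
Qed.

Lemma isD_pair N k (f g : {mpoly F[N]}) : (k.+1 < N)%N -> isD k f g ->
  pair_vanish g k k.+1.
Proof.
move=> kN h; have kN' := ltnW kN.
apply: (density q_inf (@pair_affine _ k k.+1 (q ^+ 2)) (L := 'X_(Ordinal kN'))
  (x0 := fun i => if i == k.+1 then q ^+ 2 else 1)).
- move=> v vk; rewrite evX /=; have := h v.
  rewrite vk (_ : q * v k - _ = 0) ?mul0r; last by field.
  rewrite (_ : ev g v * _ = (q ^+ 2 - 1) * (v k * ev g v)); last by ring.
  by move/eqP; rewrite mulf_eq0 subr_eq0 (negbTE (q_nroot 1)) => /eqP.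
- by rewrite eqxx (ltn_eqF (ltnSn k)) mulr1.
by rewrite evX /= (ltn_eqF (ltnSn k)) oner_eq0.
Qed.

(** If k, k+1 are consecutive members of the triple, the prefactor of D_k vanishes. Otherwise
    exchanging them keeps the triple in order, and both f and S_k f vanish. *)
Lemma isD_wheel N k (f g : {mpoly F[N]}) : (k.+1 < N)%N -> isD k f g ->
  wheelp f -> wheelp g.
Proof.
move=> kN h wf v i j l ij jl lN vj vl; have kN' := ltnW kN.
(* A point of the wheel plane with distinct coordinates at k and k+1, wherever these lie with
   respect to i, j, l. *)
pose x m := if m == i then 1 else if m == j then q ^+ 2 else
  if m == l then q ^+ 4 else if m == k then q else 0.
apply: (density q_inf (@wplane_affine _ q i j l) (x0 := x)
  (L := 'X_(Ordinal kN) - 'X_(Ordinal kN'))) (conj vj vl).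
- move=> w [wj wl]; rewrite mulrC evB !evX /= h.
  have [e|ne] := boolP ((i == k) && (j == k.+1) || (j == k) && (l == k.+1)).
    suff -> : q * w k - q^-1 * w k.+1 = 0 by rewrite mul0r.
    case/orP: e => /andP[/eqP ei /eqP ej]; rewrite -ej -ei.
      by rewrite wj; field.
    by rewrite wl wj; field.
  rewrite (wf w i j l) // (wf (sw k w) (swi k i) (swi k j) (swi k l)) ?subrr ?mulr0 //.
  - by move: ne; rewrite /swi; split_ifs; lia.
  - by move: ne; rewrite /swi; split_ifs; lia.
  - exact: swi_lt.
  - by rewrite /sw !swiK.
  - by rewrite /sw !swiK.
- by rewrite /wplane /x; split; split_ifs; rewrite ?mulr1 //; lia.
rewrite evB !evX /= subr_eq0 /x.
have n a b : (a < b)%N -> q ^+ a != q ^+ b.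
  move=> ab; apply: contraTneq ab => /(expq_inj q_neq0 q_nroot) ->.
  by rewrite ltnn.
have q1 : q != 1 := q_nroot 0.
have := n 0%N 2%N isT; have := n 0%N 4%N isT; have := n 2%N 4%N isT.
have := n 1%N 2%N isT; have := n 1%N 4%N isT; rewrite expr0 expr1.
move=> n1 n2 n3 n4 n5.
by split_ifs; rewrite ?oner_eq0 ?expf_neq0 // 1?eq_sym ?oner_eq0 ?expf_neq0 //;
  try (exfalso; lia); rewrite ?n1 // eq_sym.
Qed.

Lemma isD_msize N (a b : 'I_N) (f g : {mpoly F[N]}) : b = a.+1 :> nat ->
  isD a f g -> (msize g <= msize f)%N.
Proof.
move=> ba h; have aN : (a.+1 < N)%N by rewrite -ba.
have [->|g0] := eqVneq g 0; first by rewrite msize0.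
have e : ('X_b - 'X_a) * g = (q *: 'X_a - q^-1 *: 'X_b) * (swp a f - f).
  apply: ev_inj => v; rewrite !evM !evB !evZ !evX ev_swp // ba -h; ring.
have sX (c : 'I_N) : msize ('X_c : {mpoly F[N]}) = 2%N by rewrite msizeX mdeg1.
have ab : a != b by rewrite -val_eqE /= ba ltn_eqF.
have s : msize ('X_b - 'X_a : {mpoly F[N]}) = 2%N.
  by apply: msize_lin; rewrite ?sX // mcoeffXU (negbTE ab).
have := congr1 (fun p : {mpoly F[N]} => msize p) e; rewrite /= msizeMF //; last first.
  by rewrite -msize_poly_eq0 s.
rewrite s => e2; have [z|n0] := eqVneq (msize f) 0%N.
  move: g0; rewrite -msize_poly_eq0; move: e2.
  move/eqP: z; rewrite msize_poly_eq0 => /eqP ->.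
  by rewrite /swp rmorph0 subr0 mulr0 msize0; lia.
have : (msize ((q *: 'X_a - q^-1 *: 'X_b) * (swp a f - f)) <= (1 + (msize f).-1).+1)%N.
  apply: msizeM_leq.
    apply: leq_trans (msizeD_le _ _) _; rewrite msizeN geq_max.
    by rewrite !(leq_trans (msizeZ_le _ _)) ?sX.
  rewrite prednK ?lt0n //; apply: leq_trans (msizeD_le _ _) _.
  by rewrite msizeN geq_max leqnn msize_swp.
by rewrite -e2; lia.
Qed.

Lemma isD_min N (a b : 'I_N) (f g : {mpoly F[N]}) : b = a.+1 :> nat ->
  isD a f g -> min_wheel f -> min_wheel g.
Proof.
move=> ba h [wf sf]; split; first by apply: isD_wheel h wf; rewrite -ba.
exact: leq_trans (isD_msize ba h) sf.
Qed.

Lemma hprod_sw M (c : nat -> F) v k : (k.+1 < M)%N -> c k = c k.+1 ->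
  hprod M c (sw k v) = hprod M c v.
Proof.
move=> kM ck; pose s (i : 'I_M) := Ordinal (swi_lt kM (ltn_ord i)).
have sK : involutive s by move=> i; apply: val_inj; apply: swiK.
rewrite /hprod (reindex_inj (inv_inj sK)) /=; apply: eq_bigr => i _.
rewrite /sw swiK; congr (_ - _); rewrite /swi.
by split_ifs => //; [rewrite -ck (eqP Heqb) | rewrite (eqP Heqb0) -ck].
Qed.

(** Only the adjacent pairs (a, a+1) need checking. If the pair meets {j, j+1}, symmetry makes the
    quotient vanish on a hyperplane; if it is disjoint from it, the quotient inherits both
    properties and the induction on N applies. *)
Lemma sym_zero N (f : {mpoly F[N]}) j : (j.+1 < N)%N -> min_wheel f ->
  (forall v, ev f (sw j v) = ev f v) -> pair_vanish f j j.+1 -> f = 0.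
Proof.
have [m] := ubnP N; elim: m N f j => // m IH [|[|M]] f j Nm // jN mf sf vf.
have [wf szf] := mf.
apply: (adjacent_zero q_neq0 q_nroot) => // a aM.
have [->//|aj] := eqVneq a j.
apply: pair_vanish_adj => // u Q u0 [wQ szQ] hQ.
have nz e e' : (e < e')%N -> q ^+ e * u != q ^+ e' * u.
  move=> ee; apply: contraTneq ee => /(mulIf u0)/(expq_inj q_neq0 q_nroot) ->.
  by rewrite ltnn.
(* When the remaining z_j equals q^2 u, exchanging it with z_(j+1) = u lands on z_(j+1) = q^2
   z_j. *)
have [aj1|aj1] := eqVneq a j.+1.
  have jM : (j < M)%N by lia.
  apply: (hplane_zero q_neq0 q_nroot (c := q ^+ 2 * u) wQ jM) => //.
  have [x xs] := q_inf [seq hval q a a.+1 u i | i <- iota 0 M].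
  apply: (hprod_cancel q_neq0 q_nroot (c := hval q a a.+1 u)
    (x := fun i => if i == j then q ^+ 2 * u else x)).
  - exact: hplane_affine.
  - by rewrite eqxx.
  - move=> k kM; case: (k =P j) => [->|_].
      rewrite /hval ifT; last lia.
      apply: contra_neq (nz 0%N 4%N isT) => e; rewrite expr0 mul1r.
      rewrite -[4%N]/(2 + 2)%N exprD -mulrA e mulrA mulfV ?mul1r //.
      by rewrite expf_neq0.
    by apply: contraNneq xs => ->; apply/mapP; exists k; rewrite ?mem_iota.
  move=> w wj; rewrite -hQ -sf; apply: vf; rewrite /sw swi_l swi_r /ins.
  rewrite aj1 eqxx ltn_eqF // ltn_eqF; last lia.
  by rewrite (_ : (_ - _ - _)%N = j) ?wj //; lia.
(* Here z_j = q^2 u; when z_(j+1) = u, the exchange again lands on z_(j+1) = q^2 z_j. *)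
have [aj2|aj2] := eqVneq a.+1 j.
  have aM1 : (a < M)%N by lia.
  apply: (hplane_zero q_neq0 q_nroot (c := u) wQ aM1) => //.
  have [x xs] := q_inf [seq hval q a a.+1 u i | i <- iota 0 M].
  apply: (hprod_cancel q_neq0 q_nroot (c := hval q a a.+1 u)
    (x := fun i => if i == a then u else x)).
  - exact: hplane_affine.
  - by rewrite eqxx.
  - move=> k kM; case: (k =P a) => [->|_].
      rewrite /hval !ltnn; have := nz 0%N 4%N isT.
      by rewrite expr0 mul1r.
    by apply: contraNneq xs => ->; apply/mapP; exists k; rewrite ?mem_iota.
  move=> w wa; rewrite -hQ -sf; apply: vf; rewrite /sw swi_l swi_r /ins -aj2.
  rewrite eqxx !gtn_eqF //= ?ltnSn; try lia.
  rewrite (_ : (_ - _ - _)%N = a) ?wa //; lia.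
(* The index of z_j among the remaining variables. *)
pose j' := if (j < a)%N then j else (j - 2)%N.
have jM' : (j'.+1 < M)%N by rewrite /j'; case: ifP; lia.
have [x xs] := q_inf [seq hval q a a.+1 u i | i <- iota 0 M].
have insj w i : sw j (ins a a.+1 u (q ^+ 2 * u) w) i =
    ins a a.+1 u (q ^+ 2 * u) (sw j' w) i.
  rewrite /j'; case: ifP => ja; first by rewrite sw_ins //; lia.
  have e : (j - 2).+2 = j by lia.
  by rewrite -sw_ins_r ?e //; lia.
apply: (IH _ _ j') => //; first lia.
  move=> v; rewrite -ev_swp //; apply/eqP; rewrite -subr_eq0 -evB; apply/eqP.
  apply: (hprod_cancel q_neq0 q_nroot (c := hval q a a.+1 u) (x := fun=> x)
    (V := fun=> True)) => //.
    by apply: avoids_seq.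
  move=> w _; rewrite evB ev_swp // mulrBr -hQ.
  rewrite -[X in X * _](@hprod_sw _ (hval q a a.+1 u) _ j') //; last first.
    by rewrite /j' /hval; split_ifs => //; lia.
  by rewrite -hQ -(ev_ext f (fun i _ => insj w i)) sf subrr.
have [y [yj _] ys] := @wplane_point _ _ q_neq0 q_nroot j' j'.+1 j'.+2
  [seq hval q a a.+1 u i | i <- iota 0 M] (ltnSn _) (ltnSn _).
apply: (hprod_cancel q_neq0 q_nroot (c := hval q a a.+1 u) _ yj (avoids_seq ys)).
  exact: pair_affine.
move=> w wj; rewrite -hQ; apply: vf.
have ej : emb a a.+1 j' = j by rewrite /emb /j'; split_ifs; lia.
have ej1 : emb a a.+1 j'.+1 = j.+1 by rewrite /emb /j'; split_ifs; lia.
by rewrite -ej1 -[X in q ^+ 2 * ins _ _ _ _ _ X]ej !ins_emb.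
Qed.

(** The difference tau f - D_a f is symmetric, and both of its terms vanish at z_b = q^2 z_a;
    [sym_zero] concludes. *)
Lemma isD_eigen N (a b : 'I_N) (f g : {mpoly F[N]}) : b = a.+1 :> nat ->
  isD a f g -> min_wheel f -> pair_vanish f a a.+1 -> g = tau *: f.
Proof.
move=> ba h mf vf; have aN : (a.+1 < N)%N by rewrite -ba.
apply/eqP; rewrite eq_sym -subr_eq0; apply/eqP; apply: (sym_zero aN).
- by apply: min_wheelB (isD_min ba h mf); apply: min_wheelZ.
- exact: isD_sym.
by move=> v va; rewrite evB evZ vf // (isD_pair aN h) // mulr0 subrr.
Qed.

End DemazureLusztig.

Lemma ins_adjE T a (x y : T) w k : ins a a.+1 x y w k =
  if (k < a)%N then w k else if k == a then x else if k == a.+1 then y else w k.-2.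
Proof.
by rewrite /ins; split_ifs => //; (try by exfalso; lia); congr (w _); lia.
Qed.

Ltac adj_cases := rewrite ?ins_adjE /sw /swi ?ins_adjE; split_ifs;
  try (by exfalso; lia);
  repeat match goal with H : (_ == _) = true |- _ => move/eqP: H => H end.

(** * The Temperley-Lieb relation on wheel polynomials *)

Section BraidRelation.
Variables (F : fieldType) (q : F).
Hypothesis q_neq0 : q != 0.
Hypothesis q_nroot : forall k, q ^+ k.+1 != 1.
Implicit Types (N M : nat) (v x y : nat -> F).
Local Notation wheelp := (wheelp q).
Local Notation min_wheel := (min_wheel q).
Local Notation pair_vanish := (pair_vanish q).
Local Notation isD := (isD q).
Local Notation q_inf := (q_inf q_neq0 q_nroot).
Local Notation tau := (q + q^-1).

(** The linear factors common to the restrictions at the pairs (i, i+1) and (i+1, i+2). These differ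
    only in the factor of the third variable among z_i, z_(i+1), z_(i+2), which has index i in
    both. *)
Definition hrest M i (u : F) v := \prod_(k < M | k != i :> nat) (v k - hval q i i.+1 u k).

Lemma hprod_left M i (u : F) v : (i < M)%N ->
  hprod M (hval q i i.+1 u) v = (v i - q ^+ 4 * u) * hrest M i u v.
Proof.
move=> iM; rewrite /hprod (bigD1 (Ordinal iM)) //= /hrest; congr (_ * _).
by rewrite /hval !ltnn.
Qed.

Lemma hprod_right M i (u : F) v : (i < M)%N ->
  hprod M (hval q i.+1 i.+2 u) v = (v i - q ^- 2 * u) * hrest M i u v.
Proof.
move=> iM; rewrite /hprod (bigD1 (Ordinal iM)) //= /hrest; congr (_ * _).
  by rewrite /hval ltnSn.
apply: eq_bigr => k ki; congr (_ - _); rewrite /hval.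
by move: ki; rewrite -val_eqE /= => ki; split_ifs => //; exfalso; lia.
Qed.

(** The difference of the two sides has minimal degree and vanishes on the hyperplane v_i = c, once
    the common factors are cancelled. *)
Lemma quotients_prop M (h : {mpoly F[M.+2]}) i (u c : F) (Q1 Q2 : {mpoly F[M]}) :
  (i < M)%N -> min_wheel Q1 -> min_wheel Q2 ->
  (forall v, ev h (ins i i.+1 u (q ^+ 2 * u) v) =
             hprod M (hval q i i.+1 u) v * ev Q1 v) ->
  (forall v, ev h (ins i.+1 i.+2 u (q ^+ 2 * u) v) =
             hprod M (hval q i.+1 i.+2 u) v * ev Q2 v) ->
  (forall v, v i = c -> ev h (ins i i.+1 u (q ^+ 2 * u) v) =
                        ev h (ins i.+1 i.+2 u (q ^+ 2 * u) v)) ->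
  (c - q ^+ 4 * u) *: Q1 = (c - q ^- 2 * u) *: Q2.
Proof.
move=> iM mQ1 mQ2 hQ1 hQ2 hc; apply/eqP; rewrite -subr_eq0; apply/eqP.
have [wQ sQ] : min_wheel ((c - q ^+ 4 * u) *: Q1 - (c - q ^- 2 * u) *: Q2).
  by apply: min_wheelB; apply: min_wheelZ.
apply: (hplane_zero q_neq0 q_nroot (c := c) wQ iM sQ).
(* With the root c - 1 at index i, that factor is 1 on the hyperplane and the product reduces to
   [hrest]. *)
pose c' k := if k == i then c - 1 else hval q i i.+1 u k.
have [x xs] := q_inf [seq c' k | k <- iota 0 M].
apply: (hprod_cancel q_neq0 q_nroot (c := c')
  (x := fun k => if k == i then c else x)).
- exact: hplane_affine.
- by rewrite eqxx.
- move=> k kM; case: (k =P i) => [ki|_].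
    by rewrite /c' ki eqxx -subr_eq0 opprB addrC subrK oner_eq0.
  by apply: contraNneq xs => ->; apply/mapP; exists k; rewrite ?mem_iota.
move=> v vi; have := hc v vi; rewrite hQ1 hQ2 hprod_left // hprod_right // vi.
have -> : hprod M c' v = hrest M i u v.
  rewrite /hprod (bigD1 (Ordinal iM)) //= /c' eqxx vi opprB addrC subrK mul1r.
  by apply: eq_bigr => k; rewrite -val_eqE /= => /negbTE ->.
rewrite evB !evZ => e; rewrite mulrBr.
rewrite mulrCA [X in _ - X]mulrCA !mulrA e; apply/eqP; rewrite subr_eq0.
by apply/eqP; ring.
Qed.

Lemma ev_swap_sym N (h : {mpoly F[N]}) k v w :
  (forall x, ev h (sw k x) = ev h x) ->
  (forall i, (i < N)%N -> w i = sw k v i) -> ev h w = ev h v.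
Proof. by move=> hs e; rewrite -(hs v); apply: ev_ext. Qed.

Lemma restr_adj M (f : {mpoly F[M.+2]}) a u : min_wheel f -> (a.+1 < M.+2)%N ->
  exists2 Q : {mpoly F[M]}, min_wheel Q & forall v,
    ev f (ins a a.+1 u (q ^+ 2 * u) v) = hprod M (hval q a a.+1 u) v * ev Q v.
Proof.
move=> [wf sf] aM.
have [|Q [wQ sQ hQ]] := restr_factor q_neq0 q_nroot u wf (ltnSn a) aM.
  by move=> k w; lia.
exists Q => //; split=> //; apply: leq_trans sQ _.
by move: sf; rewrite wheel_degSS; lia.
Qed.

(** On the hyperplane h is a restriction at (i+1, i+2), and S_i h is, by symmetry of h, a
    restriction at (i, i+1). Their quotients are proportional, so D_i h is there an explicit
    multiple of h. *)
Lemma isD_braid_left N (h g : {mpoly F[N]}) i : (i.+2 < N)%N -> min_wheel h ->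
  (forall v, ev h (sw i.+1 v) = ev h v) -> isD i h g ->
  forall v, v i.+2 = q ^+ 2 * v i.+1 -> tau * ev g v = (tau ^+ 2 - 1) * ev h v.
Proof.
case: N h g => [|[|M]] h g // iN mh hs hD v vi; apply/eqP; rewrite -subr_eq0.
have iM : (i < M)%N by [].
have [iM1 iM2] : ((i < M.+2) /\ (i.+1 < M.+2))%N by lia.
pose L : {mpoly F[M.+2]} := ('X_(Ordinal iM2) - 'X_(Ordinal iM1)) * 'X_(Ordinal iM2).
have [i20 i10 i12] : [/\ (i.+2 == i) = false, (i.+1 == i) = false &
  (i.+1 == i.+2) = false] by split; lia.
rewrite -!evZ -evB; apply/eqP.
apply: (density q_inf (@pair_affine _ i.+1 i.+2 (q ^+ 2)) (L := L) (x0 :=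
  fun k => if k == i then 0 else if k == i.+2 then q ^+ 2 else 1)) vi.
2: by rewrite eqxx i20 i10 i12 mulr1.
2: by rewrite evM evB !evX /= eqxx i10 i12 subr0 mulr1 oner_eq0.
move=> {}v vi; rewrite evB !evZ evM evB !evX /=.
set x := v i; set u := v i.+1.
have [->|u0] := eqVneq u 0; first by rewrite mulr0 mul0r.
have [Q1 mQ1 hQ1] := restr_adj u mh iM2.
have [Q2 mQ2 hQ2] := restr_adj u mh iN.
(* With third value c = u the two points are (u, q^2 u, u) and (u, u, q^2 u), exchanged by the
   symmetry of h. *)
have e12 : (u - q ^+ 4 * u) *: Q1 = (u - q ^- 2 * u) *: Q2.
  apply: (quotients_prop iM mQ1 mQ2 hQ1 hQ2) => w wi.
  apply: (ev_swap_sym hs) => k kM; adj_cases => //; subst => //; rewrite ?wi //.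
pose w k := v (emb i.+1 i.+2 k).
have wi : w i = x by rewrite /w /emb ltnSn.
have e1 : ev h v = (x - q ^- 2 * u) * (hrest M i u w * ev Q2 w).
  rewrite mulrA -wi -hprod_right // -hQ2; apply: ev_ext => k _.
  by rewrite -vi ins_id.
have e2 : ev h (sw i v) = (x - q ^+ 4 * u) * (hrest M i u w * ev Q1 w).
  rewrite mulrA -wi -hprod_left // -hQ1; apply/esym/(ev_swap_sym hs) => k kM.
  adj_cases => //; subst => //; rewrite /w /emb; congr (v _).
    by split_ifs; lia.
  by split_ifs; lia.
have := hD v; rewrite -/x -/u e1 e2.
have := congr1 (fun p => ev p w) e12; rewrite /= !evZ.
move: (ev Q1 w) (ev Q2 w) (hrest _ _ _ _) (ev g v) => A B C D eAB eD.
have n41 : 1 - q ^+ 4 != 0 by rewrite subr_eq0 eq_sym (q_nroot 3).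
have eA : A = (1 - q ^- 2) / (1 - q ^+ 4) * B.
  apply: (mulfI (mulf_neq0 n41 u0)).
  have -> : (1 - q ^+ 4) * u * A = (u - q ^+ 4 * u) * A by ring.
  by rewrite eAB; field; rewrite q_neq0 n41.
have -> : forall Y, (u - x) * u * (tau * D - Y) = u * (tau * (D * (u - x)) - (u - x) * Y).
  by move=> Y; ring.
by rewrite eD eA; field; rewrite q_neq0 n41.
Qed.

Lemma isD_braid_right N (h g : {mpoly F[N]}) i : (i.+2 < N)%N -> min_wheel h ->
  (forall v, ev h (sw i v) = ev h v) -> isD i.+1 h g ->
  forall v, v i.+1 = q ^+ 2 * v i -> tau * ev g v = (tau ^+ 2 - 1) * ev h v.
Proof.
case: N h g => [|[|M]] h g // iN mh hs hD v vi; apply/eqP; rewrite -subr_eq0.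
have iM : (i < M)%N by [].
have [iM1 iM2] : ((i < M.+2) /\ (i.+1 < M.+2))%N by lia.
pose L : {mpoly F[M.+2]} := ('X_(Ordinal iN) - 'X_(Ordinal iM2)) * 'X_(Ordinal iM1).
have [i20 i10 i12] : [/\ (i.+2 == i) = false, (i.+1 == i) = false &
  (i.+1 == i.+2) = false] by split; lia.
have [i01 i02 i21] : [/\ (i == i.+1) = false, (i == i.+2) = false &
  (i.+2 == i.+1) = false] by split; lia.
rewrite -!evZ -evB; apply/eqP.
apply: (density q_inf (@pair_affine _ i i.+1 (q ^+ 2)) (L := L) (x0 :=
  fun k => if k == i.+2 then 0 else if k == i.+1 then q ^+ 2 else 1)) vi.
2: by rewrite eqxx i01 i02 i12 mulr1.
2: by rewrite evM evB !evX /= !eqxx i12 i01 i02 sub0r mulr1 oppr_eq0 expf_neq0.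
move=> {}v vi; rewrite evB !evZ evM evB !evX /= vi.
set x := v i.+2; set u := v i.
have [->|u0] := eqVneq u 0; first by rewrite mulr0 mul0r.
have [Q1 mQ1 hQ1] := restr_adj u mh iM2.
have [Q2 mQ2 hQ2] := restr_adj u mh iN.
(* Here c = q^2 u: the points (u, q^2 u, q^2 u) and (q^2 u, u, q^2 u) are exchanged. *)
have e12 : (q ^+ 2 * u - q ^+ 4 * u) *: Q1 = (q ^+ 2 * u - q ^- 2 * u) *: Q2.
  apply: (quotients_prop iM mQ1 mQ2 hQ1 hQ2) => w wi.
  apply: (ev_swap_sym hs) => k kM; adj_cases => //; subst => //; rewrite ?wi //.
pose w k := v (emb i i.+1 k).
have wi : w i = x by rewrite /w /emb !ltnn.
have e1 : ev h v = (x - q ^+ 4 * u) * (hrest M i u w * ev Q1 w).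
  rewrite mulrA -wi -hprod_left // -hQ1; apply: ev_ext => k _.
  by rewrite -[LHS](ins_id v k (ltnSn i)) vi.
have e2 : ev h (sw i.+1 v) = (x - q ^- 2 * u) * (hrest M i u w * ev Q2 w).
  rewrite mulrA -wi -hprod_right // -hQ2; apply/esym/(ev_swap_sym hs) => k kM.
  adj_cases => //; subst => //; rewrite /w /emb; congr (v _).
    by split_ifs; lia.
  by split_ifs; lia.
have := hD v; rewrite -/x vi -/u e1 e2.
have := congr1 (fun p => ev p w) e12; rewrite /= !evZ.
move: (ev Q1 w) (ev Q2 w) (hrest _ _ _ _) (ev g v) => A B C D eAB eD.
have n41 : q ^+ 4 - 1 != 0 by rewrite subr_eq0 (q_nroot 3).
have eB : B = q ^+ 2 * (q ^+ 2 - q ^+ 4) / (q ^+ 4 - 1) * A.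
  apply: (mulfI (mulf_neq0 n41 u0)).
  have -> : (q ^+ 4 - 1) * u * B = q ^+ 2 * ((q ^+ 2 * u - q ^- 2 * u) * B).
    by field.
  by rewrite -eAB; field.
have -> : forall Y, (x - q ^+ 2 * u) * u * (tau * D - Y) =
    u * (tau * (D * (x - q ^+ 2 * u)) - (x - q ^+ 2 * u) * Y).
  by move=> Y; ring.
by rewrite eD eB; field; rewrite q_neq0 n41.
Qed.

(* On polynomials satisfying the wheel condition the operators tau - D_a obey
   the Temperley-Lieb relations; the two lemmas below are consequences. *)
Lemma isD_TL_left N (a b c : 'I_N) (f g0 g1 g2 : {mpoly F[N]}) :
  b = a.+1 :> nat -> c = b.+1 :> nat -> min_wheel f -> pair_vanish f a b ->
  isD a f g0 -> isD b f g1 -> isD a g1 g2 ->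
  forall v, v c = q ^+ 2 * v b -> ev g2 v = ev f v.
Proof.
move=> ba cb mf vf h0 h1 h2 v.
have [bN cN] : (b.+1 < N)%N /\ (a.+2 < N)%N by rewrite -cb -ba -cb.
have mg1 := isD_min q_neq0 q_nroot cb h1 mf.
rewrite ba in vf; have e0 := isD_eigen q_neq0 q_nroot ba h0 mf vf.
rewrite e0 in h0; rewrite cb ba in bN h1 * => vc.
(* For h = tau f - D_b f, symmetric in z_b, z_c, one has D_a h = tau^2 f - g2. On the hyperplane D_b
   f vanishes, so the relation reads tau (tau^2 f - g2) = (tau^2 - 1) tau f. *)
have mh : min_wheel (tau *: f - g1) by apply: min_wheelB mg1; apply: min_wheelZ.
have := isD_braid_left cN mh (isD_sym q_neq0 q_nroot bN h1)
  (isDB (isDZ tau h0) h2) vc.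
rewrite !evB !evZ (isD_pair q_neq0 q_nroot bN h1 vc) => e.
apply: (mulfI (tau_neq0 q_neq0 q_nroot)); apply/eqP; rewrite -subr_eq0.
move/eqP: e; rewrite -subr_eq0 -oppr_eq0; congr (_ == 0); ring.
Qed.

Lemma isD_TL_right N (a b c : 'I_N) (f g0 g1 g2 : {mpoly F[N]}) :
  b = a.+1 :> nat -> c = b.+1 :> nat -> min_wheel f -> pair_vanish f b c ->
  isD b f g0 -> isD a f g1 -> isD b g1 g2 ->
  forall v, v b = q ^+ 2 * v a -> ev g2 v = ev f v.
Proof.
move=> ba cb mf vf h0 h1 h2 v.
have cN : (a.+2 < N)%N by rewrite -ba -cb.
have bN := ltnW cN.
have mg1 := isD_min q_neq0 q_nroot ba h1 mf.
rewrite cb in vf; have e0 := isD_eigen q_neq0 q_nroot cb h0 mf vf.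
rewrite e0 in h0; rewrite ba in h0 h2 * => vc.
have mh : min_wheel (tau *: f - g1) by apply: min_wheelB mg1; apply: min_wheelZ.
have := isD_braid_right cN mh (isD_sym q_neq0 q_nroot bN h1)
  (isDB (isDZ tau h0) h2) vc.
rewrite !evB !evZ (isD_pair q_neq0 q_nroot bN h1 vc) => e.
apply: (mulfI (tau_neq0 q_neq0 q_nroot)); apply/eqP; rewrite -subr_eq0.
move/eqP: e; rewrite -subr_eq0 -oppr_eq0; congr (_ == 0); ring.
Qed.
End BraidRelation.

(** * Lattice words of noncrossing matchings *)

Local Open Scope nat_scope.

Lemma cnt_le w k : (cnt w k <= k)%N.
Proof. by elim: k => // k IH; rewrite cntS; case: (w k); lia. Qed.

Lemma cntC w k : (cnt (fun i => ~~ w i) k = k - cnt w k)%N.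
Proof.
elim: k => // k IH; rewrite !cntS IH; have := cnt_le w k.
by case: (w k) => /=; lia.
Qed.

Lemma cnt_mono w k l : (k <= l)%N -> (cnt w k <= cnt w l)%N.
Proof.
by move=> kl; rewrite -(subnK kl); elim: (l - k)%N => // d IH; rewrite addSn cntS; lia.
Qed.

Lemma cnt_lip w k l : (k <= l)%N -> (cnt w l <= cnt w k + (l - k))%N.
Proof.
elim: l => [|l IH]; first by rewrite leqn0 => /eqP->.
rewrite leq_eqVlt => /orP[/eqP->|]; first by lia.
by move=> kl; rewrite cntS; have := IH kl; case: (w l); lia.
Qed.

Lemma card_cnt N (w : nat -> bool) k : (k <= N)%N -> #|[set h : 'I_N | (h < k)%N && w h]| = cnt w k.
Proof.
elim: k => [|k IH] kN.
  by apply/eqP; rewrite cards_eq0; apply/eqP/setP => h; rewrite !inE.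
have -> : [set h : 'I_N | (h < k.+1)%N && w h] =
    (if w k then [set Ordinal kN] else set0) :|: [set h : 'I_N | (h < k)%N && w h].
  apply/setP => h; rewrite !inE ltnS leq_eqVlt.
  case: eqP => [e|ne].
    rewrite e ltnn /= orbF; case: ifP => wk; rewrite inE //.
    by apply/esym/eqP/val_inj.
  case: ifP => _; rewrite ?inE //; case: eqP => // e; case: ne.
  by rewrite e.
rewrite cntS cardsU IH; last exact: ltnW.
case: ifP => wk; last by rewrite set0I cards0; lia.
rewrite cards1 (_ : _ :&: _ = set0) ?cards0; first by lia.
by apply/setP => h; rewrite !inE; case: eqP => // ->; rewrite /= ltnn.
Qed.

Lemma cnt_move (w w' : nat -> bool) x y k : (x < y)%N ->
  w x -> ~~ w y -> ~~ w' x -> w' y ->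
  (forall i, (i < k)%N -> i != x -> i != y -> w' i = w i) ->
  (cnt w' k + ((x < k) && (k <= y)) = cnt w k)%N.
Proof.
move=> xy wx wy wx' wy'; elim: k => // k IH h; rewrite !cntS.
have {}IH := IH (fun i ik => h i (ltnW ik)).
have [kx|kx] := eqVneq k x.
  by move: IH; rewrite kx wx (negbTE wx'); case: ltngtP => //=; lia.
have [ky|ky] := eqVneq k y.
  by move: IH; rewrite ky (negbTE wy) wy' ltnn leqnn xy /=; lia.
rewrite h //; lia.
Qed.

Section NCM.
Variable n : nat.
Implicit Types (m s p t : ncm n) (i j : 'I_(n + n)).

Lemma ncm_spec m : [/\ forall i, m i != i, forall i, m (m i) = i &
  forall i j, (i < j)%N -> (j < m i)%N -> (m i < m j)%N -> False].
Proof.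
case: m => f /= /and3P[/forallP h1 /forallP h2 /forallP h3]; split=> //.
  by move=> i; apply/eqP.
move=> i j ij jm mm; have /forallP/(_ j) := h3 i.
by rewrite ij jm mm.
Qed.

Lemma ncmK m : involutive m. Proof. by case: (ncm_spec m). Qed.
Lemma ncm_neq m i : m i != i. Proof. by case: (ncm_spec m). Qed.
Lemma ncm_nc m i j : (i < j)%N -> (j < m i)%N -> (m i < m j)%N -> False.
Proof. by case: (ncm_spec m) => _ _; apply. Qed.
Lemma ncm_neqn m i : (m i != i :> nat).
Proof. exact: ncm_neq. Qed.

(* The lattice path of m: true is a north-step; false beyond the 2n points. *)
Definition word m (k : nat) : bool :=
  if insub k is Some i then Defs.is_left m i else false.

Lemma wordE m i : word m i = (i < m i)%N.
Proof. by rewrite /word valK. Qed.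

Lemma northsE m i : norths m i = cnt (word m) i.
Proof.
rewrite -(@card_cnt (n + n)); last exact: ltnW.
by apply: eq_card => h; rewrite !inE wordE.
Qed.

Lemma eastsE m i : easts m i = (i - cnt (word m) i)%N.
Proof.
rewrite -cntC -(@card_cnt (n + n)); last exact: ltnW.
by apply: eq_card => h; rewrite !inE wordE.
Qed.

(** Sending each right end to its left end injects the right ends of a prefix into its left ends; on
    all points the reverse map is injective too. *)
Lemma word_dyck m : dyck (n + n) (word m).
Proof.
have R k : (k <= n + n)%N -> (cnt (fun i : nat => ~~ word m i) k <= cnt (word m) k)%N.
  move=> kN; rewrite -!(card_cnt _ kN) -(card_imset _ (inv_inj (ncmK m))).
  apply/subset_leq_card/subsetP => x /imsetP[y]; rewrite !inE !wordE => /andP[yk].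
  rewrite -leqNgt leq_eqVlt (negbTE (ncm_neqn m y)) /= => my ->.
  by rewrite (ltn_trans my yk) ncmK my.
split=> [k kN|]; first by have := R k kN; rewrite cntC; lia.
have := R _ (leqnn _); rewrite cntC.
suff : (cnt (word m) (n + n) <= cnt (fun i : nat => ~~ word m i) (n + n))%N.
  by rewrite cntC; have := cnt_le (word m) (n + n); lia.
rewrite -!(card_cnt _ (leqnn _)) -(card_imset _ (inv_inj (ncmK m))).
apply/subset_leq_card/subsetP => x /imsetP[y]; rewrite !inE !wordE => /andP[_ my] ->.
by rewrite ltn_ord /= ncmK -leqNgt ltnW.
Qed.

(** Take the first right end b where the matchings f, g differ, say f b < g b. Noncrossing forces
    the left end g b to be matched by f to a right end before b, where f and g agree: a
    contradiction. *)
Lemma word_inj s p : (forall k, (k < n + n)%N -> word s k = word p k) -> s = p.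
Proof.
move=> h; apply: val_inj; apply/ffunP => /= x.
have {}h i : (i < s i)%N = (i < p i)%N by rewrite -!wordE h.
suff R (b : 'I_(n + n)) : (s b < b)%N -> s b = p b.
  case: (ltngtP (s x) x) => [|xs|/eqP]; first exact: R.
    have := R (s x); rewrite ncmK => /(_ xs) e.
    by rewrite [in RHS]e ncmK.
  by rewrite (negbTE (ncm_neqn _ _)).
have [k] := ubnP b; elim: k b => // k IH b bk sb.
have pb : (p b < b)%N.
  by rewrite ltn_neqAle ncm_neqn leqNgt -h -leqNgt ltnW.
have {}IH (c : 'I_(n + n)) : (c < b)%N -> (s c < c)%N -> s c = p c.
  by move=> cb; apply: IH; apply: leq_trans cb _.
have G (f g : ncm n) : (forall c : 'I_(n + n), (c < b)%N -> (f c < c)%N -> f c = g c) ->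
    (forall i, (i < f i)%N = (i < g i)%N) ->
    (g b < b)%N -> (f b < g b)%N -> False.
  move=> fg hh gb lt.
  have f1 : (g b < f (g b))%N by rewrite hh ncmK.
  have fne : f (g b) != b :> nat.
    apply: contraTneq lt => /val_inj e; rewrite -leqNgt.
    by rewrite -[X in (_ <= f X)%N]e ncmK.
  have f2 : (f (g b) < b)%N.
    have := @ncm_nc f (f b) (g b) lt; rewrite ncmK => /(_ gb).
    by case: (ltngtP b (f (g b))) fne => // _ _ /(_ isT).
  have := fg _ f2; rewrite ncmK => /(_ f1) e.
  by have := congr1 g e; rewrite !ncmK => eb; move: fne; rewrite -eb eqxx.
apply/val_inj/eqP; case: (ltngtP (s b) (p b)) => // lt.
  by case: (G s p).
case: (G p s) => // c cb pc; rewrite IH //.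
by rewrite ltn_neqAle ncm_neqn leqNgt h -leqNgt ltnW.
Qed.

(** After n + c - r steps the path is on the antidiagonal through the upper left and lower right
    corners of the box, so a single height decides on which side of the box it passes. *)
Lemma mem_diagram m (r c : 'I_n) :
  ((r, c) \in diagram m) = (cnt (word m) (n + c - r) < n - r)%N.
Proof.
have [dk dN] := word_dyck m.
rewrite inE /=; apply/existsP/idP => [[i /and3P[li /eqP ec nr]]|lt].
  rewrite eastsE northsE in ec nr.
  have e1 : cnt (word m) i.+1 = cnt (word m) i.
    by rewrite cntS wordE; move: li; rewrite /Defs.is_left => /negbTE->; rewrite addn0.
  have := cnt_lip (word m) (_ : i.+1 <= n + c - r)%N; rewrite e1.
  have := cnt_le (word m) i; have := ltn_ord r.
  by move=> h1 h2 /(_ _)h3; have := h3 ltac:(lia); lia.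
pose k := (n + c - r)%N; have rn := ltn_ord r; have cn := ltn_ord c.
have kc : (c < k - cnt (word m) k)%N by rewrite /k; lia.
have [i] : exists2 i : nat, (i < k)%N && ~~ word m i & (i - cnt (word m) i = c)%N.
  elim: (k) kc => // l IH; rewrite cntS.
  have := cnt_le (word m) l.
  case wl : (word m l) => /= le h.
    by have [|i /andP[il wi] ei] := IH; [lia|exists i => //; rewrite wi ltnW].
  have [e|ne] := eqVneq (l - cnt (word m) l)%N c.
    by exists l => //; rewrite ltnSn wl.
  by have [|i /andP[il wi] ei] := IH; [lia|exists i => //; rewrite wi ltnW].
move=> /andP[ik wi] ei; have iN : (i < n + n)%N by rewrite /k in ik; lia.
exists (Ordinal iN); rewrite eastsE northsE /= ei eqxx /=.
have := wordE m (Ordinal iN); rewrite /= (negbTE wi) /Defs.is_left => <- /=.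
by have := cnt_mono (word m) (ltnW ik); rewrite -/k in lt; lia.
Qed.

Lemma ncleP s p : reflect (forall k, (k <= n + n)%N ->
  cnt (word p) k <= cnt (word s) k)%N (ncle s p).
Proof.
apply: (iffP subsetP) => [h k kN|h [r c]]; last first.
  rewrite !mem_diagram; apply: leq_ltn_trans; apply: h.
  by have := ltn_ord r; have := ltn_ord c; lia.
rewrite leqNgt; apply/negP => lt.
have [ds eS] := word_dyck s; have [dp eP] := word_dyck p.
have mp := cnt_mono (word p) kN.
have lp := cnt_lip (word p) kN; have lek := cnt_le (word p) k.
(* The box of the diagonal k whose lower right corner is the point of the path of s; it is missing
   in p, whose path is higher there. *)
pose v := cnt (word s) k.
have rP : (n - v.+1 < n)%N by rewrite /v; lia.
have cP : (k - v.+1 < n)%N by have := cnt_lip (word s) kN; rewrite /v; lia.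
have := h (Ordinal rP, Ordinal cP); rewrite !mem_diagram /=.
have -> : (n + (k - v.+1) - (n - v.+1) = k)%N by rewrite /v; lia.
by rewrite -/v => /(_ _)hh; have := hh ltac:(rewrite /v; lia); rewrite /v; lia.
Qed.

End NCM.

Lemma ordS_val N (a b : 'I_N) : b = a.+1 :> nat -> ordS a = b.
Proof. by move=> e; apply: val_inj; rewrite /= -e modn_small. Qed.

(** * Adding and removing a box on matchings *)

Section Moves.
Variable n : nat.
Implicit Types (m s p t : ncm n) (i j : 'I_(n + n)).
Variables (a b : 'I_(n + n)).
Hypothesis ab : b = a.+1 :> nat.

Let eab : ordS a = b := ordS_val ab.
Let neq_ba : (b == a) = false.
Proof. by rewrite -val_eqE /= ab gtn_eqF. Qed.
Lemma e_op_id m : m a = b -> e_op a m = m.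
Proof.
move=> mab; have mba : m b = a by rewrite -mab ncmK.
apply/ffunP => i; rewrite ffunE eab mab mba.
by case: eqP => [->|_] //; case: eqP => [->|_].
Qed.

Lemma e_op_far m (c d : 'I_(n + n)) : m c = d ->
  c != a -> c != b -> d != a -> d != b -> e_op a m c = d.
Proof.
move=> mcd ca cb da db; rewrite ffunE eab (negbTE ca) (negbTE cb).
have inv x y : x == m y -> y = m x by move=> /eqP->; rewrite ncmK.
case: ifP => [/inv e|_]; first by rewrite e mcd eqxx in da.
by case: ifP => [/inv e|_]; first by rewrite e mcd eqxx in db.
Qed.

(* Removing the box below a corner "east, north" of the path. *)
Lemma lower_subproof m : (m a < a)%N -> (b < m b)%N -> is_ncm (e_op a m).
Proof.
move=> ma mb; set x := m a; set y := m b.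
have mx : m x = a by rewrite /x ncmK.
have my : m y = b by rewrite /y ncmK.
have eE i : e_op a m i = if i == a then b else if i == b then a else
    if i == x then y else if i == y then x else m i by rewrite ffunE eab.
have xa : (x < a)%N by []. have yb : (b < y)%N by [].
have C i : [\/ i = a, i = b, i = x | i = y] \/
   ([/\ (i != a :> nat), (i != b :> nat), (i != x :> nat) & (i != y :> nat)]
    /\ [/\ (m i != a :> nat), (m i != b :> nat), (m i != x :> nat) & (m i != y :> nat)]).
  have [->|ia] := eqVneq i a; first by left; constructor 1.
  have [->|ib] := eqVneq i b; first by left; constructor 2.
  have [->|ix] := eqVneq i x; first by left; constructor 3.
  have [->|iy] := eqVneq i y; first by left; constructor 4.
  right; split; split=> //.
  - by apply: contraNneq ix => /val_inj; rewrite /x => <-; rewrite ncmK.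
  - by apply: contraNneq iy => /val_inj; rewrite /y => <-; rewrite ncmK.
  - by apply: contraNneq ia => /val_inj e; rewrite -mx -e ncmK.
  - by apply: contraNneq ib => /val_inj e; rewrite -my -e ncmK.
have ea : e_op a m a = b by rewrite eE eqxx.
have eb : e_op a m b = a by rewrite eE neq_ba eqxx.
have N (u v : 'I_(n + n)) : (u != v :> nat) -> (u == v) = false by move/negbTE.
have ex : e_op a m x = y by rewrite eE (N x a) ?(N x b) ?eqxx //; lia.
have ey : e_op a m y = x.
  by rewrite eE (N y a) ?(N y b) ?(N y x) ?eqxx //; lia.
have eo i : [/\ (i != a :> nat), (i != b :> nat), (i != x :> nat) & (i != y :> nat)] ->
    e_op a m i = m i.
  by case; rewrite eE -!val_eqE => /negbTE-> /negbTE-> /negbTE-> /negbTE->.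
apply/and3P; split.
- apply/forallP => i; rewrite -val_eqE /=.
  case: (C i) => [[->|->|->|->]|[h _]]; rewrite ?ea ?eb ?ex ?ey ?eo ?ncm_neqn //; lia.
- apply/forallP => i; apply/eqP.
  case: (C i) => [[->|->|->|->]|[h [h1 h2 h3 h4]]]; rewrite ?(ea, eb, ex, ey) //.
  by rewrite (eo i h) (eo (m i)) ?ncmK.
apply/forallP => i; apply/forallP => j; apply/negP => /and3P[].
have nc u v := @ncm_nc n m u v.
case: (C i) => [[->|->|->|->]|[hi hi']]; case: (C j) => [[->|->|->|->]|[hj hj']];
  rewrite ?(ea, eb, ex, ey) ?(eo _ hi) ?(eo _ hj); try lia.
- by case: hj => *; have := nc x j; have := nc b j; rewrite mx -/y; lia.
- by case: hi' => *; have := nc i x; have := nc i b; rewrite mx -/y; lia.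
by move=> h1 h2 h3; apply: (nc i j).
Qed.

Definition raise_fun m (x : 'I_(n + n)) : {ffun 'I_(n + n) -> 'I_(n + n)} :=
  [ffun i => if i == a then x else if i == x then a else
     if i == b then m x else if i == m x then b else m i].

(** The last hypothesis makes {x, m x} the innermost arch around {a, b}; otherwise the new arches
    {x, a} and {b, m x} would cross those in between. *)
Lemma raise_subproof m (x : 'I_(n + n)) : m a = b -> (x < a)%N -> (b < m x)%N ->
  (forall i, (x < i)%N -> (i < a)%N -> (m i <= b)%N) -> is_ncm (raise_fun m x).
Proof.
move=> mab xa xy xmax; have mba : m b = a by rewrite -mab ncmK.
set y := m x in xy; have my : m y = x by rewrite /y ncmK.
set f := raise_fun m x.
have fE i : f i = if i == a then x else if i == x then a else
  if i == b then y else if i == y then b else m i by rewrite ffunE.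
have C i : [\/ i = a, i = b, i = x | i = y] \/
   ([/\ (i != a :> nat), (i != b :> nat), (i != x :> nat) & (i != y :> nat)]
    /\ [/\ (m i != a :> nat), (m i != b :> nat), (m i != x :> nat) & (m i != y :> nat)]).
  have [->|ia] := eqVneq i a; first by left; constructor 1.
  have [->|ib] := eqVneq i b; first by left; constructor 2.
  have [->|ix] := eqVneq i x; first by left; constructor 3.
  have [->|iy] := eqVneq i y; first by left; constructor 4.
  right; split; split=> //.
  - by apply: contraNneq ib => /val_inj e; rewrite -mab -e ncmK.
  - by apply: contraNneq ia => /val_inj e; rewrite -mba -e ncmK.
  - by apply: contraNneq iy => /val_inj; rewrite /y => <-; rewrite ncmK.
  - by apply: contraNneq ix => /val_inj e; rewrite -my -e ncmK.
have N (u v : 'I_(n + n)) : (u != v :> nat) -> (u == v) = false by move/negbTE.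
have fa : f a = x by rewrite fE eqxx.
have fx : f x = a by rewrite fE (N x a) ?eqxx //; lia.
have fb : f b = y by rewrite fE (N b a) ?(N b x) ?eqxx //; lia.
have fy : f y = b by rewrite fE (N y a) ?(N y x) ?(N y b) ?eqxx //; lia.
have fo i : [/\ (i != a :> nat), (i != b :> nat), (i != x :> nat) & (i != y :> nat)] ->
    f i = m i.
  by case; rewrite fE -!val_eqE => /negbTE-> /negbTE-> /negbTE-> /negbTE->.
apply/and3P; split.
- apply/forallP => i; rewrite -val_eqE /=.
  case: (C i) => [[->|->|->|->]|[h _]]; rewrite ?fa ?fb ?fx ?fy ?fo ?ncm_neqn //; lia.
- apply/forallP => i; apply/eqP.
  case: (C i) => [[->|->|->|->]|[h [h1 h2 h3 h4]]]; rewrite ?(fa, fb, fx, fy) //.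
  by rewrite (fo i h) (fo (m i)) ?ncmK.
apply/forallP => i; apply/forallP => j; apply/negP => /and3P[].
have nc u v := @ncm_nc n m u v.
case: (C i) => [[->|->|->|->]|[hi hi']]; case: (C j) => [[->|->|->|->]|[hj hj']];
  rewrite ?(fa, fb, fx, fy) ?(fo _ hi) ?(fo _ hj); try lia.
- by case: hj => *; have := nc x j; have := xmax j; rewrite -/y; lia.
- by case: hj => *; case: hj' => *; have := nc x j; have := xmax j; rewrite -/y; lia.
- case: hi => *; case: hi' => *; have := nc i x; have := xmax i; rewrite -/y; lia.
- case: hi => *; case: hi' => *; have := nc i x; have := xmax i; rewrite -/y; lia.
by move=> h1 h2 h3; apply: (nc i j).
Qed.

(** Adding a box, read on lattice words: a peak of s at a, b becomes a valley of p. *)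
Definition swapped s p := [/\ word s a, ~~ word s b, ~~ word p a, word p b &
  forall k : nat, k != a -> k != b -> word p k = word s k].

Lemma swapped_cnt s p k : swapped s p ->
  (cnt (word p) k + (k == b) = cnt (word s) k)%N.
Proof.
case=> sa sb pa pb h.
rewrite -(@cnt_move (word s) (word p) a b k) //; first by rewrite ab; congr (_ + _)%N; lia.
  by rewrite ab.
by move=> i _; apply: h.
Qed.

Lemma swapped_adds_box s p : swapped s p -> adds_box a s p.
Proof.
move=> h; have [sa sb pa pb _] := h.
have [ds es] := word_dyck s; have [dp ep] := word_dyck p.
have bN := ltn_ord b.
have cb := swapped_cnt b h; rewrite eqxx in cb.
have sb1 : cnt (word s) b = (cnt (word s) a).+1 by rewrite ab cntS sa addn1.
have lb := cnt_le (word s) a.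
have sb2 : cnt (word s) b.+1 = cnt (word s) b by rewrite cntS (negbTE sb) addn0.
have lip := cnt_lip (word s) bN; have mon := cnt_mono (word s) bN.
have rP : (n - cnt (word s) b < n)%N by lia.
have cP : (b - cnt (word s) b < n)%N by lia.
have [dsb dpb] := (ds b (ltnW bN), dp b (ltnW bN)).
(* The box whose upper left corner is the peak, reached after b steps. *)
apply/existsP; exists (Ordinal rP, Ordinal cP); apply/and3P; split.
- rewrite mem_diagram /= -leqNgt.
  have e : (n + (b - cnt (word s) b) - (n - cnt (word s) b) = b)%N by lia.
  by rewrite e; lia.
- apply/eqP/setP => -[r c]; rewrite in_setU1 !mem_diagram xpair_eqE -!val_eqE /=.
  have rn := ltn_ord r; have cn := ltn_ord c.
  have := swapped_cnt (n + c - r) h.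
  have [e|ne] := eqVneq (n + c - r)%N b; last by lia.
  by rewrite e; lia.
by rewrite /=; lia.
Qed.
End Moves.

Section Corners.
Variable n : nat.
Implicit Types (m s p t : ncm n) (i j : 'I_(n + n)).

Lemma word_gt m k : (n + n <= k)%N -> word m k = false.
Proof. by move=> h; rewrite /word insubF // ltnNge h. Qed.

Lemma swappedI (a b : 'I_(n + n)) s p : word s a -> ~~ word s b -> ~~ word p a ->
  word p b -> (forall i, i != a -> i != b -> word p i = word s i) -> swapped a b s p.
Proof.
move=> h1 h2 h3 h4 h; split=> // k ka kb.
have [kn|kn] := ltnP k (n + n); last by rewrite !word_gt.
exact: (h (Ordinal kn)).
Qed.

Variables (a b : 'I_(n + n)).
Hypothesis ab : b = a.+1 :> nat.

Lemma arch_adj m : word m a -> ~~ word m b -> m a = b.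
Proof.
rewrite !wordE => ma; rewrite -leqNgt leq_eqVlt (negbTE (ncm_neqn _ _)) /= => mb.
apply/eqP; apply: contraT => ne; have ne' : (m a != b :> nat) by [].
have ne2 : (m b != a :> nat).
  by apply: contraNneq ne => /val_inj e; rewrite -e ncmK.
have := @ncm_nc n m (m b) a; rewrite ncmK; lia.
Qed.

Lemma arch_words m : m a = b -> word m a /\ ~~ word m b.
Proof.
move=> h; have h' : m b = a by rewrite -h ncmK.
by rewrite !wordE h h' ab; split; lia.
Qed.

Lemma ncm_lower p : ~~ word p a -> word p b ->
  exists s, [/\ swapped a b s p, s a = b & e_op a p = s].
Proof.
rewrite !wordE => pa pb; have {}pa : (p a < a)%N.
  by rewrite ltn_neqAle ncm_neqn leqNgt pa.
have eab := ordS_val ab.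
pose s : ncm n := NCM (lower_subproof ab pa pb).
have sE i : s i = if i == a then b else if i == b then a else
    if i == p a then p b else if i == p b then p a else p i.
  by rewrite /= ffunE eab.
have neq_ba : (b == a) = false by rewrite -val_eqE /= ab gtn_eqF.
exists s; split=> //; last by rewrite sE eqxx.
apply: swappedI; rewrite ?wordE ?sE ?eqxx ?neq_ba; try lia.
move=> i /negbTE ia /negbTE ib; rewrite !wordE sE ia ib.
case: eqP => [->|_]; first by rewrite ncmK; lia.
by case: eqP => [->|_] //; rewrite ncmK; lia.
Qed.

(** The inequality puts more left than right ends before a, so some arch passes over {a, b}. The
    innermost one is exchanged with {a, b}. *)
Lemma ncm_raise s : s a = b -> (a < 2 * cnt (word s) a)%N ->
  exists p, swapped a b s p.
Proof.
move=> sab lt; have aN := ltnW (ltn_ord a).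
have [i0 Pi0] : exists i, (i < a)%N && (b < s i)%N.
  apply/existsP; rewrite -[[exists _, _]]negbK negb_exists; apply/negP => /forallP h.
  suff : (cnt (word s) a <= cnt (fun k : nat => ~~ word s k) a)%N.
    by rewrite cntC; lia.
  rewrite -!(card_cnt _ aN) -(card_imset _ (inv_inj (ncmK s))).
  apply/subset_leq_card/subsetP => x /imsetP[i]; rewrite !inE => /andP[ia wi] ->.
  have := h i; rewrite ia /= -leqNgt => sib.
  move: wi; rewrite !wordE ncmK => wi.
  have sa : s i != a :> nat.
    by apply: contraTneq ia => /val_inj e; rewrite -[i](ncmK s) e sab ab -leqNgt leqnSn.
  have sb : s i != b :> nat.
    by apply: contraTneq ia => /val_inj e; rewrite -[i](ncmK s) e -sab ncmK ltnn.
  by lia.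
pose x := [arg max_(i > i0 | (i < a)%N && (b < s i)%N) (i : nat)].
have [xa xb xmax] : [/\ (x < a)%N, (b < s x)%N &
    forall i, (x < i)%N -> (i < a)%N -> (s i <= b)%N].
  rewrite /x; case: arg_maxnP => // i /andP[h1 h2] h; split=> // j ij ja.
  by rewrite leqNgt; apply/negP => bj; have := h j; rewrite ja bj => /(_ isT) /=; lia.
pose p : ncm n := NCM (raise_subproof ab sab xa xb xmax).
have pE i : p i = if i == a then x else if i == x then a else
   if i == b then s x else if i == s x then b else s i by rewrite /= ffunE.
have neq_ba : (b == a) = false by rewrite -val_eqE /= ab gtn_eqF.
have neq_bx : (b == x) = false by rewrite -val_eqE /=; lia.
have sba : s b = a by rewrite -sab ncmK.
exists p; apply: swappedI; rewrite ?wordE ?pE ?eqxx ?neq_ba ?neq_bx ?sab ?sba; try lia.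
move=> i /negbTE ia /negbTE ib; rewrite !wordE pE ia ib.
case: eqP => [->|_]; first by lia.
by case: eqP => [->|_] //; rewrite ncmK; lia.
Qed.

(** If a and b are both left ends, or both right ends, of t, the reconnection moves one north-step
    to a later place, which can only lower the path. *)
Lemma e_op_words t s : e_op a t = s -> t <> s ->
  (~~ word t a /\ word t b) \/
  [/\ word s a, ~~ word s b & forall k, (cnt (word s) k <= cnt (word t) k)%N]
  .
Proof.
move=> ets ts; have eab := ordS_val ab.
have sE i : s i = if i == a then b else if i == b then a else
    if i == t a then t b else if i == t b then t a else t i.
  by rewrite -ets /= ffunE eab.
have tab : t a != b.
  by apply/eqP => e; apply: ts; apply: val_inj; have := e_op_id ab e; rewrite ets => /= ->.
have tba : t b != a.
  by apply: contraNneq tab => e; rewrite -e ncmK.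
have neq_ba : (b == a) = false by rewrite -val_eqE /= ab gtn_eqF.
have N (u v : 'I_(n + n)) : (u != v :> nat) -> (u == v) = false by move/negbTE.
have sa : s a = b by rewrite sE eqxx.
have [wsa wsb] := arch_words sa.
have tabn : (t a != b :> nat) by []. have tban : (t b != a :> nat) by [].
have taa := ncm_neqn t a. have tbb := ncm_neqn t b.
rewrite !(wordE t); case: (ltnP b (t b)) => tb; case: (ltnP a (t a)) => ta; [right|by left|exfalso|right].
- split=> //.
  have lt : (t b < t a)%N.
    have := @ncm_nc n t a b; have ne : (t a != t b :> nat).
      by rewrite (inj_eq val_inj) (inj_eq (inv_inj (ncmK t))) eq_sym neq_ba.
    lia.
  have w k : (k < n + n)%N -> k != b -> k != t b -> word s k = word t k.
    move=> kn kb ktb; have [e|ka] := eqVneq k a; first by rewrite e wsa wordE ta.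
    have [e|kta] := eqVneq k (t a).
      by rewrite e !wordE sE ncmK (N (t a) a) ?(N (t a) b) ?eqxx; lia.
    pose i := Ordinal kn; rewrite -[k]/(i : nat) !wordE sE.
    by rewrite (N i a) ?(N i b) ?(N i (t a)) ?(N i (t b)).
  move=> k; rewrite -(@cnt_move (word t) (word s) b (t b) k) ?leq_addr ?wordE ?ncmK //.
  - by rewrite -leqNgt ltnW.
  - by rewrite -(wordE s b).
  - by rewrite sE (N (t b) a) ?(N (t b) b) ?(N (t b) (t a)) ?eqxx; lia.
  move=> i ik; have [kn|kn] := ltnP i (n + n); first exact: w.
  by rewrite !word_gt.
- have := @ncm_nc n t (t b) a; rewrite ncmK; lia.
split=> //.
have lt : (t b < t a)%N.
  have := @ncm_nc n t (t a) (t b); rewrite !ncmK; have ne : (t a != t b :> nat).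
    by rewrite (inj_eq val_inj) (inj_eq (inv_inj (ncmK t))) eq_sym neq_ba.
  lia.
have w k : (k < n + n)%N -> k != t a -> k != a -> word s k = word t k.
  move=> kn kta ka; have [e|kb] := eqVneq k b.
    by rewrite e (negbTE wsb) wordE; lia.
  have [e|ktb] := eqVneq k (t b).
    by rewrite e !wordE sE ncmK (N (t b) a) ?(N (t b) b) ?(N (t b) (t a)) ?eqxx; lia.
  pose i := Ordinal kn; rewrite -[k]/(i : nat) !wordE sE.
  by rewrite (N i a) ?(N i b) ?(N i (t a)) ?(N i (t b)).
move=> k; rewrite -(@cnt_move (word t) (word s) (t a) a k) ?leq_addr ?wordE ?ncmK //.
- by lia.
- by lia.
- by rewrite -leqNgt.
- by rewrite sE (N (t a) a) ?(N (t a) b) ?eqxx; lia.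
- by rewrite -(wordE s a).
move=> i ik; have [kn|kn] := ltnP i (n + n); first exact: w.
by rewrite !word_gt.
Qed.

End Corners.

(** * The order, the preimages of e_j, and Dyck words *)

Section Order.
Variable n : nat.
Implicit Types (m s p t : ncm n) (i j : 'I_(n + n)).

(** As e_b t = t here, this is the relation e_b e_a e_b = e_b. *)
Lemma e_op_TL_left (a b c : 'I_(n + n)) t : b = a.+1 :> nat -> c = b.+1 :> nat ->
  t b = c -> e_op b (e_op a t) = t.
Proof.
move=> ab bc tb; have tc : t c = b by rewrite -tb ncmK.
have [eab ebc] := (ordS_val ab, ordS_val bc).
have N (u v : 'I_(n + n)) : (u != v :> nat) -> (u == v) = false by move/negbTE.
have ta : t a != a by exact: ncm_neq.
have tab : t a != b by apply/eqP => e; move: bc; rewrite -tb -e ncmK e ab; lia.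
have tac : t a != c by apply/eqP => e; move: ab; rewrite -tc -e ncmK; lia.
pose e x : 'I_(n + n) := if x == a then b else if x == b then a else
  if x == t a then c else if x == c then t a else t x.
have eE x : e_op a t x = e x by rewrite ffunE eab tb.
apply/ffunP => x; rewrite ffunE ebc !eE /e.
rewrite (N b a) ?(N c a) ?(N c b) 1?[c == t a]eq_sym ?(negbTE tac) ?eqxx; try lia.
rewrite ?eqxx.
case: eqP => [->//|xb]; case: eqP => [->//|xc].
case: eqP => [->//|xa]; case: eqP => [->|//]; by rewrite ncmK.
Qed.

Lemma e_op_TL_right (a b c : 'I_(n + n)) t : b = a.+1 :> nat -> c = b.+1 :> nat ->
  t a = b -> e_op a (e_op b t) = t.
Proof.
move=> ab bc ta; have tb : t b = a by rewrite -ta ncmK.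
have [eab ebc] := (ordS_val ab, ordS_val bc).
have N (u v : 'I_(n + n)) : (u != v :> nat) -> (u == v) = false by move/negbTE.
have tc : t c != c by exact: ncm_neq.
have tca : t c != a by apply/eqP => e; move: bc; rewrite -ta -e ncmK; lia.
have tcb : t c != b by apply/eqP => e; move: bc; rewrite -[c](ncmK t) e tb ab; lia.
pose e x : 'I_(n + n) := if x == b then c else if x == c then b else
  if x == a then t c else if x == t c then a else t x.
have eE x : e_op b t x = e x by rewrite ffunE ebc tb.
apply/ffunP => x; rewrite ffunE eab !eE /e.
rewrite (N a b) ?(N a c) ?eqxx; try lia.
rewrite ?eqxx.
case: eqP => [->//|xa]; case: eqP => [->//|xb].
case: eqP => [->|xtc]; first by rewrite ncmK.
by case: eqP => [->|].
Qed.

Lemma e_preimP (a : 'I_(n + n)) s t : (t \in e_preim a s) = (e_op a t == s).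
Proof. by rewrite inE. Qed.

Lemma swapped_inj (a b : 'I_(n + n)) s p p' :
  swapped a b s p -> swapped a b s p' -> p = p'.
Proof.
move=> [_ _ pa pb h] [_ _ pa' pb' h']; apply: word_inj => k _.
have [->|ka] := eqVneq k a; first by rewrite (negbTE pa) (negbTE pa').
have [->|kb] := eqVneq k b; first by rewrite pb pb'.
by rewrite h // h'.
Qed.

Lemma swapped_inj_l (a b : 'I_(n + n)) s s' p :
  swapped a b s p -> swapped a b s' p -> s = s'.
Proof.
move=> [sa sb _ _ h] [sa' sb' _ _ h']; apply: word_inj => k _.
have [->|ka] := eqVneq k a; first by rewrite sa sa'.
have [->|kb] := eqVneq k b; first by rewrite (negbTE sb) (negbTE sb').
by rewrite -h // h'.
Qed.

(** Makes the recursion for Psi triangular. A preimage with a valley at a, b can only be p, and by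
    [e_op_words] the remaining ones lie below s. *)
Lemma preim_spec (a b : 'I_(n + n)) s p t : b = a.+1 :> nat -> swapped a b s p ->
  t \in e_preim a s :\: [set s; p] ->
  [/\ ncle t s, t a != b & e_op a t = s].
Proof.
move=> ab sw; rewrite in_setD in_set2 e_preimP negb_or => /andP[/andP[ts tp] /eqP ets].
have tab : t a != b.
  apply: contraNneq ts => e; apply/eqP/val_inj.
  by have := e_op_id ab e; rewrite ets.
split=> //; apply/ncleP => k _.
have [|[ta tb]|[_ _]] := e_op_words ab ets; [by apply/eqP| |exact].
have [s' [sw' _ es']] := ncm_lower ab ta tb.
case/eqP: tp; apply: swapped_inj sw' _.
suff -> : s' = s by [].
by apply: val_inj; rewrite /= -es' ets.
Qed.

Lemma ncle_refl s : ncle s s. Proof. exact: subxx. Qed.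
Lemma ncle_trans s t p : ncle s t -> ncle t p -> ncle s p.
Proof. exact: subset_trans. Qed.

Lemma cnt_inj s p : (forall k, (k <= n + n)%N -> cnt (word s) k = cnt (word p) k) -> s = p.
Proof.
move=> h; apply: word_inj => k kN; have := h k.+1 kN.
by rewrite !cntS h ?(ltnW kN) // => /addnI; case: (word s k) (word p k) => [] [].
Qed.

Lemma ncle_anti s p : ncle s p -> ncle p s -> s = p.
Proof.
move=> /ncleP h1 /ncleP h2; apply: cnt_inj => k kN.
by apply/eqP; rewrite eqn_leq h1 ?h2.
Qed.

Lemma ncle_card s p : ncle s p -> s != p -> (#|diagram s| < #|diagram p|)%N.
Proof.
move=> sp ne; apply: proper_card; rewrite properE [_ \subset _]sp /=.
by apply: contraNN ne => ps; apply/eqP/ncle_anti.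
Qed.

Lemma swapped_lt (a b : 'I_(n + n)) s p : b = a.+1 :> nat -> swapped a b s p ->
  ncle s p /\ s != p.
Proof.
move=> ab h; split.
  by apply/ncleP => k _; rewrite -(swapped_cnt ab k h) leq_addr.
by apply: contraTneq isT => e; have := swapped_cnt ab b h; rewrite e eqxx; lia.
Qed.

Lemma word_nested k : (k < n + n)%N -> word (nested n) k = (k < n)%N.
Proof.
move=> kn; have := wordE (nested n) (Ordinal kn); rewrite /= => ->.
by rewrite ffunE /=; lia.
Qed.

Lemma nested_min s : ncle (nested n) s.
Proof.
apply/ncleP => k kN.
have [d e] := word_dyck s.
have -> : cnt (word (nested n)) k = minn k n.
  elim: k kN => [|k IH kN]; first by rewrite min0n.
  rewrite cntS IH ?(ltnW kN) // word_nested //.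
  by case: ltnP; lia.
by have := cnt_le (word s) k; have := cnt_mono (word s) kN; lia.
Qed.

Lemma no_corner (w : nat -> bool) : dyck (n + n) w ->
  (forall k, (k.+1 < n + n)%N -> ~~ w k -> ~~ w k.+1) ->
  forall k, (k < n + n)%N -> w k = (k < n)%N.
Proof.
move=> [d e] h.
have H k l : (k <= l)%N -> (l < n + n)%N -> ~~ w k -> ~~ w l.
  move=> kl; rewrite -(subnK kl); elim: (l - k)%N => // r IH.
  by rewrite addSn => lt wk; apply: h => //; apply: IH => //; lia.
have up k l : (k <= l)%N -> (l <= n + n)%N -> ~~ w k -> cnt w l = cnt w k.
  move=> kl; rewrite -(subnK kl); elim: (l - k)%N => // r IH.
  rewrite addSn => lt wk; rewrite cntS IH ?(ltnW lt) //.
  by rewrite (negbTE (H k _ _ _ wk)) ?addn0 // ?leq_addl.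
have down k l : (l <= k.+1)%N -> (k < n + n)%N -> w k -> cnt w l = l.
  elim: l => // l IH lk kn wk; rewrite cntS IH ?(ltnW lk) //.
  have -> : w l by apply: contraLR wk; apply: H.
  by rewrite addn1.
move=> k kn; apply/idP/idP => [wk|kn'].
  have := down k k.+1 (leqnn _) kn wk; have := cnt_mono w kn; lia.
apply: contraT => wk; have := up k _ (ltnW kn) (leqnn _) wk.
by have := cnt_le w k; lia.
Qed.

(** Turning a valley into a peak raises the path and lowers [mu]. The matching of the raised word is
    known by induction, and [ncm_raise] restores the valley. *)
Lemma ncm_word (w : nat -> bool) : dyck (n + n) w ->
  exists m : ncm n, forall k, (k < n + n)%N -> word m k = w k.
Proof.
pose mu w := (\sum_(k < (n + n).+1) (n + n - cnt w k))%N.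
have [r] := ubnP (mu w); elim: r w => // r IH w wr dw; have [d e] := dw.
have [/existsP[a /existsP[b /and3P[/eqP ab wa wb]]]|] := boolP
    [exists a : 'I_(n + n), exists b : 'I_(n + n),
      [&& b == a.+1 :> nat, ~~ w a & w b]]; last first.
  rewrite negb_exists => /forallP h; exists (nested n) => k kn.
  rewrite word_nested // (no_corner dw) // => l ln wl.
  have := h (Ordinal (ltnW ln)); rewrite negb_exists => /forallP/(_ (Ordinal ln)).
  by rewrite /= eqxx wl.
pose w' (k : nat) := if k == a then true else if k == b then false else w k.
have w'a : w' a by rewrite /w' eqxx.
have w'b : ~~ w' b by rewrite /w' eqxx ab gtn_eqF.
have ltab : (a < b)%N by rewrite ab.
have c' k : (cnt w k + (k == b) = cnt w' k)%N.
  rewrite -(@cnt_move w' w a b k) //; first by congr (_ + _)%N; lia.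
  by move=> i _ /negbTE ia /negbTE ib; rewrite /w' ia ib.
have dw' : dyck (n + n) w'.
  split=> [k kn|]; rewrite -c'; first by have := d k kn; lia.
  by rewrite (gtn_eqF (ltn_ord b)) addn0.
have [|m hm] := IH w' _ dw'.
  rewrite -ltnS; apply: leq_trans wr; rewrite ltnS /mu.
  have bN : (b < (n + n).+1)%N by apply: ltnW; rewrite ltnS.
  rewrite (bigD1 (Ordinal bN)) //= [X in (_ < X)%N](bigD1 (Ordinal bN)) //=.
  rewrite -addSn; apply: leq_add.
    have := cnt_mono w (ltnW (ltn_ord b)); have := ltn_ord b.
    by rewrite -c' eqxx; lia.
  by apply: leq_sum => k _; rewrite -c'; lia.
have ma : m a = b by apply: (arch_adj ab); rewrite hm.
have [|p [_ _ pa pb hp]] := ncm_raise ab ma.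
  rewrite (@eq_cnt _ w'); last by move=> i ia; rewrite hm //; have := ltn_ord a; lia.
  rewrite -c' (ltn_eqF ltab) addn0.
  by have := d a.+1; rewrite cntS (negbTE wa); have := ltn_ord b; lia.
exists p => k kn.
have [->|ka] := eqVneq k a; first by rewrite (negbTE pa) (negbTE wa).
have [->|kb] := eqVneq k b; first by rewrite pb wb.
by rewrite hp // hm // /w' (negbTE ka) (negbTE kb).
Qed.

End Order.

(** * The last box of a Young diagram *)

Section LastBox.
Variable n : nat.
Implicit Types (m s p t : ncm n).

Local Notation comp := (fun f g : pol n -> pol n => f \o g).

(** The outermost factor of [D_pol] for a shape with l + 1 rows, the last of length x. *)
Definition D_row (l x : nat) : pol n -> pol n :=
  \big[comp/idfun]_(1 <= j < x.+1) @D_lab n (n.+1 + x - (l.+1 + j))%N.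

Definition D_shape (sh : seq nat) : pol n :=
  let lam r := nth 0%N sh r.-1 in
  let l := size sh in
  (\big[comp/idfun]_(1 <= i < l.+1)
    \big[comp/idfun]_(1 <= j < (lam (l.+1 - i)%N).+1)
      @D_lab n (n + i + lam (l.+1 - i) - (l + j))%N) (Psi0 n).

Lemma D_row0 l : D_row l 0 = idfun.
Proof. by rewrite /D_row big_geq. Qed.

Lemma D_rowS l x f : D_row l x.+1 f = D_lab (n + x.+1 - l.+1)%N (D_row l x f).
Proof.
rewrite /D_row big_ltn //= big_add1 /=.
have -> : (n.+1 + x.+1 - (l.+1 + 1) = n + x.+1 - l.+1)%N by lia.
congr (@D_lab n _ _); apply: (congr1 (fun g : pol n -> pol n => g f)).
apply: eq_big_nat => j _; congr (@D_lab n _); lia.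
Qed.

Lemma D_shape_rcons sh x : D_shape (rcons sh x) = D_row (size sh) x (D_shape sh).
Proof.
rewrite /D_shape size_rcons big_ltn //= nth_rcons ltnn eqxx addn1.
apply: (congr1 (D_row (size sh) x)); rewrite big_add1 /=.
apply: (congr1 (fun g : pol n -> pol n => g (Psi0 n))).
apply: eq_big_nat => i /andP[i1 il].
have -> : ((size sh).+2 - i.+1 = (size sh).+1 - i)%N by lia.
rewrite nth_rcons ifT; last by lia.
by apply: eq_big_nat => j _; congr (@D_lab n _); lia.
Qed.

Lemma D_polE p : D_pol p = D_shape (Defs.shape p).
Proof. by []. Qed.

Definition row_len p (r : nat) : nat :=
  #|[set c : 'I_n | (cnt (word p) (n + c - r) < n - r)%N]|.

Lemma shapeE p : Defs.shape p = [seq k <- [seq row_len p r | r <- iota 0 n] | (0 < k)%N].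
Proof.
rewrite /Defs.shape; congr filter; rewrite -val_enum_ord -map_comp; apply: eq_map => r /=.
by apply: eq_card => c; rewrite !inE -mem_diagram inE.
Qed.

Lemma diagram_closed p (r r' c c' : 'I_n) : (r' <= r)%N -> (c' <= c)%N ->
  (r, c) \in diagram p -> (r', c') \in diagram p.
Proof.
move=> rr cc; rewrite !mem_diagram => h.
have rn := ltn_ord r.
have [h1 h2] : ((n + c' - r' <= n + c - r')%N /\ (n + c - r <= n + c - r')%N) by lia.
by have := cnt_mono (word p) h1; have := cnt_lip (word p) h2; lia.
Qed.

(** The last box in reading order ends the last nonempty row, so it is a corner. Removing it
    shortens the last part of the shape, which removes the outermost operator of [D_pol]. *)
Lemma last_box p : p != nested n -> exists s (a b : 'I_(n + n)),
  [/\ b = a.+1 :> nat, swapped a b s p, s a = b, e_op a p = s &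
      D_pol p = D_op a (D_pol s)].
Proof.
move=> pne.
have [box0 box0P] : exists bx, bx \in diagram p.
  apply/set0Pn; apply: contraNneq pne => e; apply/eqP/ncle_anti; last exact: nested_min.
  by rewrite /ncle e sub0set.
have n0 : (0 < n)%N by apply: leq_ltn_trans (ltn_ord box0.1).
pose c0 := Ordinal n0.
have P0 : (box0.1, c0) \in diagram p.
  by move: box0P; case: (box0) => r c; apply: diagram_closed.
have [r rP rmax] : exists2 r : 'I_n, (r, c0) \in diagram p &
    forall r', (r', c0) \in diagram p -> (r' <= r)%N.
  have := @arg_maxnP _ _ (fun r => (r, c0) \in diagram p) (fun r => r : nat) P0.
  by case=> r h1 h2; exists r.
have [c cP cmax] : exists2 c : 'I_n, (r, c) \in diagram p &
    forall c', (r, c') \in diagram p -> (c' <= c)%N.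
  have := @arg_maxnP _ _ (fun c => (r, c) \in diagram p) (fun c => c : nat) rP.
  by case=> c h1 h2; exists c.
pose k := (n + c - r)%N.
have rn := ltn_ord r; have cn := ltn_ord c.
have [dp ep] := word_dyck p.
have kP : (cnt (word p) k < n - r)%N by move: cP; rewrite mem_diagram.
have kN : (k < n + n)%N by rewrite /k; lia.
have k0 : (0 < k)%N by rewrite /k; lia.
have dk := dp k (ltnW kN).
have c1n : (c.+1 < n)%N.
  rewrite ltnNge; apply/negP => h; move: dk kP; rewrite /k; lia.
(* The boxes (r, c+1) and (r+1, c) are missing, which gives a north-step at k and an east-step just
   before it. *)
have wk : word p k /\ (cnt (word p) k).+1 = (n - r)%N.
  have := cmax (Ordinal c1n); rewrite mem_diagram /=.
  have -> : (n + c.+1 - r = k.+1)%N by rewrite /k; lia.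
  rewrite cntS; case: (word p k) => /=; first by split=> //; lia.
  by move=> h; exfalso; have := h ltac:(lia); rewrite ltnn.
have r1n : (r.+1 < n)%N by move: dk; case: wk => _; lia.
have wk1 : ~~ word p k.-1.
  have := rmax (Ordinal r1n); rewrite !mem_diagram /=.
  have h : ((Ordinal r1n, c) \notin diagram p).
    apply/negP => h; have := rmax (Ordinal r1n) (diagram_closed (leqnn _) (leq0n c : (c0 <= c)%N) h).
    by rewrite /= ltnn.
  move: h; rewrite mem_diagram /= => h _.
  have ek : (n + c - r.+1 = k.-1)%N by rewrite /k; lia.
  rewrite ek in h; apply/negP => w1.
  have := cntS (word p) k.-1; rewrite prednK // w1; lia.
have k1N : (k.-1 < n + n)%N by lia.
pose a := Ordinal k1N; pose b := Ordinal kN.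
have ab : b = a.+1 :> nat by rewrite /= prednK.
have [s [sw sab es]] := ncm_lower ab (wk1 : ~~ word p a) wk.1.
exists s, a, b; split=> //.
have cs i : cnt (word s) i = (cnt (word p) i + (i == k))%N by rewrite (swapped_cnt ab i sw).
have rowE i : (i < n)%N -> i != r -> row_len s i = row_len p i.
  move=> iN ir; apply: eq_card => c'; rewrite !inE cs.
  have c'n := ltn_ord c'.
  have [e|//] := eqVneq (n + c' - i)%N k; last by rewrite addn0.
  by case: wk => _ ek; rewrite e; lia.
have in_row c' : (cnt (word p) (n + (c' : 'I_n) - r) < n - r)%N = (c' < c.+1)%N.
  rewrite -mem_diagram ltnS; apply/idP/idP; first exact: cmax.
  by move=> cc; apply: diagram_closed cP.
have cardlt x : (x <= n)%N -> #|[set c' : 'I_n | (c' < x)%N]| = x.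
  move=> xn; rewrite -[RHS](_ : cnt (fun=> true) x = x).
    by rewrite -(card_cnt _ xn); apply: eq_card => c'; rewrite !inE andbT.
  by rewrite /cnt count_predT size_iota.
have rowp : row_len p r = c.+1.
  by rewrite -[RHS](cardlt _ cn); apply: eq_card => c'; rewrite !inE in_row.
have rows : row_len s r = c.
  rewrite -[RHS](cardlt _ (ltnW cn)); apply: eq_card => c'; rewrite !inE cs.
  have c'n := ltn_ord c'; have := in_row c'.
  have [e|ne] := eqVneq (n + c' - r)%N k.
    have -> : c' = c by apply: val_inj; move: e; rewrite /k /=; lia.
    by case: wk => _ ek; rewrite -/k; lia.
  have ne' : c' != c :> nat by apply: contraNneq ne => ->.
  by rewrite addn0 => ->; lia.
have zero i : (r < i)%N -> (i < n)%N -> row_len p i = 0%N.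
  move=> ri iN; apply/eqP; rewrite cards_eq0; apply/eqP/setP => c'; rewrite !inE.
  apply/negP => h; have := rmax (Ordinal iN).
  have hc : (Ordinal iN, c') \in diagram p by rewrite mem_diagram.
  by move=> /(_ (diagram_closed (leqnn _) (leq0n c' : (c0 <= c')%N) hc)) /=; lia.
have pos i : (i < r)%N -> (0 < row_len p i)%N.
  move=> ir; have iN : (i < n)%N by lia.
  rewrite card_gt0; apply/set0Pn; exists c0; rewrite inE.
  have := @diagram_closed p r (Ordinal iN) c0 c0 (ltnW ir) (leqnn _) rP.
  by rewrite mem_diagram.
pose sh := [seq row_len p i | i <- iota 0 r].
have ssh : size sh = r by rewrite size_map size_iota.
(* The row r disappears from the shape when its last box was its only one. *)
have shapeC m x : (forall i, (i < n)%N -> i != r -> row_len m i = row_len p i) ->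
    row_len m r = x -> Defs.shape m = if (0 < x)%N then rcons sh x else sh.
  move=> hm hx; rewrite shapeE.
  have -> : iota 0 n = iota 0 r ++ (r : nat) :: iota r.+1 (n - r.+1).
    have e : (n = r + (n - r.+1).+1)%N by lia.
    by rewrite [in LHS]e iotaD.
  rewrite map_cat filter_cat /= hx.
  have -> : [seq x <- [seq row_len m i | i <- iota 0 r] | (0 < x)%N] = sh.
    have /eq_in_map -> : {in iota 0 r, row_len m =1 row_len p}.
      by move=> i; rewrite mem_iota => ir; apply: hm; lia.
    apply/all_filterP/allP => y /mapP[i]; rewrite mem_iota => ir ->.
    by apply: pos; lia.
  have -> : [seq x <- [seq row_len m i | i <- iota r.+1 (n - r.+1)] | (0 < x)%N] = [::].
    apply/eqP; rewrite -[_ == _]negbK -has_filter; apply/hasPn => y /mapP[i].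
    rewrite mem_iota => ir ->; rewrite hm; try lia.
    by rewrite zero //; lia.
  by case: ifP; rewrite ?cats0 ?cats1.
have shp := shapeC p c.+1 (fun _ _ _ => erefl) rowp.
have shs := shapeC s c rowE rows.
rewrite !D_polE shp /= D_shape_rcons D_rowS ssh.
have -> : D_row r c (D_shape sh) = D_shape (Defs.shape s).
  rewrite shs; case: (nat_of_ord c) => [|x] /=; first by rewrite D_row0.
  by rewrite D_shape_rcons ssh.
have -> : (n + c.+1 - r.+1 = k)%N by rewrite /k; lia.
by rewrite /D_lab insubT.
Qed.

End LastBox.

(** * Extremal monomials *)

Local Open Scope ring_scope.

Section Hull.
Variables (F : fieldType) (N : nat).
Implicit Types (p f g h : {mpoly F[N]}) (S : {set 'I_N}) (m : 'X_{1..N}).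

Definition wt S m := (\sum_(i in S) m i)%N.

Lemma wtD S m m' : wt S (m + m')%MM = (wt S m + wt S m')%N.
Proof. by rewrite /wt -big_split; apply: eq_bigr => i _; rewrite mnmDE. Qed.

Lemma wtU S a : wt S U_(a)%MM = (a \in S).
Proof.
rewrite /wt; have [aS|aS] := boolP (a \in S).
  rewrite (bigD1 a) //= mnm1E eqxx big1 // => i /andP[_ ia].
  by rewrite mnm1E eq_sym (negbTE ia).
by rewrite big1 // => i iS; rewrite mnm1E; case: eqP => // e; rewrite e iS in aS.
Qed.

Lemma mcoeffMXU p a m :
  (p * 'X_a)@_m = if m a == 0%N then 0 else p@_(m - U_(a))%MM.
Proof.
case: eqP => [ma|/eqP ma]; last first.
  have -> : m = (U_(a) + (m - U_(a)))%MM.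
    apply/mnmP => i; rewrite mnmDE mnmBE mnm1E subnKC //.
    by case: eqP => // <-; rewrite lt0n.
  by rewrite mcoeffMX addmC addmK.
apply/eqP; rewrite mcoeff_eq0 (perm_mem (msuppMX _ _)).
by apply/mapP => -[k _ e]; move: ma; rewrite e mnmDE mnm1E eqxx.
Qed.

Definition ord_ge S M p := forall m, (wt S m < M)%N -> p@_m = 0.

Lemma ord_geB S M p g : ord_ge S M p -> ord_ge S M g -> ord_ge S M (p - g).
Proof. by move=> h h' m lt; rewrite mcoeffB h // h' // subr0. Qed.

Lemma ord_geZ S M c p : ord_ge S M p -> ord_ge S M (c *: p).
Proof. by move=> h m lt; rewrite mcoeffZ h // mulr0. Qed.

Lemma ord_geX S M p a : ord_ge S M p -> ord_ge S (M + (a \in S)) (p * 'X_a).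
Proof.
move=> h m lt; rewrite mcoeffMXU; case: eqP => // /eqP ma; apply: h.
suff : wt S m = (wt S (m - U_(a))%MM + (a \in S))%N by lia.
rewrite -wtU -wtD; congr wt; apply/mnmP => i; rewrite mnmDE mnmBE mnm1E subnK //.
by case: eqP => // <-; rewrite lt0n.
Qed.

(** Induction on the exponent of z_d: the product has coefficient p_m - p_(m + U_c - U_d) at m +
    U_c, and the second monomial has a smaller exponent of z_d and no larger weight. *)
Lemma ord_ge_div S M p c d : c != d -> (c \in S) ==> (d \in S) ->
  ord_ge S (M + (c \in S)) (p * ('X_c - 'X_d)) -> ord_ge S M p.
Proof.
move=> cd cS h m; have [k] := ubnP (m d); elim: k m => // k IH m mk lt.
have := h (m + U_(c))%MM; rewrite wtD wtU ltn_add2r => /(_ lt).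
rewrite mulrBr mcoeffB !mcoeffMXU mnmDE mnm1E eqxx addn1 /= addmK.
rewrite mnmDE mnm1E (negbTE cd) addn0; case: eqP => [_|/eqP md].
  by rewrite subr0.
move/eqP; rewrite subr_eq0 => /eqP ->; apply: IH.
  rewrite mnmBE mnmDE !mnm1E eqxx (negbTE cd) addn0; lia.
suff : (wt S (m + U_(c) - U_(d))%MM + (d \in S) = wt S m + (c \in S))%N.
  by move: cS; case: (c \in S); case: (d \in S) => //=; lia.
rewrite -!wtU -!wtD; congr wt; apply/mnmP => i.
rewrite mnmDE mnmBE mnmDE !mnm1E subnK //; case: eqP => // <-.
by rewrite (leq_trans _ (leq_addr _ _)) // lt0n.
Qed.

(** As [wheel_deg k] is the sum of the k smallest terms of 0, 0, 1, 1, 2, 2, ..., these are the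
    inequalities of the permutohedron spanned by the rearrangements of 0, ..., n-1, 0, ..., n-1. *)
Definition hull p := forall S, ord_ge S (wheel_deg #|S|) p.

Lemma wt_perm S m (s : 'S_N) : wt S m = wt (s @^-1: S) [multinom m (s i) | i < N].
Proof.
rewrite /wt (reindex_inj (@perm_inj _ s)) /=; apply: eq_big => [i|i _].
  by rewrite inE.
by rewrite mnmE.
Qed.

Lemma hull_msym (s : 'S_N) p : hull p -> hull (msym s p).
Proof.
move=> h S m lt; rewrite mcoeff_sym; apply: (h (s @^-1: S)).
rewrite -wt_perm (_ : #|_| = #|S|) //.
by rewrite on_card_preimset //; apply: onW_bij; apply: injF_bij; apply: perm_inj.
Qed.

Lemma hullB p g : hull p -> hull g -> hull (p - g).
Proof. by move=> h h' S; apply: ord_geB. Qed.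

(** The order in S gained from the linear form on the right is 1 if a and b both lie in S and 0
    otherwise; the division by z_b - z_a costs no more. *)
Lemma hull_div x y p h a b : a != b -> hull h ->
  p * ('X_b - 'X_a) = (x *: 'X_a - y *: 'X_b) * h -> hull p.
Proof.
move=> ab hh e S; have ba : b != a by rewrite eq_sym.
have H c z e' : e' = ((a \in S) && (b \in S)) -> (c == a) || (c == b) ->
    ord_ge S (wheel_deg #|S| + e') (h * (z *: 'X_c)).
  move=> -> cab; rewrite -scalerAr; apply: ord_geZ => m lt.
  apply: (ord_geX (a := c) (hh S)); apply: leq_trans lt _; rewrite leq_add2l.
  by case/orP: cab => /eqP->; case: (a \in S); case: (b \in S).
have {}H e' : e' = ((a \in S) && (b \in S)) ->
    ord_ge S (wheel_deg #|S| + e') (p * ('X_b - 'X_a)).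
  move=> ee; rewrite e mulrC mulrBr; apply: ord_geB; apply: H => //.
    by rewrite eqxx.
  by rewrite eqxx orbT.
have [aS|aS] := boolP (a \in S); have [bS|bS] := boolP (b \in S).
- apply: (ord_ge_div ba) => //; first by rewrite aS bS.
  by apply: H; rewrite aS bS.
- apply: (ord_ge_div ba) => //; first by rewrite (negbTE bS).
  by apply: H; rewrite aS (negbTE bS).
- apply: (ord_ge_div ab); first by rewrite (negbTE aS).
  by rewrite -opprB mulrN -scaleN1r; apply: ord_geZ; apply: H; rewrite (negbTE aS).
apply: (ord_ge_div ba); first by rewrite (negbTE bS).
by apply: H; rewrite (negbTE aS) (negbTE bS).
Qed.

End Hull.

(** * Action of D_k on the coefficients at the vertices *)

Section Extremal.
Variables (F : fieldType) (q : F) (n : nat).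
Implicit Types (al : 'X_{1..n + n}) (f g h : {mpoly F[n + n]}).

Definition alpha0 : 'X_{1..n + n} :=
  [multinom (if (i < n)%N then i : nat else i - n)%N | i < n + n].

Definition ext al := exists w : 'S_(n + n), forall i, al i = alpha0 (w i).

Definition mperm al (s : 'S_(n + n)) : 'X_{1..n + n} :=
  [multinom al (s i) | i < n + n].

Lemma ext_mperm al s : ext al -> ext (mperm al s).
Proof. by move=> [w h]; exists (s * w)%g => i; rewrite mnmE h permM. Qed.

Lemma sum_alpha0 (G : nat -> nat) c : (c <= n)%N ->
  (\sum_(i < n + n | alpha0 i < c) G (alpha0 i) = (\sum_(i < c) G i).*2)%N.
Proof.
move=> cn; rewrite big_split_ord /= -addnn; congr (_ + _)%N.
  rewrite [RHS](big_ord_widen_cond _ xpredT G cn); apply: eq_big => [i|i _].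
    by rewrite mnmE /= ltn_ord.
  by rewrite mnmE /= ltn_ord.
rewrite [RHS](big_ord_widen_cond _ xpredT G cn); apply: eq_big => [i|i _].
  by rewrite mnmE /= [(n + i < n)%N]ltnNge leq_addr /= addKn.
by rewrite mnmE /= [(n + i < n)%N]ltnNge leq_addr /= addKn.
Qed.

Lemma ext_lt al i : ext al -> (al i < n)%N.
Proof.
by move=> [w ->]; rewrite mnmE; case: ifP => // h; have := ltn_ord (w i); lia.
Qed.

Lemma sum_ord_double c : ((\sum_(i < c) i).*2 = c * c.-1)%N.
Proof.
elim: c => [|c IH]; first by rewrite big_ord0.
by rewrite big_ord_recr /= doubleD IH; case: c {IH} => //= c; nia.
Qed.

(* The smallest values of an extremal word attain the bound defining the hull. *)
Lemma ext_tight al k : ext al -> exists S : {set 'I_(n + n)},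
  [/\ k \in S, forall l, l != k -> (al k <= al l)%N -> l \notin S &
      wheel_deg #|S| = wt S al].
Proof.
move=> hal; have kn := ltnW (ext_lt k hal); case: (hal) => w hw.
pose c := al k; pose T := [set i | (al i < c)%N].
have kT : k \notin T by rewrite inE ltnn.
have sumT G : (\sum_(i in T) G (al i) = (\sum_(i < c) G i).*2)%N.
  rewrite -sum_alpha0 // [RHS](reindex_inj (@perm_inj _ w)) /=.
  by apply: eq_big => [i|i _]; rewrite ?inE -hw.
exists (k |: T); split.
- by rewrite setU11.
- by move=> l lk kl; rewrite !inE negb_or lk -leqNgt.
rewrite cardsU1 kT -sum1_card (sumT (fun=> 1%N)) sum1_card card_ord add1n.
rewrite /wt (big_setD1 k) ?setU11 //= setU1K // (sumT id) -/c /wheel_deg /=.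
rewrite sum_ord_double uphalf_double half_double.
by case: c {kT T sumT} => // c; rewrite /=; nia.
Qed.

(** Spreading two exponents apart leaves the polytope: a tight set containing k but not l loses one
    unit of weight. *)
Lemma ext_out f al (k l : 'I_(n + n)) : hull f -> ext al -> k != l ->
  (al k <= al l)%N -> (0 < al k)%N -> f@_(al + U_(l) - U_(k)) = 0.
Proof.
move=> hf hal kl le k0; have [S [kS lS wS]] := ext_tight k hal.
apply: (hf S); rewrite wS.
have : (wt S (al + U_(l) - U_(k))%MM + wt S U_(k)%MM = wt S al + wt S U_(l)%MM)%N.
  rewrite -!wtD; congr wt; apply/mnmP => i; rewrite mnmDE mnmBE mnmDE !mnm1E.
  by case: (k =P i) => // [<-|_]; rewrite ?subn0 ?addn0 // subnK //; lia.
by rewrite !wtU kS (negbTE (lS l _ _)) //= 1?eq_sym //; lia.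
Qed.

(** Compare coefficients one unit above [al], at whichever of a, b has the larger exponent. One term
    of each linear form then refers to an exponent outside of the polytope and drops out. *)
Lemma ext_coef (a b : 'I_(n + n)) f g al : a != b -> hull f -> ext al ->
  g * ('X_b - 'X_a) = (q *: 'X_a - q^-1 *: 'X_b) * (msym (tperm a b) f - f) ->
  g@_al = if (al b <= al a)%N then q * (f@_al - f@_(mperm al (tperm a b)))
          else q^-1 * (f@_al - f@_(mperm al (tperm a b))).
Proof.
move=> ab hf hal e; have ba : b != a by rewrite eq_sym.
set h := msym (tperm a b) f - f in e.
have hh : hull h by apply: hullB => //; apply: hull_msym.
have hg : hull g by apply: hull_div e.
have eh : f@_al - f@_(mperm al (tperm a b)) = - h@_al.
  by rewrite mcoeffB mcoeff_sym opprB.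
have coefA (p : {mpoly F[n + n]}) c : (p * 'X_c)@_(al + U_(c)) = p@_al.
  by rewrite mcoeffMXU mnmDE mnm1E eqxx addn1 /= addmK.
have coefB (p : {mpoly F[n + n]}) (c d : 'I_(n + n)) : hull p -> c != d ->
    (al c <= al d)%N -> (p * 'X_c)@_(al + U_(d)) = 0.
  move=> hp cd le; rewrite mcoeffMXU mnmDE mnm1E [d == c]eq_sym (negbTE cd) addn0.
  by case: eqP => // /eqP c0; apply: ext_out => //; rewrite lt0n.
have eq_at c := congr1 (mcoeff (al + U_(c))%MM) e.
rewrite eh; case: ifP => le.
  have := eq_at a; rewrite mulrBr mcoeffB (coefB _ b a) // coefA.
  rewrite mulrC mulrBr mcoeffB -!scalerAr !mcoeffZ coefA (coefB _ b a) //.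
  by rewrite sub0r mulr0 subr0 mulrN => <-; rewrite opprK.
have := eq_at b; rewrite mulrBr mcoeffB (coefB _ a b) ?coefA; [|by []|by []|lia].
rewrite mulrC mulrBr mcoeffB -!scalerAr !mcoeffZ coefA (coefB _ a b); [|by []|by []|lia].
by rewrite mulr0 sub0r subr0 mulrN.
Qed.

End Extremal.

(** * Wheel polynomials over Q(q) *)

Lemma pair_form (F : fieldType) (r x : F) : r != 0 -> r * x - r^-1 * (r ^+ 2 * x) = 0.
Proof. by move=> r0; field. Qed.

Lemma q_neq0 : q != 0.
Proof. by rewrite tofrac_eq0 polyX_eq0. Qed.

Lemma q_nroot k : q ^+ k.+1 != 1.
Proof.
rewrite -tofracXn -tofrac1 tofrac_eq; apply/eqP => /(congr1 (fun p : {poly rat} => size p)).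
by rewrite size_polyXn size_poly1.
Qed.

Section Bridge.
Variable n : nat.
Local Notation N := (n + n)%N.
Implicit Types (f g : pol n) (a b : 'I_N).

Lemma ev_msym a b f v : b = a.+1 :> nat -> ev (msym (tperm a b) f) v = ev f (sw a v).
Proof.
move=> ab; apply: (rmorph_mpoly_eq (f := @meval _ _ (fun i : 'I_N => v i) \o msym (tperm a b))
  (g := @meval _ _ (fun i : 'I_N => sw a v i))) => [c|i] /=.
  by rewrite -[c%:MP]mulr1 mul_mpolyC msymZ msym1 !mevalZ !meval1.
rewrite mevalXU /msym mmapX mmap1U mevalXU /sw /swi; congr v.
case: tpermP => [->|->|/eqP ia /eqP ib].
- by rewrite eqxx ab.
- by rewrite ab eqxx gtn_eqF.
by rewrite -ab; rewrite -!val_eqE /= in ia ib; rewrite (negbTE ia) (negbTE ib).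
Qed.

Lemma D_op_eq a b f : b = a.+1 :> nat ->
  D_op a f * ('X_b - 'X_a) = (q *: 'X_a - q^-1 *: 'X_b) * (msym (tperm a b) f - f).
Proof.
move=> ab.
have e : divdiff a f * ('X_(ordS a) - 'X_a) = S_op a f - f.
  by apply/eqP; apply: (xchooseP (divdiff_ex a f)).
rewrite /S_op (ordS_val ab) in e.
by rewrite /D_op (ordS_val ab) -mulrA e.
Qed.

Lemma D_op_isD a b f : b = a.+1 :> nat -> isD q a f (D_op a f).
Proof.
move=> ab v; have := congr1 (fun p => ev p v) (D_op_eq f ab).
by rewrite /= !evM !evB !evZ !evX ev_msym // ab.
Qed.

Lemma wheel_degD : wheel_deg N = (n * n.-1)%N.
Proof. by rewrite /wheel_deg addnn uphalf_double doubleK. Qed.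

Lemma ev_wheel_subst (i j k : 'I_N) f (v w : nat -> Qq) :
  w i = v i -> w j = q ^+ 2 * v i -> w k = q ^+ 4 * v i ->
  (j != i) -> (k != i) -> (k != j) ->
  (forall l, l != j :> nat -> l != k :> nat -> w l = v l) ->
  ev (wheel_subst i j k f) v = ev f w.
Proof.
move=> wi wj wk ji ki kj h; rewrite /ev /wheel_subst comp_mpoly_meval.
apply: meval_eq => l; rewrite tnth_mktuple.
case: eqP => [->|/eqP lj]; first by rewrite mevalZ mevalXU wj.
case: eqP => [->|/eqP lk]; first by rewrite mevalZ mevalXU wk.
by rewrite mevalXU h.
Qed.

(** Homogeneity is automatic in minimal degree, so the degree bound suffices. *)
Lemma wheelP f : wheel f <-> min_wheel q f.
Proof.
split=> [[hom wf]|mf]; last first.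
  split; first by rewrite -wheel_degD; apply: min_wheel_homog q_neq0 q_nroot _ _ mf.
  move=> i j k ij jk; apply: (ev_eq0 (q_inf q_neq0 q_nroot)) => v.
  pose w (l : nat) := if l == j then q ^+ 2 * v i else if l == k then q ^+ 4 * v i else v l.
  have [ij' ik' jk'] : [/\ (i == j :> nat) = false, (i == k :> nat) = false &
    (k == j :> nat) = false] by split; lia.
  rewrite (@ev_wheel_subst i j k f v w); rewrite /w ?eqxx ?ij' ?ik' ?jk' //.
  - case: mf => wf _; apply: (wf _ i j k) => //; rewrite ?eqxx ?ij' ?ik' ?jk' //.
  - by rewrite eq_sym -val_eqE /= ij'.
  - by rewrite eq_sym -val_eqE /= ik'.
  - by rewrite -val_eqE /= jk'.
  by move=> l /negbTE-> /negbTE->.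
split; last first.
  rewrite msizeE; apply/bigmax_leqP_seq => m mf _.
  by rewrite ltnS wheel_degD (dhomog_mf hom mf).
move=> v i j k ij jk kN vj vk.
have iN : (i < N)%N by lia. have jN : (j < N)%N by lia.
rewrite -(@ev_wheel_subst (Ordinal iN) (Ordinal jN) (Ordinal kN) f v v) //.
- by rewrite wf ?ev0.
- by rewrite -val_eqE /= gtn_eqF.
- by rewrite -val_eqE /= gtn_eqF //; lia.
by rewrite -val_eqE /= gtn_eqF.
Qed.

Lemma msize_prod_leq I (r : seq I) (P : pred I) (G : I -> pol n) (d : I -> nat) :
  (forall i, P i -> msize (G i) <= (d i).+1)%N ->
  (msize (\prod_(i <- r | P i) G i) <= (\sum_(i <- r | P i) d i).+1)%N.
Proof.
move=> h; elim/big_rec2: _ => [|i s p Pi IH]; first by rewrite msize1.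
by apply: msizeM_leq (h i Pi) IH.
Qed.

Lemma ev_Psi0_eq0 (v : nat -> Qq) (i j : 'I_N) : (i < j)%N -> ((j < n) || (n <= i))%N ->
  v j = q ^+ 2 * v i -> ev (Psi0 n) v = 0.
Proof.
move=> ij same vj; rewrite /Psi0 evZ ev_prod.
apply/eqP; rewrite mulf_eq0; apply/orP; right.
have lin (x y : 'I_N) : x = i -> y = j ->
   ev (q *: 'X_x - q^-1 *: 'X_y : pol n) v = 0.
  by move=> -> ->; rewrite evB !evZ !evX vj; apply: pair_form; exact: q_neq0.
have [jn|ni] := orP same.
  have iN := ltn_trans ij jn.
  apply/prodf_eq0; exists (Ordinal iN) => //; rewrite ev_prod.
  apply/prodf_eq0; exists (Ordinal jn) => //.
  by rewrite evM mulf_eq0 lin ?eqxx //; apply: val_inj.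
have iN : (i - n < n)%N by have := ltn_ord i; lia.
have jN : (j - n < n)%N by have := ltn_ord j; lia.
apply/prodf_eq0; exists (Ordinal iN) => //; rewrite ev_prod.
apply/prodf_eq0; exists (Ordinal jN); first by rewrite /=; lia.
rewrite evM mulf_eq0 [X in _ || (X == 0)]lin ?eqxx ?orbT //; apply: val_inj => /=; lia.
Qed.

Lemma sum_pairs m : (\sum_(i < m) \sum_(j < m | i < j) 1 = \sum_(j < m) j)%N.
Proof.
rewrite (exchange_big_dep xpredT) //=; apply: eq_bigr => j _.
rewrite -[RHS](card_ord j) -sum1_card.
by rewrite (big_ord_widen_cond _ xpredT (fun=> 1%N) (ltnW (ltn_ord j))).
Qed.

Lemma Psi0_min : min_wheel q (Psi0 n).
Proof.
split.
  move=> v i j k ij jk kN vj vk.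
  have iN : (i < N)%N by lia. have jN : (j < N)%N by lia.
  (* Two consecutive members of the triple lie in the same half of the variables, where Psi_0
     contains the corresponding binomial. *)
  have [jn|nj] := ltnP j n.
    by apply: (@ev_Psi0_eq0 v (Ordinal iN) (Ordinal jN)); rewrite //= jn.
  apply: (@ev_Psi0_eq0 v (Ordinal jN) (Ordinal kN)); rewrite //= ?nj ?orbT //.
  by rewrite vj vk mulrA -exprD.
apply: leq_trans (msizeZ_le _ _) _; rewrite wheel_degD -sum_ord_double -sum_pairs.
rewrite -muln2 big_distrl /=; apply: msize_prod_leq => i _.
rewrite big_distrl; apply: msize_prod_leq => j _.
have s (x y : 'I_N) : (msize (q *: 'X_x - q^-1 *: 'X_y : pol n) <= 2)%N.
  apply: leq_trans (msizeD_le _ _) _; rewrite msizeN geq_max.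
  by rewrite !(leq_trans (msizeZ_le _ _)) ?msizeX ?mdeg1.
exact: (@msizeM_leq _ _ _ _ 1 1).

Qed.

Lemma Psi0_vanish a b : b = a.+1 :> nat -> nested n a != b ->
  pair_vanish q (Psi0 n) a b.
Proof.
move=> ab; rewrite -val_eqE /= ffunE /= => h v vb.
by apply: (@ev_Psi0_eq0 v a b) => //; lia.
Qed.

Lemma D_op_min a b f : b = a.+1 :> nat -> min_wheel q f -> min_wheel q (D_op a f).
Proof. by move=> ab; apply: (isD_min q_neq0 q_nroot ab (D_op_isD f ab)). Qed.

Lemma D_pol_nested : D_pol (nested n) = Psi0 n.
Proof.
suff e : Defs.shape (nested n) = [::] by rewrite /D_pol e /= big_geq.
rewrite shapeE; apply/eqP; rewrite -[_ == _]negbK -has_filter.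
apply/hasPn => x /mapP[r]; rewrite mem_iota add0n => /= rn ->.
rewrite -eqn0Ngt cards_eq0; apply/eqP/setP => c; rewrite !inE.
have cn := ltn_ord c; apply/negbTE; rewrite -leqNgt.
have h : (n - r <= n + c - r)%N by lia.
apply: leq_trans (cnt_mono _ h).
have H k : (k <= n)%N -> cnt (word (nested n)) k = k.
  elim: k => // k IH kn; rewrite cntS IH ?(ltnW kn) // word_nested; last by lia.
  by rewrite kn addn1.
by rewrite H // leq_subr.
Qed.

(* Induction on the number of boxes, removing the last box in reading order. *)
Lemma ncm_ind (P : ncm n -> Prop) : P (nested n) ->
  (forall s p a b, b = a.+1 :> nat -> swapped a b s p -> s a = b -> e_op a p = s ->
     D_pol p = D_op a (D_pol s) -> P s -> P p) -> forall p, P p.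
Proof.
move=> P0 PS p; have [k] := ubnP #|diagram p|; elim: k p => // k IH p pk.
have [->//|/last_box[s [a [b [ab sw sab es Dp]]]]] := eqVneq p (nested n).
have [le ne] := swapped_lt ab sw; have lt := ncle_card le ne.
by apply: (PS s p a b) => //; apply: IH; lia.
Qed.

Lemma D_pol_min (p : ncm n) : min_wheel q (D_pol p).
Proof.
elim/ncm_ind: p => [|s p a b ab _ _ _ ->]; first by rewrite D_pol_nested; apply: Psi0_min.
by apply: D_op_min ab.
Qed.

End Bridge.

(** * Specialization at q = 0 and the basis *)

Section Specialization.
Variables (R : idomainType) (F K : fieldType) (N : nat).
Variables (phi : {rmorphism R -> F}) (psi : {rmorphism R -> K}).
Implicit Types (f : {mpoly F[N]}) (g : {mpoly K[N]}).

(** With R = Q[q], [phi] the inclusion into Q(q) and [psi] the evaluation at 0: g is the limit of f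
    at q = 0 after rescaling. *)
Definition limit0 f g := exists2 k : F, k != 0 &
  exists2 B : {mpoly R[N]}, k *: f = map_mpoly phi B & map_mpoly psi B = g.

Lemma limit0M f f' g g' : limit0 f g -> limit0 f' g' -> limit0 (f * f') (g * g').
Proof.
move=> [k k0 [B e1 e2]] [k' k0' [B' e1' e2']]; exists (k * k'); first exact: mulf_neq0.
exists (B * B'); last by rewrite rmorphM /= e2 e2'.
by rewrite rmorphM /= -e1 -e1' -scalerAl -scalerAr scalerA.
Qed.

Lemma limit0_prod I (r : seq I) (P : pred I) (G : I -> {mpoly F[N]}) (H : I -> {mpoly K[N]}) :
  (forall i, P i -> limit0 (G i) (H i)) ->
  limit0 (\prod_(i <- r | P i) G i) (\prod_(i <- r | P i) H i).
Proof.
move=> h; elim/big_rec2: _ => [|i f g Pi IH]; last exact: limit0M (h i Pi) IH.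
exists 1; first exact: oner_neq0.
by exists 1; rewrite ?scale1r !rmorph1.
Qed.

Lemma limit0Z c f g : c != 0 -> limit0 f g -> limit0 (c *: f) g.
Proof.
move=> c0 [k k0 [B e1 e2]]; exists (k / c); first by rewrite mulf_neq0 // invr_eq0.
by exists B; rewrite // -e1 scalerA mulfVK.
Qed.

Lemma limit0_coef f g : limit0 f g -> exists2 k : F, k != 0 &
  forall m, exists2 P : R, k * f@_m = phi P & psi P = g@_m.
Proof.
move=> [k k0 [B e1 <-]]; exists k => // m; exists B@_m.
  by rewrite -mcoeffZ e1 mcoeff_map_mpoly.
by rewrite mcoeff_map_mpoly.
Qed.

Lemma limit0_lin (r : R) (x y : 'I_N) : phi r != 0 -> psi r = 0 ->
  limit0 (phi r *: 'X_x - (phi r)^-1 *: 'X_y) (- 'X_y).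
Proof.
move=> r0 r0'; exists (phi r) => //; exists ((r * r) *: 'X_x - 'X_y).
  by rewrite rmorphB /= map_mpolyZ !map_mpolyX scalerBr !scalerA mulfV // scale1r rmorphM.
by rewrite rmorphB /= map_mpolyZ !map_mpolyX rmorphM r0' mul0r scale0r sub0r.
Qed.

End Specialization.

Section OrderProducts.
Variable N : nat.

Lemma ord_geM (F : fieldType) (S : {set 'I_N}) M M' (p p' : {mpoly F[N]}) :
  ord_ge S M p -> ord_ge S M' p' -> ord_ge S (M + M') (p * p').
Proof.
move=> h h' m lt; rewrite mcoeffM big1 // => k /eqP e.
have [lt1|ge1] := ltnP (wt S k.1) M; first by rewrite h ?mul0r.
have ew : wt S m = (wt S k.1 + wt S k.2)%N by rewrite -wtD; congr wt.
by rewrite (h' k.2) ?mulr0 //; lia.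
Qed.

Lemma ord_ge_prod (F : fieldType) (S : {set 'I_N}) I (r : seq I) (P : pred I)
    (G : I -> {mpoly F[N]}) (d : I -> nat) :
  (forall i, P i -> ord_ge S (d i) (G i)) ->
  ord_ge S (\sum_(i <- r | P i) d i) (\prod_(i <- r | P i) G i).
Proof.
move=> h; elim/big_rec2: _ => [|i s p Pi IH]; first by move=> m.
by apply: ord_geM (h i Pi) IH.
Qed.

Lemma ord_ge_lin (F : fieldType) (S : {set 'I_N}) (c d : F) (x y : 'I_N) :
  ord_ge S ((x \in S) && (y \in S)) (c *: 'X_x - d *: 'X_y).
Proof.
move=> m; have [] := boolP (_ && _) => // /andP[xS yS] lt.
rewrite mcoeffB !mcoeffZ !mcoeffX.
have ne z : z \in S -> (U_(z)%MM == m) = false.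
  by move=> zS; apply/eqP => e; move: lt; rewrite -e wtU zS.
by rewrite !ne // !mulr0 subrr.
Qed.

End OrderProducts.

(** The number of pairs inside two blocks of total size x + y is least for the most even split,
    where it equals [wheel_deg (x + y)]. *)
Lemma wheel_deg_split x y : ((wheel_deg (x + y)).*2 <= x * x.-1 + y * y.-1)%N.
Proof.
have P z : (z * z.-1 + z = z * z)%N by case: z => // z; rewrite /=; nia.
have [cauchy strict] := nat_Cauchy x y; rewrite -!mulnn in cauchy strict.
have e := odd_double_half (x + y); have u := uphalf_half (x + y).
have sq : ((x + y) * (x + y) = x * x + 2 * (x * y) + y * y)%N by nia.
rewrite /wheel_deg u; have := P (x + y)./2; have := P x; have := P y.
move: e sq; case E: (odd (x + y)) => /=; set h := (x + y)./2; rewrite -!muln2 => e sq.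
  have ne : x != y by apply/eqP => xy; rewrite xy addnn odd_double in E.
  have lt : (2 * (x * y) < x * x + y * y)%N by rewrite ltn_neqAle cauchy strict ne.
  have e2 : ((x + y) * (x + y) = 4 * (h * h) + 4 * h + 1)%N by rewrite -e; nia.
  lia.
have e2 : ((x + y) * (x + y) = 4 * (h * h))%N by rewrite -e; nia.
lia.
Qed.

Lemma sum_pairs_in (w : nat -> bool) k :
  ((\sum_(i < k) \sum_(j < k | i < j) (w i && w j)).*2 = cnt w k * (cnt w k).-1)%N.
Proof.
rewrite (exchange_big_dep xpredT) //=.
have -> : (\sum_(j < k) \sum_(i < k | i < j) (w i && w j) = \sum_(j < k) w j * cnt w j)%N.
  apply: eq_bigr => j _.
  rewrite -(big_ord_widen_cond _ xpredT (fun i => nat_of_bool (w i && w j)) (ltnW (ltn_ord j))).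
  move: (w j) => b; elim: (nat_of_ord j) => [|l IH]; first by rewrite big_ord0 /cnt muln0.
  by rewrite big_ord_recr /= {}IH cntS mulnDr; case: b; case: (w l).
elim: k => [|k IH]; first by rewrite big_ord0.
rewrite big_ord_recr /= doubleD IH cntS; case: (w k) => /=; last by rewrite !addn0.
by rewrite mul1n addn1 /= -muln2; nia.
Qed.

(** * The exponents attached to matchings, and Psi_0 at q = 0 *)

Section Independence.
Variable n : nat.
Local Notation N := (n + n)%N.
Implicit Types (f g : pol n) (a b : 'I_N) (m s p : ncm n).

(** Each step of the path is numbered among the steps of its own kind, so both kinds receive 0, ...,
    n-1. *)
Definition alpha m : 'X_{1..N} :=
  [multinom (if word m i then cnt (word m) i else i - cnt (word m) i)%N | i < N].

Lemma alpha_nested : alpha (nested n) = alpha0 n.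
Proof.
apply/mnmP => i; rewrite !mnmE word_nested //.
have H k : (k < N)%N -> cnt (word (nested n)) k = minn k n.
  elim: k => [|k IH] kn; first by rewrite min0n.
  by rewrite cntS IH ?(ltnW kn) // word_nested; lia.
by rewrite H //; case: ltnP; lia.
Qed.

(** The inequality is strict because p still satisfies the Dyck condition after the east-step at a;
    this is why no tie occurs. *)
Lemma alpha_swapped a b s p : b = a.+1 :> nat -> swapped a b s p ->
  alpha p = mperm (alpha s) (tperm a b) /\ (alpha s b < alpha s a)%N.
Proof.
move=> ab sw; have [sa sb pa pb h] := sw.
have c k := swapped_cnt ab k sw.
have ca : cnt (word p) a = cnt (word s) a by rewrite -c ab ltn_eqF // addn0.
have cb : (cnt (word p) b).+1 = cnt (word s) b by rewrite -c eqxx addn1.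
have csb : cnt (word s) b = (cnt (word s) a).+1 by rewrite ab cntS sa addn1.
split; last first.
  rewrite !mnmE sa (negbTE sb) csb ab.
  have [d _] := word_dyck p; have := d b (ltnW (ltn_ord b)).
  have := d a.+1; rewrite cntS (negbTE pa) ca; have := ltn_ord b; lia.
apply/mnmP => i; rewrite !mnmE.
case: tpermP => [->|->|/eqP ia /eqP ib].
- by rewrite (negbTE pa) (negbTE sb) ca csb ab; lia.
- by rewrite pb sa; lia.
have ib' : (i == b :> nat) = false by apply/negbTE.
by rewrite h // -c ib' addn0.
Qed.

(** After a common prefix with h north-steps out of k, the exponent is h or k - h according to the
    next step. If these are equal the prefix is balanced and the next step must be north. *)
Lemma alpha_inj s p : alpha s = alpha p -> s = p.
Proof.
move=> e; apply: word_inj => k; have [r] := ubnP k; elim: r k => // r IH k kr kN.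
have ce : cnt (word s) k = cnt (word p) k.
  by apply: eq_cnt => i ik; apply: IH; lia.
have := congr1 (fun al : 'X_{1..N} => al (Ordinal kN)) e; rewrite /= !mnmE /= ce.
have [ds _] := word_dyck s; have [dp _] := word_dyck p.
have := ds k.+1 kN; have := dp k.+1 kN; rewrite !cntS ce.
by case: (word s k); case: (word p k) => //=; lia.
Qed.

Lemma alpha_ext m : ext (alpha m).
Proof.
elim/ncm_ind: m => [|s p a b ab sw _ _ _ IH].
  by rewrite alpha_nested; exists 1%g => i; rewrite perm1.
by have [-> _] := alpha_swapped ab sw; apply: ext_mperm.
Qed.

Definition modq (c : Qq) (r : rat) := exists2 P : {poly rat}, c = tofrac P & P.[0] = r.

Lemma modqB c d r t : modq c r -> modq d t -> modq (c - d) (r - t).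
Proof. by move=> [P -> <-] [Q -> <-]; exists (P - Q); rewrite ?tofracB ?hornerE. Qed.

Lemma modqM c d r t : modq c r -> modq d t -> modq (c * d) (r * t).
Proof. by move=> [P -> <-] [Q -> <-]; exists (P * Q); rewrite ?tofracM ?hornerE. Qed.

Lemma modqq : modq q 0.
Proof. by exists 'X; rewrite ?hornerX. Qed.

Local Notation limit0 := (limit0 (@tofrac {poly rat}) (horner_eval (0 : rat))).

Lemma limit0_Psi0 : limit0 (Psi0 n) 'X_[alpha0 n].
Proof.
(* Multiplied by q, a factor q z_i - q^-1 z_j tends to -z_j. There are j such factors in each half
   for every j, and the signs cancel between the halves. *)
have -> : 'X_[alpha0 n] = \prod_(i < n) \prod_(j < n | (i < j)%N)
    ((- 'X_(lshift n j)) * (- 'X_(rshift n j))) :> {mpoly rat[N]}.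
  rewrite (exchange_big_dep xpredT) //= [LHS]mpolyXE_id big_split_ord /=.
  rewrite [RHS](eq_bigr (fun j : 'I_n => 'X_(lshift n j) ^+ j * 'X_(rshift n j) ^+ j)).
    rewrite [RHS]big_split /=; congr (_ * _); apply: eq_bigr => j _; rewrite mnmE /=.
      by rewrite ltn_ord.
    by rewrite [(n + j < n)%N]ltnNge leq_addr /= addKn.
  move=> j _; rewrite mulrNN prodr_const exprMn.
  suff -> : #|[pred i : 'I_n | (i < j)%N]| = j by [].
  rewrite -[RHS](card_ord j) -!sum1_card.
  by rewrite (big_ord_widen_cond _ xpredT (fun=> 1%N) (ltnW (ltn_ord j))).
apply: limit0Z.
  rewrite invr_eq0 expf_neq0 // subr_eq0; apply/eqP => e.
  have /eqP[] := q_nroot 1; rewrite expr2 {2}e mulfV //; exact: q_neq0.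
by apply: limit0_prod => i _; apply: limit0_prod => j _; apply: limit0M; apply: limit0_lin;
  rewrite ?q_neq0 //= ?horner_evalE ?hornerX.
Qed.

(** A factor of Psi_0 contributes 1 when both of its variables lie in S. Only pairs within one half
    occur, and [wheel_deg_split] bounds their number. *)
Lemma hull_Psi0 : hull (Psi0 n).
Proof.
move=> S; apply: ord_geZ.
pose wl (k : nat) := if insub k is Some i then lshift n i \in S else false.
pose wr (k : nat) := if insub k is Some i then rshift n i \in S else false.
have wlE (i : 'I_n) : wl i = (lshift n i \in S) by rewrite /wl valK.
have wrE (i : 'I_n) : wr i = (rshift n i \in S) by rewrite /wr valK.
pose d := (\sum_(i < n) \sum_(j < n | i < j) ((wl i && wl j) + (wr i && wr j)))%N.
suff le : (wheel_deg #|S| <= d)%N.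
  suff h : ord_ge S d (\prod_(i < n) \prod_(j < n | (i < j)%N)
    ((q *: 'X_(lshift n i) - q^-1 *: 'X_(lshift n j)) *
     (q *: 'X_(rshift n i) - q^-1 *: 'X_(rshift n j)))).
    by move=> m lt; apply: h; apply: leq_trans lt le.
  apply: ord_ge_prod => i _; apply: ord_ge_prod => j _.
  by rewrite !wlE !wrE; apply: ord_geM; apply: ord_ge_lin.
have card : #|S| = (cnt wl n + cnt wr n)%N.
  rewrite -sum1_card big_mkcond big_split_ord /= -!(card_cnt _ (leqnn n)) -!sum1_card.
  congr (_ + _)%N; rewrite [RHS]big_mkcond; apply: eq_bigr => i _.
    by rewrite inE ltn_ord wlE.
  by rewrite inE ltn_ord wrE.
have ed : (d.*2 = cnt wl n * (cnt wl n).-1 + cnt wr n * (cnt wr n).-1)%N.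
  rewrite -!sum_pairs_in -doubleD; congr _.*2; rewrite /d -big_split.
  by apply: eq_bigr => i _; rewrite -big_split.
by rewrite -leq_double ed card wheel_deg_split.
Qed.

End Independence.

(** * Square linear systems indexed by a finite type *)

Section FiniteLinearAlgebra.
Variables (F : fieldType) (T : finType).

Definition fun_mx (E : T -> T -> F) : 'M[F]_#|T| := \matrix_(i, j) E (enum_val i) (enum_val j).
Definition fun_rv (u : T -> F) : 'rV[F]_#|T| := \row_i u (enum_val i).

Lemma fun_mx_mul (E : T -> T -> F) (u : T -> F) s :
  (fun_rv u *m fun_mx E) 0 (enum_rank s) = \sum_p u p * E p s.
Proof.
rewrite mxE [RHS](reindex_onto enum_val enum_rank) /=; last first.
  by move=> p _; rewrite enum_rankK.
by apply: eq_big => [i|i _]; rewrite ?enum_valK ?eqxx // !mxE enum_rankK.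
Qed.

Lemma row_free_solve (E : T -> T -> F) :
  (forall u : T -> F, (forall s, \sum_p u p * E p s = 0) -> forall p, u p = 0) ->
  forall e : T -> F, exists u : T -> F, forall s, \sum_p u p * E p s = e s.
Proof.
move=> h e.
have fr : row_free (fun_mx E).
  rewrite -kermx_eq0; apply/eqP/row_matrixP => i; rewrite row0.
  set v := row i _; have vE : v *m fun_mx E = 0.
    by apply/sub_kermxP; apply: row_sub.
  have ev : v = fun_rv (fun p => v 0 (enum_rank p)).
    by apply/rowP => j; rewrite [RHS]mxE enum_valK.
  have H s : \sum_p v 0 (enum_rank p) * E p s = 0.
    by rewrite -fun_mx_mul -ev vE mxE.
  by apply/rowP => j; have := h _ H (enum_val j); rewrite enum_valK => ->; rewrite mxE.
have un : fun_mx E \in unitmx by rewrite -row_free_unit.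
exists (fun p => (fun_rv e *m invmx (fun_mx E)) 0 (enum_rank p)) => s; rewrite -fun_mx_mul.
have -> : fun_rv (fun p => (fun_rv e *m invmx (fun_mx E)) 0 (enum_rank p)) = fun_rv e *m invmx (fun_mx E).
  by apply/rowP => j; rewrite [LHS]mxE enum_valK.
by rewrite mulmxKV // mxE enum_rankK.
Qed.

(** Under [psi] the determinant becomes a product of nonzero diagonal entries. So it is nonzero in
    R, and also in F since [phi] is injective. *)
Lemma spec_free (R : idomainType) (K : fieldType) (phi : {rmorphism R -> F})
    (psi : {rmorphism R -> K}) (P : T -> T -> R) (r : T -> K) :
  (forall x, phi x = 0 -> x = 0) -> (forall p, r p != 0) ->
  (forall p s, psi (P p s) = if s == p then r p else 0) ->
  forall u : T -> F, (forall s, \sum_p u p * phi (P p s) = 0) -> forall p, u p = 0.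
Proof.
move=> inj r0 hP u hu p.
pose A : 'M[R]_#|T| := \matrix_(i, j) P (enum_val i) (enum_val j).
have dA : \det A != 0.
  suff : psi (\det A) != 0 by apply: contraNneq => ->; rewrite rmorph0.
  rewrite -det_map_mx (_ : map_mx psi A = diag_mx (\row_i r (enum_val i))).
    by rewrite det_diag; apply/prodf_neq0 => i _; rewrite mxE.
  apply/matrixP => i j; rewrite !mxE hP (inj_eq enum_val_inj) eq_sym.
  by case: eqP => [->|_]; rewrite ?mulr1n ?mulr0n.
have un : map_mx phi A \in unitmx.
  rewrite unitmxE unitfE det_map_mx; apply: contraNneq dA => /inj ->.
  exact: eqxx.
have e : fun_rv u *m map_mx phi A = 0.
  have -> : map_mx phi A = fun_mx (fun p s => phi (P p s)) by apply/matrixP => i j; rewrite !mxE.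
  by apply/rowP => j; rewrite -(enum_valK j) fun_mx_mul hu mxE.
have := congr1 (fun M => (M *m invmx (map_mx phi A)) 0 (enum_rank p)) e.
by rewrite /= mulmxK // mul0mx !mxE enum_rankK.
Qed.

End FiniteLinearAlgebra.

Lemma scal_mod (F : fieldType) (k r x y : F) :
  k * r * (r * (x - y)) = r * r * (k * x - k * y).
Proof. by ring. Qed.

Lemma scal_modV (F : fieldType) (k r x y : F) : r != 0 ->
  k * r * (r^-1 * (x - y)) = k * x - k * y.
Proof. by move=> r0; field. Qed.

(** * Independence and spanning of the D_p *)

Section Basis.
Variable n : nat.
Local Notation N := (n + n)%N.

Lemma D_pol_limit (p : ncm n) : hull (D_pol p) /\
  exists k : Qq, exists r : rat, [/\ k != 0, r != 0 & forall al, ext al ->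
    modq (k * (D_pol p)@_al) (if al == alpha p then r else 0)].
Proof.
elim/ncm_ind: p => [|s p a b ab sw sab es Dp [hs [k [r [k0 r0 IH]]]]].
  rewrite D_pol_nested; split; first exact: hull_Psi0.
  have [k k0 h] := limit0_coef (limit0_Psi0 n).
  exists k, 1; split=> // al _.
  have [P e1 e2] := h al; exists P => //; rewrite -horner_evalE e2 mcoeffX alpha_nested eq_sym.
  by case: eqP.
have ne : a != b by rewrite -val_eqE /= ab ltn_eqF.
have De := D_op_eq (D_pol s) ab; rewrite Dp.
split; first by apply: hull_div ne _ De; apply: hullB => //; apply: hull_msym.
have [ap lt] := alpha_swapped ab sw.
(* The extra factor q cancels the q^-1 of [ext_coef] in one case and produces q^2, hence 0 at q = 0,
   in the other. In the surviving case the coefficient at the exchanged exponent enters with a minus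
   sign. *)
exists (k * q), (- r); split=> [||al hal].
- exact: mulf_neq0 k0 q_neq0.
- by rewrite oppr_eq0.
rewrite (ext_coef ne hs hal De); case: ifP => le.
  have -> : (al == alpha p) = false.
    have ea : mperm (alpha s) (tperm a b) a = alpha s b by rewrite mnmE tpermL.
    have eb : mperm (alpha s) (tperm a b) b = alpha s a by rewrite mnmE tpermR.
    by apply/eqP => e; move: le; rewrite e ap ea eb leqNgt lt.
  have := modqM (modqM modqq modqq)
    (modqB (IH al hal) (IH _ (ext_mperm (tperm a b) hal))).
  by rewrite !mul0r scal_mod.
rewrite scal_modV ?q_neq0 //.
have e1 : (al == alpha s) = false.
  by apply/eqP => e; move: le; rewrite e ltnW.
have e2 : (mperm al (tperm a b) == alpha s) = (al == alpha p).
  rewrite ap; apply/eqP/eqP => [<-|->]; apply/mnmP => i; rewrite !mnmE tpermK //.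
have := IH al hal; rewrite e1 => h1.
have := IH _ (ext_mperm (tperm a b) hal); rewrite e2 => h2.
by have := modqB h1 h2; rewrite sub0r; case: ifP => _; rewrite ?oppr0.
Qed.


Lemma D_pol_free (c : ncm n -> Qq) :
  \sum_p c p *: D_pol p = 0 -> forall p, c p = 0.
Proof.
move=> e.
have [k hk] := fin_all_exists (fun p => (D_pol_limit p).2).
have [r hr] := fin_all_exists hk.
have /fin_all_exists[P hP] p : exists Pp : ncm n -> {poly rat}, forall s,
    k p * (D_pol p)@_(alpha s) = tofrac (Pp s) /\
    (Pp s).[0] = if s == p then r p else 0.
  have [_ _ h] := hr p; apply: (@fin_all_exists _ _ (fun s Q =>
    k p * (D_pol p)@_(alpha s) = tofrac Q /\ Q.[0] = if s == p then r p else 0)) => s.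
  have [Q e1 e2] := h _ (alpha_ext s); exists Q; split=> //.
  by rewrite e2 (inj_eq (@alpha_inj n)).
have k0 p : k p != 0 by case: (hr p).
have r0 p : r p != 0 by case: (hr p).
have tofrac_inj x : @tofrac {poly rat} x = 0 -> x = 0.
  by move/eqP; rewrite tofrac_eq0 => /eqP.
have hP0 p s : horner_eval 0 (P p s) = if s == p then r p else 0.
  by case: (hP p s).
have u0 := spec_free (phi := @tofrac {poly rat}) (psi := horner_eval 0) tofrac_inj r0 hP0.
suff hs s : \sum_p c p / k p * tofrac (P p s) = 0.
  move=> p; have /eqP := u0 _ hs p.
  by rewrite mulf_eq0 invr_eq0 (negbTE (k0 p)) orbF => /eqP.
transitivity (mcoeff (alpha s) (\sum_p c p *: D_pol p)); last by rewrite e mcoeff0.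
rewrite [RHS]raddf_sum /=; apply: eq_bigr => p _; have [<- _] := hP p s.
by rewrite mcoeffZ mulrA mulfVK.
Qed.

Lemma D_pol_basis : is_basis (@wheel n) (@D_pol n).
Proof.
split; first by move=> p; apply/wheelP; apply: D_pol_min.
  exact: D_pol_free.
move=> v /wheelP mv.
pose pt (s : ncm n) := dyck_pt q 1 (word s).
have zero (f : pol n) : min_wheel q f -> (forall s, ev f (pt s) = 0) -> f = 0.
  have oN : ~~ odd N by rewrite oddD addbb.
  move=> mf hf; apply: (dyck_zero q_neq0 q_nroot oN mf).
  move=> w dw; have [s hs] := ncm_word dw; rewrite -(hf s).
  by apply: ev_ext => i iN; rewrite /pt /dyck_pt hs.
have mD (u : ncm n -> Qq) : min_wheel q (\sum_p u p *: D_pol p).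
  by apply: min_wheel_sum => p _; apply/min_wheelZ/D_pol_min.
have evD u s : ev (\sum_p u p *: D_pol p) (pt s) = \sum_p u p * ev (D_pol p) (pt s).
  by rewrite ev_sum; apply: eq_bigr => p _; rewrite evZ.
(* The matrix of the values of the D_p at the Dyck points is square with trivial left kernel, so the
   values of v are matched by some combination. *)
have [|c hc] := @row_free_solve _ _ (fun p s => ev (D_pol p) (pt s)) _ (fun s => ev v (pt s)).
  by move=> u hu; apply: D_pol_free; apply: zero => // s; rewrite evD.
exists c; apply/eqP; rewrite -subr_eq0; apply/eqP; apply: zero.
  exact: min_wheelB.
by move=> s; rewrite evB evD hc subrr.
Qed.

End Basis.

(** * The family Psi *)

Section Span.
Variables (F : fieldType) (V : lmodType F) (T : finType).
Implicit Types (B : T -> V) (P : pred T).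

Definition inspan P B (f : V) := exists c : T -> F, f = \sum_(t | P t) c t *: B t.

Lemma inspan0 P B : inspan P B 0.
Proof. by exists (fun=> 0); rewrite big1 // => t _; rewrite scale0r. Qed.

Lemma inspanD P B f g : inspan P B f -> inspan P B g -> inspan P B (f + g).
Proof.
move=> [c ->] [d ->]; exists (fun t => c t + d t); rewrite -big_split.
by apply: eq_bigr => t _; rewrite scalerDl.
Qed.

Lemma inspanZ P B c f : inspan P B f -> inspan P B (c *: f).
Proof.
move=> [d ->]; exists (fun t => c * d t); rewrite scaler_sumr.
by apply: eq_bigr => t _; rewrite scalerA.
Qed.

Lemma inspan_sum P B I (r : seq I) (Q : pred I) (G : I -> V) :
  (forall i, Q i -> inspan P B (G i)) -> inspan P B (\sum_(i <- r | Q i) G i).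
Proof.
move=> h; elim/big_rec: _ => [|i f Qi]; first exact: inspan0.
exact: inspanD (h i Qi).
Qed.

Lemma inspan_gen P B t : P t -> inspan P B (B t).
Proof.
move=> Pt; exists (fun u => (u == t)%:R); rewrite (bigD1 t) //= eqxx scale1r.
by rewrite big1 ?addr0 // => u /andP[_ /negbTE->]; rewrite scale0r.
Qed.

Lemma inspan_trans P B P' B' f : inspan P B f ->
  (forall t, P t -> inspan P' B' (B t)) -> inspan P' B' f.
Proof. by move=> [c ->] h; apply: inspan_sum => t Pt; apply/inspanZ/h. Qed.

End Span.

Lemma ncm_sind n (P : ncm n -> Prop) :
  (forall p, (forall t, ncle t p -> t != p -> P t) -> P p) -> forall p, P p.
Proof.
move=> PS p; have [k] := ubnP #|diagram p|; elim: k p => // k IH p pk.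
by apply: PS => t tp ne; apply: IH; have := ncle_card tp ne; lia.
Qed.

Lemma isD_pair_far (F : fieldType) (q : F) : q != 0 -> (forall k, q ^+ k.+1 != 1) ->
  forall N k a (f g : {mpoly F[N]}), (k.+1 < N)%N ->
  a != k -> a != k.+1 -> a.+1 != k -> isD q k f g ->
  pair_vanish q f a a.+1 -> pair_vanish q g a a.+1.
Proof.
move=> q0 qr N k a f g kN ak ak1 a1k h vf v va; have kN' := ltnW kN.
have a1k1 : a.+1 != k.+1 by rewrite eqSS.
pose x i := if i == a then 1 else if i == a.+1 then q ^+ 2 else diff_point F k i.
apply: (density (q_inf q0 qr) (@pair_affine _ a a.+1 (q ^+ 2)) (x0 := x)
  (L := 'X_(Ordinal kN) - 'X_(Ordinal kN'))) va => [w wa||].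
- have f2 : ev f (sw k w) = 0 by apply: vf; rewrite /sw !swi_id.
  by rewrite mulrC evB !evX /= h f2 (vf w wa) subrr mulr0.
- by rewrite /x !eqxx gtn_eqF ?mulr1.
rewrite evB !evX /= /x /diff_point (eq_sym k.+1 a) (negbTE ak1) (eq_sym k.+1) (negbTE a1k1).
rewrite (eq_sym k) (negbTE ak) (eq_sym k a.+1) (negbTE a1k) eqxx gtn_eqF //.
by rewrite subr0 oner_eq0.
Qed.

Lemma isD_sum (F : fieldType) (q : F) N k I (r : seq I) (P : pred I)
    (f g : I -> {mpoly F[N]}) : (forall i, P i -> isD q k (f i) (g i)) ->
  isD q k (\sum_(i <- r | P i) f i) (\sum_(i <- r | P i) g i).
Proof.
move=> h v; rewrite !ev_sum mulr_suml -sumrB mulr_sumr.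
by apply: eq_bigr => i Pi; apply: h.
Qed.

Section PsiFamily.
Variables (n : nat) (Psi : ncm n -> pol n).
Hypothesis PsiP : is_Psi Psi.
Local Notation N := (n + n)%N.
Local Notation tau := (q + q^-1).
Implicit Types (s p t u : ncm n) (a b : 'I_N).

Lemma Psi_rec a b s p : b = a.+1 :> nat -> swapped a b s p ->
  Psi p = D_op a (Psi s) - \sum_(t in e_preim a s :\: [set s; p]) Psi t.
Proof. by move=> ab sw; apply: PsiP.2; apply: swapped_adds_box ab _ _ sw. Qed.

Lemma ncle_lt_trans s t p : ncle t s -> ncle s p -> s != p -> ncle t p /\ t != p.
Proof.
move=> ts sp ne; split; first exact: ncle_trans ts sp.
by apply: contraNneq ne => e; apply/eqP/ncle_anti => //; rewrite -e.
Qed.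

Lemma Psi_min p : min_wheel q (Psi p).
Proof.
elim/ncm_sind: p => p IH.
have [->|/last_box[s [a [b [ab sw _ _ _]]]]] := eqVneq p (nested n).
  by rewrite PsiP.1; apply: Psi0_min.
have [sp ne] := swapped_lt ab sw.
rewrite (Psi_rec ab sw); apply: min_wheelB.
  by apply: D_op_min ab _; apply: IH.
apply: min_wheel_sum => t /(preim_spec ab sw)[ts _ _].
by have [tp tne] := ncle_lt_trans ts sp ne; apply: IH.
Qed.

Lemma D_op_eigen a b f : b = a.+1 :> nat -> min_wheel q f ->
  pair_vanish q f a b -> D_op a f = tau *: f.
Proof.
move=> ab mf; rewrite ab => vf.
exact: (isD_eigen q_neq0 q_nroot ab (D_op_isD f ab) mf vf).
Qed.

Lemma Psi_vanish p a b : b = a.+1 :> nat -> p a != b -> pair_vanish q (Psi p) a b.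
Proof.
elim/ncm_sind: p a b => p IH a b ab pab v vb.
have [e|/last_box[s [i [j [ij sw sij es _]]]]] := eqVneq p (nested n).
  by rewrite e PsiP.1; apply: (Psi0_vanish ab _ vb); rewrite -e.
have [sp ne] := swapped_lt ij sw; have [si sj pi pj h] := sw.
have jN : (i.+1 < N)%N by rewrite -ij.
have ltp t : ncle t s -> ncle t p /\ t != p by move=> ts; apply: ncle_lt_trans ts sp ne.
rewrite (Psi_rec ij sw) evB ev_sum.
pose A := e_preim i s :\: [set s; p].
have vt t : t \in A -> t a != b -> ev (Psi t) v = 0.
  move=> te tab; have [ts _ _] := preim_spec ij sw te.
  by have [tp tne] := ltp t ts; apply: (IH t tp tne a b ab tab).
have vall : (forall t, t \in A -> t a != b) -> \sum_(t in A) ev (Psi t) v = 0.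
  by move=> ht; rewrite big1 // => t tA; apply: vt (ht t tA).
have vsingle t0 : t0 \in A -> (forall t, t \in A -> t != t0 -> t a != b) ->
    \sum_(t in A) ev (Psi t) v = ev (Psi t0) v.
  move=> h0 ht; rewrite (bigD1 t0) //= [X in _ + X]big1 ?addr0 //.
  by move=> t /andP[tA tn]; apply: vt (ht t tA tn).
(* Same pair as the last box: the image of D_i vanishes on it, and no t in the sum has the arch {i,
   j}. *)
have [eai|nai] := eqVneq (a : nat) i.
  have ea : a = i by apply: val_inj.
  have eb : b = j by apply: val_inj; rewrite /= ab ij eai.
  rewrite vall ?subr0.
    by apply: (isD_pair q_neq0 q_nroot jN (D_op_isD (Psi s) ij)); rewrite -ij -eb -ea.
  by move=> t /(preim_spec ij sw)[_ tij _]; rewrite ea eb.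
(* Next pair to the right: s itself arises from some t0 by adding a box at {j, b}, and t0 is the
   only term of the sum with the arch {j, b}. So D_i Psi_s has to equal Psi_t0 on the hyperplane. *)
have [eaj|naj] := eqVneq (a : nat) j.
  have ea : a = j by apply: val_inj.
  have jb : b = j.+1 :> nat by rewrite ab ea.
  have wpb : word p b.
    apply: contraT => wb; move: pab; rewrite ea.
    by rewrite (arch_adj jb pj wb) eqxx.
  have bi : b != i :> nat by lia. have bj : b != j :> nat by lia.
  have wsb : word s b by rewrite -h.
  have [t0 [sw0 t0j e0]] := ncm_lower jb sj wsb.
  have [t0s t0ne] := swapped_lt jb sw0.
  have [t0p t0pne] := ltp t0 t0s.
  have eis : e_op i t0 = s by rewrite -e0; apply: e_op_TL_right ij jb sij.
  have t0A : t0 \in A.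
    by rewrite in_setD in_set2 e_preimP negb_or t0ne t0pne; apply/eqP.
  rewrite (vsingle t0 t0A); last first.
    move=> t /(preim_spec ij sw)[_ _ et] tn; rewrite ea; apply: contraNneq tn => tj.
    apply/eqP/val_inj; rewrite /= -e0 -et; apply/esym.
    exact: e_op_TL_left ij jb tj.
  have t0i : t0 i != j.
    apply: contraTneq isT => e; have := congr1 t0 e; rewrite ncmK => ei.
    by move: bi; rewrite ei t0j eqxx.
  have v0 := IH t0 t0p t0pne i j ij t0i.
  apply/eqP; rewrite subr_eq0; apply/eqP.
  have h0 := D_op_isD (Psi t0) ij; have h1 := D_op_isD (Psi t0) jb.
  have h2 := D_op_isD (D_op j (Psi t0)) ij.
  (* On the hyperplane Psi_t0 is D_i D_j Psi_t0, and D_j Psi_t0 differs from Psi_s by terms that D_i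
     multiplies by tau and that vanish there. *)
  rewrite -(isD_TL_left q_neq0 q_nroot ij jb (Psi_min t0) v0 h0 h1 h2); last by rewrite vb ea.
  pose A0 := e_preim j t0 :\: [set t0; s].
  have hu u : u \in A0 -> [/\ pair_vanish q (Psi u) j b & pair_vanish q (Psi u) i j].
    move=> uA; have [ut0 ujb eu] := preim_spec jb sw0 uA.
    have [us une] := ncle_lt_trans ut0 t0s t0ne.
    have [up upne] := ltp u us.
    split; first exact: (IH u up upne j b jb ujb).
    apply: (IH u up upne i j ij); apply: contraNneq une => ui.
    by apply/eqP/val_inj; rewrite /= -eis -eu; apply/esym/(e_op_TL_right ij jb ui).
  have hd : isD q i (\sum_(u in A0) Psi u) (\sum_(u in A0) tau *: Psi u).
    apply: isD_sum => u uA; have [_ ui] := hu u uA.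
    by rewrite -(D_op_eigen ij (Psi_min u) ui); apply: D_op_isD ij.
  have := isD_uniq q_neq0 q_nroot jN (D_op_isD (Psi s) ij).
  rewrite (Psi_rec jb sw0) -/A0 => /(_ _ (isDB h2 hd)) ->.
  rewrite evB ev_sum [X in _ - X]big1 ?subr0 // => u uA.
  have [uj _] := hu u uA; rewrite evZ uj ?mulr0 //.
  by rewrite vb ea.
(* Next pair to the left: the mirror image of the previous case. *)
have [ebi|nbi] := eqVneq (b : nat) i.
  have eb : b = i by apply: val_inj.
  have ai : i = a.+1 :> nat by rewrite -ebi ab.
  have wpa : ~~ word p a.
    by apply: contra_neqN pab => wa; rewrite eb (arch_adj ai wa pi).
  have an_i : a != i :> nat by lia. have an_j : a != j :> nat by lia.
  have wsa : ~~ word s a by rewrite -h.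
  have [t0 [sw0 t0a e0]] := ncm_lower ai wsa si.
  have [t0s t0ne] := swapped_lt ai sw0.
  have [t0p t0pne] := ltp t0 t0s.
  have eis : e_op i t0 = s by rewrite -e0; apply: e_op_TL_left ai ij sij.
  have t0A : t0 \in A.
    by rewrite in_setD in_set2 e_preimP negb_or t0ne t0pne; apply/eqP.
  rewrite (vsingle t0 t0A); last first.
    move=> t /(preim_spec ij sw)[_ _ et] tn; rewrite eb; apply: contraNneq tn => ti.
    apply/eqP/val_inj; rewrite /= -e0 -et; apply/esym.
    exact: e_op_TL_right ai ij ti.
  have t0i : t0 i != j.
    have -> : t0 i = a by rewrite -t0a ncmK.
    by rewrite -val_eqE.
  have v0 := IH t0 t0p t0pne i j ij t0i.
  apply/eqP; rewrite subr_eq0; apply/eqP.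
  have h0 := D_op_isD (Psi t0) ij; have h1 := D_op_isD (Psi t0) ai.
  have h2 := D_op_isD (D_op a (Psi t0)) ij.
  rewrite -(isD_TL_right q_neq0 q_nroot ai ij (Psi_min t0) v0 h0 h1 h2); last by rewrite -eb vb.
  pose A0 := e_preim a t0 :\: [set t0; s].
  have hu u : u \in A0 -> [/\ pair_vanish q (Psi u) a i & pair_vanish q (Psi u) i j].
    move=> uA; have [ut0 uai eu] := preim_spec ai sw0 uA.
    have [us une] := ncle_lt_trans ut0 t0s t0ne.
    have [up upne] := ltp u us.
    split; first exact: (IH u up upne a i ai uai).
    apply: (IH u up upne i j ij); apply: contraNneq une => ui.
    by apply/eqP/val_inj; rewrite /= -eis -eu; apply/esym/(e_op_TL_left ai ij ui).
  have hd : isD q i (\sum_(u in A0) Psi u) (\sum_(u in A0) tau *: Psi u).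
    apply: isD_sum => u uA; have [_ ui] := hu u uA.
    by rewrite -(D_op_eigen ij (Psi_min u) ui); apply: D_op_isD ij.
  have := isD_uniq q_neq0 q_nroot jN (D_op_isD (Psi s) ij).
  rewrite (Psi_rec ai sw0) -/A0 => /(_ _ (isDB h2 hd)) ->.
  rewrite evB ev_sum [X in _ - X]big1 ?subr0 // => u uA.
  have [ua _] := hu u uA; rewrite evZ ua ?mulr0 //.
  by rewrite -eb vb.
(* The pairs are disjoint: e_i keeps an arch {a, b}, so neither s nor any t in the sum has it, and
   D_i preserves the vanishing. *)
have bnj : b != j :> nat by rewrite ab ij eqSS.
have psb : s a != b.
  apply: contraNneq pab => e; apply/eqP/(arch_adj ab).
    by rewrite h //; case: (arch_words ab e).
  by rewrite h //; case: (arch_words ab e).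
rewrite vall ?subr0; last first.
  move=> t /(preim_spec ij sw)[_ _ et]; apply: contraNneq psb => e.
  by apply/eqP; rewrite -et; apply: (e_op_far ij e nai naj nbi bnj).
have vs := IH s sp ne a b ab psb; rewrite ab in vs vb nbi *.
by apply: (isD_pair_far q_neq0 q_nroot jN nai _ nbi (D_op_isD (Psi s) ij) vs vb); rewrite -ij.
Qed.

Definition below p t := ncle t p && (t != p).

Lemma D_op_Psi_below a b s p u : b = a.+1 :> nat -> swapped a b s p ->
  below s u -> inspan (below p) Psi (D_op a (Psi u)).
Proof.
move=> ab sw /andP[us une]; have [sp ne] := swapped_lt ab sw.
have ltp t : ncle t s -> below p t.
  by move=> ts; have [tp tne] := ncle_lt_trans ts sp ne; rewrite /below tp.
have [uab|uab] := eqVneq (u a) b; last first.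
  rewrite (D_op_eigen ab (Psi_min u) (Psi_vanish ab uab)).
  by apply/inspanZ/inspan_gen/ltp.
(* The path of u is at least as high as that of s, to which a box can be added here; so u can be
   raised as well, and D_a Psi_u is given by the recursion. *)
have [|u' swu] := ncm_raise ab uab.
  have aN := ltn_ord b; have /ncleP us' := us.
  have := us' a (ltnW (ltn_ord a)); have := swapped_cnt ab a sw.
  have [_ _ pa _ _] := sw; have [d _] := word_dyck p.
  have := d a.+1; rewrite cntS (negbTE pa) ab ltn_eqF //; rewrite ab in aN; lia.
have -> : D_op a (Psi u) = Psi u' + \sum_(t in e_preim a u :\: [set u; u']) Psi t.
  by rewrite (Psi_rec ab swu) subrK.
apply: inspanD; last first.
  apply: inspan_sum => t /(preim_spec ab swu)[tu _ _].
  by apply/inspan_gen/ltp/(ncle_trans tu us).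
apply: inspan_gen; apply/andP; split.
  apply/ncleP => k kN; have := swapped_cnt ab k sw; have := swapped_cnt ab k swu.
  by move/ncleP: us => /(_ k kN); lia.
apply: contraNneq une => e; apply/eqP; rewrite e in swu.
exact: swapped_inj_l swu sw.
Qed.

Lemma D_pol_Psi p : inspan (below p) Psi (D_pol p - Psi p).
Proof.
elim/ncm_ind: p => [|s p a b ab sw sab es Dp [c hc]].
  by rewrite D_pol_nested PsiP.1 subrr; apply: inspan0.
have [sp ne] := swapped_lt ab sw.
have aN : (a.+1 < N)%N by rewrite -ab.
have Ds : D_pol s = Psi s + \sum_(t | below s t) c t *: Psi t by rewrite -hc addrC subrK.
have hd : isD q a (Psi s + \sum_(t | below s t) c t *: Psi t)
    (D_op a (Psi s) + \sum_(t | below s t) c t *: D_op a (Psi t)).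
  rewrite -[X in isD q a (_ + X)]opprK -[X in isD q a _ (_ + X)]opprK.
  apply: isDB; first exact: D_op_isD ab.
  rewrite -!sumrN; apply: isD_sum => t _; rewrite -!scaleNr.
  by apply: isDZ; apply: D_op_isD ab.
have e : D_pol p = D_op a (Psi s) + \sum_(t | below s t) c t *: D_op a (Psi t).
  have := D_op_isD (D_pol s) ab; rewrite -Dp Ds => hD.
  exact: (isD_uniq q_neq0 q_nroot aN hD hd).
rewrite e (Psi_rec ab sw) opprB addrAC addrCA subrr addr0.
apply: inspanD; apply: inspan_sum => t; last first.
  by move=> st; apply/inspanZ/(D_op_Psi_below ab sw st).
move=> /(preim_spec ab sw)[ts _ _]; apply: inspan_gen.
by have [tp tne] := ncle_lt_trans ts sp ne; rewrite /below tp.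
Qed.

(** Inverts the unitriangular system of [D_pol_Psi] by induction along the order. *)
Lemma Psi_D_pol p : inspan (below p) (@D_pol n) (Psi p - D_pol p).
Proof.
elim/ncm_sind: p => p IH; rewrite -opprB -scaleN1r; apply: inspanZ.
apply: inspan_trans (D_pol_Psi p) _ => t /andP[tp tne].
have -> : Psi t = (Psi t - D_pol t) + D_pol t by rewrite subrK.
apply: inspanD; last by apply: inspan_gen; rewrite /below tp.
apply: inspan_trans (IH t tp tne) _ => u /andP[ut une]; apply: inspan_gen.
by have [up upne] := ncle_lt_trans ut tp tne; rewrite /below up.
Qed.

End PsiFamily.

Theorem theorem13 (n : nat) (n_gt0 : (0 < n)%N) :
  is_basis (@wheel n) (@D_pol n) /\
  forall Psi : ncm n -> {mpoly Qq[n + n]}, is_Psi Psi ->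
  forall p : ncm n, exists c : ncm n -> Qq,
    Psi p = \sum_(t : ncm n | ncle t p) c t *: D_pol t /\ c p = 1.
Proof.
split; first exact: D_pol_basis.
move=> Psi PsiP p; have [c hc] := Psi_D_pol PsiP p.
exists (fun t => if t == p then 1 else c t); rewrite eqxx; split=> //.
rewrite (bigD1 p) /=; last exact: ncle_refl.
rewrite eqxx scale1r -[LHS](subrK (D_pol p)) hc addrC; congr (_ + _).
by apply: eq_bigr => t /andP[_ /negbTE ->].
Qed.
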